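(* Let $N\ge M>1$ be integers, let $\{X_n\}_{n\ge0}$ be an $\mathbb{R}^N$-valued i.i.d. process on $(\Omega,\mathcal F,P)$ with $E\|X_0\|^4<\infty$, and let $f(\Theta)=E\|X_0-\Theta\Theta^TX_0\|^2$ for $\Theta\in\mathbb{R}^{N\times M}$. Let $\Theta_0\in\mathbb{R}^{N\times M}$ be an arbitrary matrix and $$\Theta_{n+1}=\Theta_n+\alpha_n\big(X_nX_n^T(2\boldsymbol I-\Theta_n\Theta_n^T)-\Theta_n\Theta_n^TX_nX_n^T\big)\Theta_n,\qquad n\ge0,$$ where $\boldsymbol I$ is the $N\times N$ unit matrix and $\{\alpha_n\}_{n\ge0}$ are positive reals such that $\lim_{n\to\infty}\alpha_n=0$, $\limsup_{n\to\infty}|\alpha_{n+1}^{-1}-\alpha_n^{-1}|<\infty$, $\sum_{n=0}^\infty\alpha_n=\infty$, and $\sum_{n=0}^\infty\alpha_n^2\gamma_n^{2r}<\infty$ for some real $r\in(1,\infty)$. Then, with $p=\min\{1,r\}$: (i) $\hat\Theta=\lim_{n\to\infty}\Theta_n$ exists and satisfies $\nabla f(\hat\Theta)=0$ w.p.1 on $\{\sup_{n\ge0}\|\Theta_n\|<\infty\}$. (ii) $\|\nabla f(\Theta_n)\|^2=o(\gamma_n^{-\hat p})$, $|f(\Theta_n)-f(\hat\Theta)|=o(\gamma_n^{-\hat p})$ and $\|\Theta_n-\hat\Theta\|=o(\gamma_n^{-\hat q})$ w.p.1 on $\{\sup_{n\ge0}\|\Theta_n\|<\infty\}\cap\{\hat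 r>r\}$. (iii) $\|\nabla f(\Theta_n)\|^2=O(\gamma_n^{-\hat p})$, $|f(\Theta_n)-f(\hat\Theta)|=O(\gamma_n^{-\hat p})$ and $\|\Theta_n-\hat\Theta\|=O(\gamma_n^{-\hat q})$ w.p.1 on $\{\sup_{n\ge0}\|\Theta_n\|<\infty\}\cap\{\hat r\le r\}$. (iv) $\|\nabla f(\Theta_n)\|^2=o(\gamma_n^{-p})$ and $|f(\Theta_n)-f(\hat\Theta)|=o(\gamma_n^{-p})$ w.p.1 on $\{\sup_{n\ge0}\|\Theta_n\|<\infty\}$.
   Context: Matrices in $\mathbb{R}^{N\times M}$ are identified with vectors in $\mathbb{R}^{NM}$ listing their entries, $\|\cdot\|$ is the Euclidean norm under this identification, and $\nabla f(\Theta)$ is the $N\times M$ matrix of partial derivatives of $f$ with respect to the entries of $\Theta$. $\gamma_0=0$ and $\gamma_n=\sum_{i=0}^{n-1}\alpha_i$ for $n\ge1$. ''W.p.1 on an event $\Lambda$'' means for all $\omega\in\Lambda$ outside a null set; $o,O$ are pathwise as $n\to\infty$ (constants may be random). For each $\Theta\in\mathbb{R}^{N\times M}$ fix $\delta_\Theta\in(0,1]$, $\mu_\Theta\in(1,2]$, $M_\Theta\in[1,\infty)$ such that $|f(\Theta')-f(\Theta)|\le M_\Theta\|\nabla f(\Theta')\|^{\mu_\Theta}$ for all $\Theta'$ with $\|\Theta'-\Theta\|\le\delta_\Theta$ (such constants exist by the Lojasiewicz gradient inequality, $f$ being real-analytic). Put $r_\Theta=1/(2-\mu_\Theta)$ if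 $\mu_\Theta<2$ and $r_\Theta=\infty$ if $\mu_\Theta=2$; $p_\Theta=\mu_\Theta\min\{r,r_\Theta\}$; $q_\Theta=\min\{r,r_\Theta\}-1$. Then $\hat r=r_{\hat\Theta}$, $\hat p=p_{\hat\Theta}$, $\hat q=q_{\hat\Theta}$. *)

(* Defs.v *)
From HB Require Import structures.
From mathcomp Require Import all_boot all_order all_algebra.
From mathcomp Require Import finmap.
From mathcomp Require Import all_classical all_reals all_analysis.

Set Implicit Arguments.
Unset Strict Implicit.
Unset Printing Implicit Defensive.

Import Order.TTheory GRing.Theory Num.Theory.
Import numFieldNormedType.Exports.

Local Open Scope classical_set_scope.
Local Open Scope ring_scope.

(* The canonical norm `|A| of a matrix type in MathComp-Analysis is the max
   norm; it induces the same topology as [enorm], but is not Euclidean. *)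
Definition enorm (R : realType) (m n : nat) (A : 'M[R]_(m, n)) : R :=
  Num.sqrt (\sum_i \sum_j A i j ^+ 2).

Definition grad (R : realType) (m n : nat) (f : 'M[R]_(m, n) -> R)
    (Theta : 'M[R]_(m, n)) : 'M[R]_(m, n) :=
  \matrix_(i, j) 'D_(delta_mx i j) f Theta.

Definition borel_mx (R : realType) (m n : nat) :=
  g_sigma_algebraType (@open 'M[R]_(m, n)).

Definition mutually_independent (d d' : measure_display)
    (Omega : measurableType d) (U : measurableType d') (R : realType)
    (P : probability Omega R) (X : nat -> Omega -> U) : Prop :=
  forall (J : {fset nat}) (B : nat -> set U),
    (forall j, measurable (B j)) ->
    P (\bigcap_(j in [set` J]) (X j @^-1` B j)) =
    (\big[*%E/1]_(j <- J) P (X j @^-1` B j))%E.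

Definition identically_distributed (d d' : measure_display)
    (Omega : measurableType d) (U : measurableType d') (R : realType)
    (P : probability Omega R) (X : nat -> Omega -> U) : Prop :=
  forall (n : nat) (B : set U), measurable B ->
    P (X n @^-1` B) = P (X 0%N @^-1` B).

Definition iid (d d' : measure_display)
    (Omega : measurableType d) (U : measurableType d') (R : realType)
    (P : probability Omega R) (X : nat -> Omega -> U) : Prop :=
  [/\ forall n, measurable_fun setT (X n),
      mutually_independent P X & identically_distributed P X].

Definition gamma (R : realType) (alpha : nat -> R) (n : nat) : R :=
  \sum_(i < n) alpha i.

(* The next four definitions take the Lojasiewicz exponent mu_Theta, not
   Theta itself. *)
Definition r_exp (R : realType) (mu : R) : \bar R :=
  if mu < 2 then ((2 - mu)^-1)%:E else +oo%E.

(* The minimum is finite, so [fine] loses nothing. *)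
Definition min_exp (R : realType) (r mu : R) : R :=
  fine (Order.min r%:E (r_exp mu)).

Definition p_exp (R : realType) (r mu : R) : R := mu * min_exp r mu.

Definition q_exp (R : realType) (r mu : R) : R := min_exp r mu - 1.

(* Main.v *)
Require Import Defs.
From HB Require Import structures.
From mathcomp Require Import all_boot all_order all_algebra.
From mathcomp Require Import finmap.
From mathcomp Require Import all_classical all_reals all_analysis.
From mathcomp Require Import measurable_realfun.
From mathcomp Require Import zify ring lra.

Set Implicit Arguments.
Unset Strict Implicit.
Unset Printing Implicit Defensive.

Import Order.TTheory GRing.Theory Num.Theory.
Import numFieldNormedType.Exports.

Local Open Scope classical_set_scope.
Local Open Scope ring_scope.


(** Let C = E X_0 X_0^T and R(A) = I - A A^T. Then f(A) = tr (R(A) C R(A)) is a polynomial of degree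
    four, and the recursion reads
      Theta_(n+1) = Theta_n + alpha_n (- grad f(Theta_n) / 2 + xi_n),
    where xi_n is linear in X_n X_n^T - C: it is gradient descent with random errors. The proof has a
    probabilistic half, which shows that the errors are summable, and a deterministic half, which
    studies one path on which they are.

    Probabilistic half. Each entry of xi_n is a finite sum of products h(X_n) H_n, with h(X_n) centred
    and of finite variance, and H_n a polynomial in Theta_n, a function of X_0, .., X_(n-1). If
    H_n is replaced with 0 when |Theta_n|^2 exceeds a level q, the terms
    alpha_n gamma_n^r h(X_n) H_n are orthogonal, and their variances are bounded by a multiple of
    alpha_n^2 gamma_n^(2r), which is summable. Kolmogorov's maximal inequality makes the series of
    these terms converge almost surely ([weighted_noise_cvg]). On a bounded path a large enough integer
    q changes nothing, so the series of alpha_n gamma_n^r xi_n converges ([oja_noise_cvg]), and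
    summation by parts shows that the tails T_n of the series of alpha_n xi_n are o(gamma_n^(-r))
    ([weighted_tail]).

    Deterministic half. Y_n = Theta_n + T_n performs a gradient step up to an error bounded by a
    multiple of |T_n|, hence by b_n = eps_n gamma_n^(-r) with eps_n decreasing to 0. As the sum of the
    alpha_n b_n is finite, the values f(Y_n) converge. Let A be a cluster point of Y_n, and put
    w_n = f(Y_n) - f(A) and g_n = |grad f(Y_n)|. Near A the Lojasiewicz inequality |w| <= K g^mu makes
    a regularized signed power of w, of exponent 1 - 1/mu, a potential whose decrease at each step
    dominates the length of the step ([length_potential_step]). A path that comes close enough to A
    therefore stays close, Y_n tends to A ([trapped_cvg]), and the distance to A is bounded by the
    potential ([distance_le_potential]).

    Rates. Where w > 0 the inequality turns the descent into
      w_(n+1) <= w_n - c alpha_n w_n^(2/mu) + 3 alpha_n b_n^2,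
    which is compared with barriers gamma^(-q) ([barrier]). Without noise the decay is
    gamma^(-mu/(2 - mu)); the noise alone would allow o(gamma^(-mu r)). The slower of the two wins,
    according to the position of r with respect to 1/(2 - mu) ([upper_rate_bigO],
    [upper_rate_littleo]). Below, w cannot pass a multiple of - b_n^mu, since it would go on decreasing
    instead of tending to 0 ([lower_rate]). The gradient is controlled by the value, since a gradient
    that varies slowly forces a drop of the value proportional to its square ([gradient_window]), and
    the distance is controlled by the potential. Both exponents mu r and mu/(2 - mu) exceed 1, whence
    the last claim ([rate_O_gap]). *)

(** * Powers with real exponents *)

Section PowerInequalities.
Variable R : realType.
Implicit Types x y q s B h w m : R.

Lemma powR_mvt x y q : 0 < x -> x <= y ->
  exists2 c, x <= c <= y & y `^ q - x `^ q = q * c `^ (q - 1) * (y - x).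
Proof.
move=> x0 xy.
have [|||c] := @MVT_segment R (fun z => z `^ q) (fun z => q * z `^ (q - 1)) x y.
- exact: xy.
- move=> z; rewrite in_itv/= => /andP[xz _].
  by apply: is_derive1_powR; exact: lt_trans xz.
- apply: derivable_within_continuous => z; rewrite in_itv/= => /andP[xz _].
  by apply: derivable_powR; rewrite in_itv/= andbT (lt_le_trans x0).
- by rewrite in_itv/= => ? ?; exists c.
Qed.

Lemma powR_mono x y q : 0 <= x -> x <= y -> 0 <= q -> x `^ q <= y `^ q.
Proof.
move=> x0 xy q0; have y0 := le_trans x0 xy.
by have := @ge0_ler_powR R q q0 x y; rewrite !nnegrE => /(_ x0 y0 xy).
Qed.

Lemma powR_anti x y q : 0 < x -> x <= y -> q <= 0 -> y `^ q <= x `^ q.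
Proof.
move=> x0 xy q0; have y0 : 0 < y by exact: lt_le_trans xy.
rewrite -[q]opprK !(powRN _ (- q)) lef_pV2 ?posrE ?powR_gt0//.
by apply: powR_mono; rewrite ?oppr_ge0// ltW.
Qed.

Lemma powR_concave_le x y s : 0 < x -> x <= y -> 0 <= s -> s <= 1 ->
  y `^ s - x `^ s <= s * x `^ (s - 1) * (y - x).
Proof.
move=> x0 xy s0 s1; have [c /andP[xc cy] ->] := powR_mvt s x0 xy.
rewrite ler_wpM2r ?subr_ge0// ler_wpM2l//.
by apply: powR_anti => //; rewrite subr_le0.
Qed.

Lemma powR_concave_ge x y s : 0 < x -> x <= y -> 0 <= s -> s <= 1 ->
  s * y `^ (s - 1) * (y - x) <= y `^ s - x `^ s.
Proof.
move=> x0 xy s0 s1; have [c /andP[xc cy] ->] := powR_mvt s x0 xy.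
rewrite ler_wpM2r ?subr_ge0// ler_wpM2l//.
by apply: powR_anti => //; [exact: lt_le_trans xc|rewrite subr_le0].
Qed.

Lemma powRN_diff_le x y q : 0 < x -> x <= y -> 0 <= q ->
  x `^ (- q) - y `^ (- q) <= q * x `^ (- q - 1) * (y - x).
Proof.
move=> x0 xy q0; have [c /andP[xc cy]] := powR_mvt (- q) x0 xy.
rewrite -opprB => /eqP; rewrite eqr_oppLR => /eqP ->.
rewrite !mulNr opprK ler_wpM2r ?subr_ge0// ler_wpM2l//.
by apply: powR_anti => //; lra.
Qed.

Lemma powRN_diff_ge x y q : 0 < x -> x <= y -> 0 <= q ->
  q * y `^ (- q - 1) * (y - x) <= x `^ (- q) - y `^ (- q).
Proof.
move=> x0 xy q0; have [c /andP[xc cy]] := powR_mvt (- q) x0 xy.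
rewrite -opprB => /eqP; rewrite eqr_oppLR => /eqP ->.
rewrite !mulNr opprK ler_wpM2r ?subr_ge0// ler_wpM2l//.
by apply: powR_anti => //; [exact: lt_le_trans xc|lra].
Qed.

(** Increments of a concave function over intervals of a fixed length decrease. *)
Lemma powR_incr_anti x y h s : 0 < x -> x <= y -> 0 <= h -> 0 <= s -> s <= 1 ->
  (y + h) `^ s - y `^ s <= (x + h) `^ s - x `^ s.
Proof.
move=> x0 xy h0 s0 s1; have y0 : 0 < y by exact: lt_le_trans xy.
have [yxh|xhy] := leP y (x + h).
  have H1 : (y + h) `^ s - (x + h) `^ s <= s * (x + h) `^ (s - 1) * (y - x).
    rewrite [leRHS](_ : _ = s * (x + h) `^ (s - 1) * ((y + h) - (x + h))).
      by apply: powR_concave_le => //; lra.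
    by congr (_ * _); lra.
  have H2 := powR_concave_ge x0 xy s0 s1.
  have H3 : s * (x + h) `^ (s - 1) * (y - x) <= s * y `^ (s - 1) * (y - x).
    rewrite ler_wpM2r ?subr_ge0// ler_wpM2l//.
    by apply: powR_anti => //; rewrite subr_le0.
  lra.
have H1 : (y + h) `^ s - y `^ s <= s * y `^ (s - 1) * h.
  rewrite [leRHS](_ : _ = s * y `^ (s - 1) * (y + h - y)).
    by apply: powR_concave_le => //; lra.
  by congr (_ * _); lra.
have H2 : s * (x + h) `^ (s - 1) * h <= (x + h) `^ s - x `^ s.
  rewrite [leLHS](_ : _ = s * (x + h) `^ (s - 1) * (x + h - x)).
    by apply: powR_concave_ge => //; lra.
  by congr (_ * _); lra.
have H3 : s * y `^ (s - 1) * h <= s * (x + h) `^ (s - 1) * h.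
  rewrite ler_wpM2r// ler_wpM2l//.
  by apply: powR_anti; [lra|exact: ltW|rewrite subr_le0].
lra.
Qed.

(** sign(w) ((|w| + B)^s - B^s): an odd version of the power w^s, which linearizes the Lojasiewicz
    inequality when s = 1 - 1/mu; the shift B keeps the slope at 0 finite. *)
Definition signed_power s B w : R :=
  if 0 <= w then (w + B) `^ s - B `^ s else B `^ s - (B - w) `^ s.

(** The slope of [signed_power] is largest at the origin, where it is s B^(s - 1). *)
Lemma signed_power_up s B w w' : 0 <= s -> s <= 1 -> 0 < B -> w <= w' ->
  signed_power s B w' - signed_power s B w <= s * B `^ (s - 1) * (w' - w).
Proof.
move=> s0 s1 B0 ww'; rewrite /signed_power.
have up x y : B <= x -> x <= y -> y `^ s - x `^ s <= s * B `^ (s - 1) * (y - x).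
  move=> Bx xy; have x0 : 0 < x by exact: lt_le_trans Bx.
  apply: le_trans (powR_concave_le x0 xy s0 s1) _.
  rewrite ler_wpM2r ?subr_ge0// ler_wpM2l//.
  by apply: powR_anti => //; rewrite subr_le0.
case: (leP 0 w) => [w0|w0]; first rewrite (le_trans w0 ww').
  have := @up (w + B) (w' + B); rewrite (_ : w' + B - (w + B) = w' - w); last lra.
  by move=> H; have {}H := H ltac:(lra) ltac:(lra); lra.
case: (leP 0 w') => [w'0|w'0].
  have H1 := up B (w' + B) (lexx _) ltac:(lra).
  have H2 := up B (B - w) (lexx _) ltac:(lra).
  have -> : s * B `^ (s - 1) * (w' - w) =
    s * B `^ (s - 1) * (w' + B - B) + s * B `^ (s - 1) * (B - w - B) by ring.
  lra.
have := @up (B - w') (B - w); rewrite (_ : B - w - (B - w') = w' - w); last lra.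
by move=> H; have {}H := H ltac:(lra) ltac:(lra); lra.
Qed.

(** On [-m, m] the slope of [signed_power] is smallest at the endpoints. *)
Lemma signed_power_low s B w w' m : 0 <= s -> s <= 1 -> 0 < B -> w' <= w ->
  `|w| <= m -> `|w'| <= m ->
  s * (m + B) `^ (s - 1) * (w - w') <= signed_power s B w - signed_power s B w'.
Proof.
move=> s0 s1 B0 ww'; rewrite !ler_norml => /andP[mw wm] /andP[mw' wm'].
rewrite /signed_power.
have lo x y : 0 < x -> x <= y -> y <= m + B ->
    s * (m + B) `^ (s - 1) * (y - x) <= y `^ s - x `^ s.
  move=> x0 xy ym; apply: le_trans (powR_concave_ge x0 xy s0 s1).
  rewrite ler_wpM2r ?subr_ge0// ler_wpM2l//.
  by apply: powR_anti => //; [exact: lt_le_trans xy|rewrite subr_le0].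
case: (leP 0 w') => [w0|w0]; first rewrite (le_trans w0 ww').
  have := @lo (w' + B) (w + B); rewrite (_ : w + B - (w' + B) = w - w'); last lra.
  by move=> H; have {}H := H ltac:(lra) ltac:(lra) ltac:(lra); lra.
case: (leP 0 w) => [w'0|w'0].
  have H1 := lo B (w + B) B0 ltac:(lra) ltac:(lra).
  have H2 := lo B (B - w') B0 ltac:(lra) ltac:(lra).
  have -> : s * (m + B) `^ (s - 1) * (w - w') =
    s * (m + B) `^ (s - 1) * (w + B - B) +
    s * (m + B) `^ (s - 1) * (B - w' - B) by ring.
  lra.
have := @lo (B - w) (B - w'); rewrite (_ : B - w' - (B - w) = w - w'); last lra.
by move=> H; have {}H := H ltac:(lra) ltac:(lra) ltac:(lra); lra.
Qed.

(** The shift B may be lowered from one step to the next: with B^s added, the signed power can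
    only decrease. For negative w this is the decrease of the increments of a concave function. *)
Lemma signed_power_shift s B B' w : 0 <= s -> s <= 1 -> 0 < B' -> B' <= B ->
  signed_power s B' w + B' `^ s <= signed_power s B w + B `^ s.
Proof.
move=> s0 s1 B0 BB; rewrite /signed_power.
have BBs : B' `^ s <= B `^ s by apply: powR_mono => //; exact: ltW.
case: (leP 0 w) => [w0|w0].
  have : (w + B') `^ s <= (w + B) `^ s by apply: powR_mono => //; lra.
  lra.
have := powR_incr_anti B0 BB (ltac:(lra) : 0 <= - w) s0 s1.
lra.
Qed.

Lemma signed_power_bound s B w : 0 <= s -> s <= 1 -> 0 < B ->
  `|signed_power s B w| <= (`|w| + B) `^ s.
Proof.
move=> s0 s1 B0; rewrite /signed_power.
have H x : 0 <= x -> B `^ s <= (x + B) `^ s.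
  by move=> x0; apply: powR_mono => //; lra.
have B0' : 0 <= B `^ s by exact: powR_ge0.
case: (leP 0 w) => [w0|w0].
  rewrite ger0_norm//; last by have := H _ w0; lra.
  by rewrite ger0_norm//; lra.
have w0' : 0 <= - w by lra.
rewrite [ `|w|]ltr0_norm// (_ : B - w = - w + B); last by rewrite addrC.
have Hw := H _ w0'; rewrite ler0_norm; lra.
Qed.

End PowerInequalities.

(** * A potential that dominates the length of the path *)

Lemma cvg_powR0 (R : realType) (u : nat -> R) (s : R) : 0 < s ->
  (forall n, 0 <= u n) -> u n @[n --> \oo] --> 0 ->
  u n `^ s @[n --> \oo] --> 0.
Proof.
move=> s0 u0 /cvgrPdist_le ucv; apply/cvgrPdist_le => e e0.
have := ucv (e `^ s^-1) (powR_gt0 _ e0).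
apply: filterS => n; rewrite !sub0r !normrN !ger0_norm ?powR_ge0// => une.
have := powR_mono (u0 n) une (ltW s0).
by rewrite -powRrM mulVf ?gt_eqF// powRr1// ltW.
Qed.

Lemma cvg0_eventually (R : realType) (u : nat -> R) (e : R) :
  u n @[n --> \oo] --> 0 -> 0 < e ->
  exists n0, forall n, (n0 <= n)%N -> `|u n| <= e.
Proof.
move=> /cvgrPdist_le ucv e0; have [n0 _ H] := ucv e e0.
by exists n0 => n nn; have := H n nn; rewrite sub0r normrN.
Qed.

(** The setting: [w] are values measured from the value at a cluster point A, [g] the gradient
    norms, [D] the distances to A, [a] the step sizes, [b] a bound of the noise, and [tau] a bound
    of the remaining sum of a n * b n. The Lojasiewicz inequality is available only while D n <= delta,
    so that trapping the path near A is part of the argument. *)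
Section Potential.
Variable R : realType.
Variables (a b w g D tau : nat -> R) (mu K delta Gm : R).
Hypothesis a_gt0 : forall n, 0 < a n.
Hypothesis a_le1 : forall n, a n <= 1.
Hypothesis b_gt0 : forall n, 0 < b n.
Hypothesis b_noninc : forall n, b n.+1 <= b n.
Hypothesis g_ge0 : forall n, 0 <= g n.
Hypothesis g_le : forall n, g n <= Gm.
Hypothesis mu_bnd : 1 < mu <= 2.
Hypothesis K_ge1 : 1 <= K.
Hypothesis descent : forall n,
  w n.+1 <= w n - a n * g n ^+ 2 / 4 + 3 * a n * b n ^+ 2.
Hypothesis w_step : forall n, `|w n.+1 - w n| <= a n * (g n ^+ 2 + 3 * b n ^+ 2).
Hypothesis D_step : forall n, `|D n.+1 - D n| <= a n * (g n + b n).
Hypothesis lojasiewicz : forall n, D n <= delta -> `|w n| <= K * g n `^ mu.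
Hypothesis tau_step : forall n, a n * b n <= tau n - tau n.+1.

Let s : R := 1 - mu^-1.

Lemma mu_gt0 : 0 < mu. Proof. by case/andP: mu_bnd => m1 m2; lra. Qed.

Lemma s_bnd : 0 < s <= 1.
Proof.
have m0 := mu_gt0; case/andP: mu_bnd => m1 m2; rewrite /s.
have i0 : 0 < mu^-1 by rewrite invr_gt0.
have i1 : mu^-1 < 1 by rewrite invf_lt1.
lra.
Qed.

Lemma powR_mu_s x : 0 < x -> (x `^ mu) `^ (s - 1) = x^-1.
Proof.
move=> x0; rewrite -powRrM /s.
rewrite (_ : mu * _ = -1) ?powR_inv1 ?ltW//.
by rewrite addrAC subrr add0r mulrN divff// gt_eqF// mu_gt0.
Qed.

Let K' : R := K + 2 * (1 + Gm) + 1.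
Let C1 : R := 16 / (s * K' `^ (s - 1)).
Let C2 : R := 6 + 3 * C1.

(** Along a gradient flow, |w|^(1 - 1/mu) decreases at least as fast as the length of the path
    grows. The signed power is used because noise can push [w] below 0; its shift b^mu is the size
    of [w] under which noise dominates the gradient, and C2 tau pays for the moves due to noise. *)
Definition length_potential n : R :=
  C1 * (signed_power s (b n `^ mu) (w n) + (b n `^ mu) `^ s) + C2 * tau n.

Let K'_gt0 : 0 < K'.
Proof. have G0 := le_trans (g_ge0 0) (g_le 0); have K1 := K_ge1; rewrite /K'; lra. Qed.

Let C1_gt0 : 0 < C1.
Proof.
case/andP: s_bnd => s0 _.
by rewrite /C1 divr_gt0// mulr_gt0// powR_gt0.
Qed.

(** If g n <= 5 b n, the step is of the order of the noise and is paid for by [tau]. Otherwise the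
    noise is absorbed, [w] decreases by at least a g^2 / 8, and the Lojasiewicz inequality bounds
    the slope of the signed power from below by a multiple of 1 / g. *)
Lemma length_potential_step n : D n <= delta ->
  a n * (g n + b n) <= length_potential n - length_potential n.+1.
Proof.
move=> Dn; case/andP: (s_bnd) => s0 s1; case/andP: (mu_bnd) => mu1 mu2.
have s0' := ltW s0; have K1 := K_ge1; have Gn := g_le n.
have mu0 := mu_gt0.
have B0 := powR_gt0 mu (b_gt0 n); have B'0 := powR_gt0 mu (b_gt0 n.+1).
have a0 := a_gt0 n; have b0 := b_gt0 n; have g0 := g_ge0 n.
have BB : b n.+1 `^ mu <= b n `^ mu.
  by apply: powR_mono; [exact: ltW|exact: b_noninc|exact: ltW].
have shift := signed_power_shift (w n.+1) s0' s1 B'0 BB.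
have ts := tau_step n.
have dsc := descent n.
rewrite /length_potential.
set P := signed_power s (b n `^ mu) (w n) in shift *.
set P' := signed_power s (b n `^ mu) (w n.+1) in shift *.
set P'' := signed_power s (b n.+1 `^ mu) (w n.+1) in shift *.
set Bs := (b n `^ mu) `^ s in shift *.
set B's := (b n.+1 `^ mu) `^ s in shift *.
suff : a n * (g n + b n) <= C1 * (P - P') + C2 * (a n * b n).
  have : C1 * (P' + Bs - (P'' + B's)) >= 0 by rewrite mulr_ge0 ?(ltW C1_gt0)// subr_ge0.
  have : C2 * (tau n - tau n.+1 - a n * b n) >= 0.
    by rewrite mulr_ge0 ?subr_ge0// /C2; have := C1_gt0; lra.
  lra.
have ab0 : 0 < a n * b n by rewrite mulr_gt0.
have [gb|bg] := leP (g n) (5 * b n).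
  have ag : a n * g n <= 5 * (a n * b n).
    by rewrite mulrCA ler_wpM2l// ltW.
  have : C1 * (P' - P) <= 3 * C1 * (a n * b n).
    rewrite (_ : 3 * C1 * _ = C1 * (3 * (a n * b n))); last ring.
    rewrite ler_wpM2l ?(ltW C1_gt0)//.
    have [ww|ww] := leP (w n) (w n.+1).
      have := signed_power_up s0' s1 B0 ww; rewrite -/P -/P' powR_mu_s//.
      move=> /le_trans; apply.
      have -> : 3 * (a n * b n) = 1 * (b n)^-1 * (3 * a n * b n ^+ 2).
        by field; rewrite gt_eqF.
      have dw : w n.+1 - w n <= 3 * a n * b n ^+ 2.
        have : 0 <= a n * g n ^+ 2 by rewrite mulr_ge0 ?sqr_ge0 ?ltW.
        lra.
      apply: ler_pM => //.
      - by rewrite mulr_ge0 ?invr_ge0 ?ltW.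
      - by rewrite subr_ge0.
      - by rewrite ler_wpM2r// invr_ge0 ltW.
    have := @signed_power_low R s _ _ _ (Num.max `|w n| `|w n.+1|) s0' s1 B0 (ltW ww).
    rewrite !le_max !lexx orbT => /(_ isT isT); rewrite -/P -/P'.
    have : 0 <= s * (Num.max `|w n| `|w n.+1| + b n `^ mu) `^ (s - 1) * (w n - w n.+1).
      apply: mulr_ge0; last by rewrite subr_ge0 ltW.
      by apply: mulr_ge0; rewrite ?powR_ge0.
    lra.
  rewrite /C2; lra.
have g1 : 0 < g n by apply: lt_trans bg; rewrite mulr_gt0.
have bb : 25 * b n ^+ 2 <= g n ^+ 2.
  rewrite (_ : 25 * _ = (5 * b n) ^+ 2); last ring.
  by rewrite ler_sqr ?nnegrE ?ltW// mulr_gt0.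
have abb : 3 * a n * b n ^+ 2 <= a n * g n ^+ 2 / 8.
  have : a n * (25 * b n ^+ 2) <= a n * g n ^+ 2 by rewrite ler_wpM2l ?(ltW a0).
  have : 0 <= a n * b n ^+ 2 by rewrite mulr_ge0 ?sqr_ge0 ?ltW.
  lra.
have dw : a n * g n ^+ 2 / 8 <= w n - w n.+1 by lra.
have ag2 : 0 < a n * g n ^+ 2 by rewrite mulr_gt0// exprn_gt0.
have ww : w n.+1 <= w n by lra.
have gmu0 := powR_gt0 mu g1.
have g2 : g n ^+ 2 <= (1 + Gm) * g n `^ mu.
  have -> : g n ^+ 2 = g n `^ (2 - mu) * g n `^ mu.
    rewrite -powRD; last by rewrite (gt_eqF g1) implybT.
    by rewrite subrK powR_mulrn.
  rewrite ler_wpM2r ?powR_ge0//.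
  apply: (@le_trans _ _ ((1 + Gm) `^ (2 - mu))).
    by apply: powR_mono => //; have := g_le n; lra.
  by apply: ler1_powR; have := g_le n; lra.
have m1 : `|w n| <= K * g n `^ mu + 2 * (1 + Gm) * g n `^ mu.
  apply: le_trans (lojasiewicz Dn) _; rewrite lerDl !mulr_ge0 ?powR_ge0//.
  by have := g_le n; lra.
have m2 : `|w n.+1| <= K * g n `^ mu + 2 * (1 + Gm) * g n `^ mu.
  have h1 := lojasiewicz Dn; have h2 := w_step n.
  have h3 : a n * (g n ^+ 2 + 3 * b n ^+ 2) <= 1 * (2 * g n ^+ 2).
    have b2 := sqr_ge0 (b n).
    by apply: ler_pM => //; [exact: ltW|lra|lra].
  have := ler_normD (w n) (w n.+1 - w n); rewrite addrC subrK.
  lra.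
have := signed_power_low s0' s1 B0 ww m1 m2; rewrite -/P -/P'.
set m := (X in (X + b n `^ mu) `^ _).
have mB : m + b n `^ mu <= K' * g n `^ mu.
  have : b n `^ mu <= g n `^ mu by apply: powR_mono; lra.
  by rewrite /m /K'; lra.
have mB0 : 0 < m + b n `^ mu.
  by rewrite ltr_wpDl// (le_trans _ m1).
have low : K' `^ (s - 1) * (g n)^-1 <= (m + b n `^ mu) `^ (s - 1).
  rewrite -(powR_mu_s g1) -(powRM (s - 1) (ltW K'_gt0) (ltW gmu0)).
  by apply: powR_anti; rewrite ?subr_le0.
move=> PP.
have {}PP : 2 * a n * g n <= C1 * (P - P').
  apply: (@le_trans _ _ (C1 * (s * (K' `^ (s - 1) * (g n)^-1) * (a n * g n ^+ 2 / 8)))).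
    have KK : K' `^ (s - 1) != 0 by rewrite gt_eqF// powR_gt0.
    rewrite [leRHS](_ : _ = 2 * a n * g n)// /C1; field.
    by rewrite (gt_eqF g1) KK (gt_eqF s0).
  rewrite ler_wpM2l ?(ltW C1_gt0)//; apply: le_trans PP.
  apply: ler_pM => //.
  - by rewrite !mulr_ge0 ?powR_ge0 ?invr_ge0.
  - by rewrite divr_ge0// ltW.
  - by rewrite ler_wpM2l.
have : 0 <= C2 * (a n * b n).
  by rewrite mulr_ge0 ?ltW// /C2; have := C1_gt0; lra.
have : a n * b n <= a n * g n by rewrite ler_wpM2l ?ltW//; lra.
lra.
Qed.

Hypothesis D_ge0 : forall n, 0 <= D n.
Hypothesis w_cvg : w n @[n --> \oo] --> 0.
Hypothesis b_cvg : b n @[n --> \oo] --> 0.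
Hypothesis tau_ge0 : forall n, 0 <= tau n.
Hypothesis tau_cvg : tau n @[n --> \oo] --> 0.

Lemma length_potential_bound n :
  `|length_potential n| <= 2 * C1 * (`|w n| + b n `^ mu) `^ s + C2 * tau n.
Proof.
case/andP: (s_bnd) => s0 s1; have C10 := C1_gt0.
have B0 := powR_gt0 mu (b_gt0 n).
have h := signed_power_bound (w n) (ltW s0) s1 B0.
have h2 : (b n `^ mu) `^ s <= (`|w n| + b n `^ mu) `^ s.
  by apply: powR_mono; rewrite ?(ltW B0) ?(ltW s0)// lerDr.
rewrite /length_potential; apply: le_trans (ler_normD _ _) _.
apply: lerD; last first.
  by rewrite normrM (ger0_norm (tau_ge0 n)) ger0_norm// /C2; lra.
rewrite normrM (gtr0_norm C10) [leRHS](_ : _ = C1 * (2 * (`|w n| + b n `^ mu) `^ s)).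
  rewrite ler_wpM2l ?(ltW C10)//; apply: le_trans (ler_normD _ _) _.
  by rewrite [X in _ + X]ger0_norm ?powR_ge0//; lra.
ring.
Qed.

Lemma length_potential_cvg : length_potential n @[n --> \oo] --> 0.
Proof.
case/andP: (s_bnd) => s0 s1; apply/norm_cvg0P.
apply: (@squeeze_cvgr _ _ _ _ (fun=> 0)
  (fun n => 2 * C1 * (`|w n| + b n `^ mu) `^ s + C2 * tau n)).
- by apply: nearW => n; rewrite normr_ge0 length_potential_bound.
- exact: cvg_cst.
- rewrite -[X in _ --> X](_ : 2 * C1 * 0 + C2 * 0 = 0); last by rewrite !mulr0 addr0.
  apply: cvgD; apply: cvgMr => //; apply: cvg_powR0 => //.
    by move=> n; rewrite addr_ge0 ?powR_ge0.
  rewrite -[X in _ --> X](addr0 0); apply: cvgD; first exact/norm_cvg0P.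
  by apply: cvg_powR0 mu_gt0 _ b_cvg => n; exact: ltW.
Qed.

Hypothesis delta_gt0 : 0 < delta.
Hypothesis D_frequently : forall e, 0 < e -> forall n,
  exists2 m, (n <= m)%N & D m <= e.

(** D + potential decreases as long as D n <= delta; since the potential tends to 0, a visit close
    enough to A at a late time can never be followed by an exit. *)
Lemma trapped e : 0 < e -> e <= delta ->
  exists n1, forall n, (n1 <= n)%N -> D n <= e.
Proof.
move=> e0 ed; have e4 : 0 < e / 4 by rewrite divr_gt0.
have [N HN] := cvg0_eventually length_potential_cvg e4.
have [n1 Nn1 Dn1] := D_frequently e4 N.
exists n1.
have H k : D (n1 + k)%N <= e /\
    D (n1 + k)%N + length_potential (n1 + k)%N <= D n1 + length_potential n1.
  elim: k => [|k [IH1 IH2]]; first by rewrite addn0; split => //; lra.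
  have := length_potential_step (le_trans IH1 ed); have := D_step (n1 + k)%N.
  rewrite !addnS; rewrite ler_norml => /andP[_ s1] s2.
  have h1 := HN _ Nn1; have h2 := HN (n1 + k).+1 (leqW (leq_trans Nn1 (leq_addr _ _))).
  move: h1 h2; rewrite !ler_norml => /andP[h1 h1'] /andP[h2 h2'].
  by split; lra.
by move=> n nn; have [] := H (n - n1)%N; rewrite subnKC.
Qed.

Lemma trapped_cvg : D n @[n --> \oo] --> 0.
Proof.
apply/cvgrPdist_le => e e0.
have [n1 H] := @trapped (Num.min e delta) ltac:(by rewrite lt_min e0)
  ltac:(by rewrite ge_min lexx orbT).
exists n1 => // n nn /=; rewrite sub0r normrN ger0_norm//.
by apply: le_trans (H _ nn) _; rewrite ge_min lexx.
Qed.

(** Once the path is trapped, D - potential increases to the limit 0, so that the potential at time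
    n, which is the length of the remaining path up to constants, dominates D n. *)
Lemma distance_le_potential : exists Ca Cb, [/\ 0 <= Ca, 0 <= Cb &
  exists n1, forall n, (n1 <= n)%N ->
    D n <= delta /\
    D n <= Ca * (`|w n| + b n `^ mu) `^ (1 - mu^-1) + Cb * tau n].
Proof.
exists (2 * C1), C2; split.
- by rewrite mulr_ge0 ?(ltW C1_gt0).
- by have := C1_gt0; rewrite /C2; lra.
have [n1 H] := trapped delta_gt0 (lexx _).
exists n1 => n nn; split; first exact: H.
apply: le_trans (length_potential_bound n).
apply: le_trans (ler_norm _).
rewrite leNgt; apply/negP => lt.
have e4 : 0 < (D n - length_potential n) / 4 by rewrite divr_gt0// subr_gt0.
have [N1 H1] := cvg0_eventually length_potential_cvg e4.
have [N2 H2] := cvg0_eventually trapped_cvg e4.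
have mono k : D n - length_potential n <=
    D (n + k)%N - length_potential (n + k)%N.
  elim: k => [|k IH]; first by rewrite addn0.
  have nk : (n1 <= n + k)%N by exact: leq_trans (leq_addr _ _).
  have := length_potential_step (H _ nk); have := D_step (n + k)%N.
  by rewrite !addnS ler_norml => /andP[s1 _] s2; lra.
have := mono (N1 + N2)%N.
have := H1 (n + (N1 + N2))%N ltac:(lia).
have := H2 (n + (N1 + N2))%N ltac:(lia).
by rewrite !ler_norml => /andP[? ?] /andP[? ?] ?; lra.
Qed.

End Potential.

(** * Scalar descent recursions *)

(** Only comparisons of natural numbers matter for [lia] here; real hypotheses slow it down. *)
Ltac nat_lia := repeat match goal with H : ?T |- _ =>
  lazymatch T with nat => fail | is_true (leq _ _) => fail | _ => clear H end
  end; lia.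

Section Rates.
Variable R : realType.
Implicit Types (a b t w g D : nat -> R).

(** If w n were below - K (5 b n)^mu, the Lojasiewicz inequality would give g n > 5 b n, so that the
    drift beats the noise and w decreases further. This would go on forever, while w tends to 0. *)
Lemma lower_rate a b w g (mu K : R) :
  (forall n, 0 < a n) -> (forall n, 0 < b n) ->
  (forall n, b n.+1 <= b n) -> (forall n, 0 <= g n) -> 0 < mu -> 0 < K ->
  (forall n, w n.+1 <= w n - a n * g n ^+ 2 / 4 + 3 * a n * b n ^+ 2) ->
  (forall n, `|w n| <= K * g n `^ mu) ->
  w n @[n --> \oo] --> 0 ->
  forall n, - (K * 5 `^ mu * b n `^ mu) <= w n.
Proof.
move=> a0 b0 b_dec g0 mu0 K0 dsc loj w0 n; rewrite leNgt; apply/negP => wn.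
have noninc k : - w n <= - w (n + k)%N /\
    w (n + k)%N < - (K * 5 `^ mu * b (n + k)%N `^ mu).
  elim: k => [|k [IH1 IH2]]; first by rewrite addn0.
  set m := (n + k)%N in IH1 IH2 *; rewrite addnS -/m.
  have bm := powR_ge0 (b m) mu; have p5 := powR_gt0 mu (ltac:(lra) : 0 < 5 :> R).
  have gb : 5 * b m < g m.
    rewrite ltNge; apply/negP => gb.
    have : g m `^ mu <= 5 `^ mu * b m `^ mu.
      by rewrite -powRM ?(ltW (b0 m))//; apply: powR_mono; rewrite ?(ltW mu0).
    rewrite -(ler_pM2l K0) mulrA => gbm.
    have wm0 : w m < 0.
      by apply: lt_le_trans IH2 _; rewrite oppr_le0 !mulr_ge0 ?(ltW K0) ?(ltW p5).
    have := loj m; rewrite ltr0_norm// => lm; lra.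
  have g5 : (5 * b m) ^+ 2 <= g m ^+ 2.
    by rewrite ler_sqr ?nnegrE ?(ltW gb) ?g0// mulr_ge0// ltW.
  have ag : a m * (5 * b m) ^+ 2 <= a m * g m ^+ 2 by rewrite ler_wpM2l ?(ltW (a0 m)).
  have ab : 0 <= a m * b m ^+ 2 by rewrite mulr_ge0 ?sqr_ge0 ?(ltW (a0 m)).
  have ww : w m.+1 <= w m by have := dsc m; lra.
  split; first lra.
  apply: le_lt_trans ww (lt_le_trans IH2 _).
  rewrite lerN2 ler_wpM2l ?mulr_ge0 ?(ltW K0) ?(ltW p5)//.
  by apply: powR_mono; rewrite ?b_dec ?(ltW (b0 _)) ?(ltW mu0).
have wn0 : w n < 0.
  apply: lt_le_trans wn _; rewrite oppr_le0 !mulr_ge0 ?powR_ge0//.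
  exact: ltW.
have [n0 Hn0] := cvg0_eventually w0 (ltac:(lra) : 0 < - w n / 2).
have [h1 _] := noninc n0; have := Hn0 (n + n0)%N (leq_addl _ _).
by rewrite ler_norml => /andP[h2 _]; lra.
Qed.

(** Comparison with A t^(-q). In the upper half of the barrier the drift outweighs the noise and the
    decrease of the barrier; from the lower half a single step is too short to cross it. *)
Lemma barrier a t w nu (q sigma c A : R) n0 :
  (forall n, (n0 <= n)%N -> 0 < a n) ->
  (forall n, (n0 <= n)%N -> 1 <= t n) ->
  (forall n, (n0 <= n)%N -> t n.+1 = t n + a n) ->
  0 < q -> 0 < A -> 0 <= c -> 0 <= sigma ->
  (forall n, (n0 <= n)%N -> 2 * (1 + q) * a n <= 1) ->
  (forall n, (n0 <= n)%N -> nu n <= A * t n `^ (- q)) ->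
  (forall n, (n0 <= n)%N ->
    nu n + A * (q * t n `^ (- q - 1)) <= c * (A / 2 * t n `^ (- q)) `^ sigma) ->
  (forall n, (n0 <= n)%N -> w n.+1 <= w n + a n * nu n) ->
  (forall n, (n0 <= n)%N -> 0 < w n ->
    w n.+1 <= w n - c * a n * w n `^ sigma + a n * nu n) ->
  w n0 <= A * t n0 `^ (- q) ->
  forall n, (n0 <= n)%N -> w n <= A * t n `^ (- q).
Proof.
move=> a0 t1 tS q0 A0 c0 sg0 aq nuA nuc up drift w0.
move=> n nn; rewrite -(subnKC nn); elim: (n - n0)%N => [|k IH].
  by rewrite addn0.
rewrite addnS; set m := (n0 + k)%N in IH *.
have n0m : (n0 <= m)%N by exact: leq_addr.
have am := a0 _ n0m; have tm := t1 _ n0m.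
have tm0 : 0 < t m by lra.
have tS' := tS _ n0m.
have tt : t m <= t m.+1 by lra.
have pw := powRN_diff_le tm0 tt (ltW q0).
rewrite (_ : t m.+1 - t m = a m) in pw; last by lra.
have T0 := powR_gt0 (- q) tm0.
have T1 : t m `^ (- q - 1) <= t m `^ (- q) by apply: ler_powR => //; lra.
have pwA : A * t m `^ (- q) - A * (q * t m `^ (- q - 1)) * a m <=
    A * t m.+1 `^ (- q).
  have := ler_wpM2l (ltW A0) pw; rewrite mulrBr; lra.
have [wle|wgt] := leP (w m) (A / 2 * t m `^ (- q)).
  have h1 := up _ n0m.
  have h2 : a m * nu m <= a m * (A * t m `^ (- q)).
    by rewrite ler_wpM2l ?(ltW am) ?nuA.
  have h3 : a m * (A * (q * t m `^ (- q - 1))) <= a m * (A * (q * t m `^ (- q))).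
    by rewrite ler_wpM2l ?(ltW am)// ler_wpM2l ?(ltW A0)// ler_wpM2l ?(ltW q0).
  have h4 : 2 * (1 + q) * a m * (A * t m `^ (- q)) <= 1 * (A * t m `^ (- q)).
    by rewrite ler_wpM2r ?aq// mulr_ge0 ?(ltW A0) ?(ltW T0).
  lra.
have w1 : 0 < w m by apply: le_lt_trans wgt; rewrite !mulr_ge0 ?(ltW A0) ?(ltW T0).
have h1 := drift _ n0m w1.
have h2 : c * (A / 2 * t m `^ (- q)) `^ sigma <= c * w m `^ sigma.
  rewrite ler_wpM2l//; apply: powR_mono => //; last exact: ltW.
  by rewrite !mulr_ge0 ?(ltW A0) ?(ltW T0).
have h3 := nuc _ n0m.
have h4 : a m * (nu m + A * (q * t m `^ (- q - 1))) <= a m * (c * w m `^ sigma).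
  exact: (ler_wpM2l (ltW am) (le_trans h3 h2)).
lra.
Qed.

(** The clock [t] is the algorithmic time, the sum of the step sizes [a]; rates are powers of it. *)
Section Clock.
Variables a t : nat -> R.
Hypothesis a_gt0 : forall n, 0 < a n.
Hypothesis t_ge1 : forall n, 1 <= t n.
Hypothesis t_step : forall n, t n.+1 = t n + a n.
Hypothesis a_cvg : a n @[n --> \oo] --> 0.
Hypothesis t_cvg : t n @[n --> \oo] --> +oo.

Let t_gt0 n : 0 < t n. Proof. exact: lt_le_trans (t_ge1 n). Qed.

Lemma clock_powR_small q e : 0 < q -> 0 < e ->
  exists n0, forall n, (n0 <= n)%N -> t n `^ (- q) <= e.
Proof.
move=> q0 e0.
have /cvgryPge/(_ (e^-1 `^ q^-1)) [n0 _ H] := t_cvg.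
exists n0 => n nn; have := H n nn => /= h.
have e1 : 0 < e^-1 by rewrite invr_gt0.
rewrite powRN -[leRHS]invrK lef_pV2 ?posrE ?powR_gt0//.
have := powR_mono (powR_ge0 _ _) h (ltW q0).
by rewrite -powRrM mulVf ?gt_eqF// powRr1// ltW.
Qed.

(** t^(-q) is the decay of the solutions of y' = - c y^(1 + 1/q), and noise of order t^(-q - 1) is
    of the order of y' itself. The constant A is chosen so that the drift at A/2 t^(-q) exceeds the
    noise and the slope of the barrier. *)
Lemma upper_rate_bigO w (q c C : R) m : 0 < q -> 0 < c -> 0 <= C ->
  (forall n, (m <= n)%N -> w n.+1 <= w n + a n * (C * t n `^ (- q - 1))) ->
  (forall n, (m <= n)%N -> 0 < w n ->
    w n.+1 <= w n - c * a n * w n `^ (1 + q^-1) + a n * (C * t n `^ (- q - 1))) ->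
  exists A : R, 0 < A /\
  exists n0, forall n, (n0 <= n)%N -> w n <= A * t n `^ (- q).
Proof.
move=> q0 c0 C0 up drift.
have q1 : 0 < 2 * (1 + q) by lra.
have [n1 Hn1] := cvg0_eventually a_cvg (ltac:(by rewrite invr_gt0) : 0 < (2 * (1 + q))^-1).
pose n0 := maxn m n1.
pose x0 := (2 * (1 + q) / c) `^ q.
pose A := C + 2 * x0 + `|w n0| * t n0 `^ q.
have x00 : 0 < x0 by rewrite powR_gt0// divr_gt0.
have wt0 : 0 <= `|w n0| * t n0 `^ q by rewrite mulr_ge0 ?powR_ge0.
have A0 : 0 < A by rewrite /A; lra.
exists A; split=> //; exists n0.
have mn n : (n0 <= n)%N -> (m <= n)%N by rewrite geq_max => /andP[].
have n1n n : (n0 <= n)%N -> (n1 <= n)%N by rewrite geq_max => /andP[].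
apply: (@barrier a t w (fun n => C * t n `^ (- q - 1)) q (1 + q^-1) c A n0) => //.
- exact: ltW.
- by rewrite addr_ge0// invr_ge0 ltW.
- move=> n nn; have := Hn1 _ (n1n _ nn); rewrite gtr0_norm// => h.
  by rewrite -(@ler_pM2l _ (2 * (1 + q))^-1) ?invr_gt0// mulrA mulVf ?gt_eqF// mul1r mulr1.
- move=> n nn; apply: ler_pM => //; first exact: powR_ge0.
    by rewrite /A; lra.
  by apply: ler_powR => //; lra.
- move=> n nn.
  have A20 : 0 < A / 2 by lra.
  rewrite powRM ?powR_ge0 ?(ltW A20)// -powRrM.
  rewrite (_ : - q * (1 + q^-1) = - q - 1); last first.
    by rewrite mulrDr mulr1 mulNr divff ?gt_eqF.
  have Tn := powR_gt0 (- q - 1) (t_gt0 n).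
  rewrite [X in X <= _](_ : _ = (C + A * q) * t n `^ (- q - 1)); last by ring.
  rewrite mulrA ler_wpM2r ?(ltW Tn)//.
  apply: (@le_trans _ _ (A * (1 + q))); first by rewrite /A; lra.
  rewrite powRD; last by rewrite (gt_eqF A20) implybT.
  rewrite powRr1 ?(ltW A20)//.
  have h : 2 * (1 + q) / c <= (A / 2) `^ q^-1.
    have : x0 `^ q^-1 <= (A / 2) `^ q^-1.
      by apply: powR_mono; rewrite ?invr_ge0 ?(ltW q0) ?(ltW x00)// /A; lra.
    by rewrite -powRrM divff ?gt_eqF// powRr1// divr_ge0// ltW.
  have -> : A * (1 + q) = c * (A / 2 * (2 * (1 + q) / c)).
    by field; rewrite gt_eqF.
  by rewrite ler_wpM2l ?(ltW c0)// ler_wpM2l ?(ltW A20).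
- by move=> n nn; apply: up; exact: mn.
- by move=> n nn; apply: drift; exact: mn.
- rewrite powRN ler_pdivlMr ?powR_gt0// /A.
  have : w n0 * t n0 `^ q <= `|w n0| * t n0 `^ q.
    by rewrite ler_wpM2r ?powR_ge0 ?ler_norm.
  lra.
Qed.

(** Here the noise, not the drift, determines the rate: at w = t^(-mu r) the drift w^(2/mu) equals
    t^(-2 r), and the noise is of smaller order. So any barrier e t^(-mu r) works, provided that w
    is below it at some late time. *)
Lemma upper_rate_littleo w nu (r mu c : R) :
  1 < r -> 1 < mu -> mu <= 2 -> r * (2 - mu) < 1 -> 0 < c ->
  w n @[n --> \oo] --> 0 ->
  (forall e : R, 0 < e -> exists n0, forall n, (n0 <= n)%N ->
     nu n <= e * t n `^ (- (2 * r))) ->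
  (forall n, w n.+1 <= w n + a n * nu n) ->
  (forall n, 0 < w n -> w n.+1 <= w n - c * a n * w n `^ (2 / mu) + a n * nu n) ->
  forall e : R, 0 < e ->
  exists n0, forall n, (n0 <= n)%N -> w n <= e * t n `^ (- (mu * r)).
Proof.
move=> r1 mu1 mu2 rmu c0 w0 nu_small up drift e e0.
have mu0 : 0 < mu by lra. have r0 : 0 < r by lra.
set q := mu * r.
have q0 : 0 < q by rewrite mulr_gt0.
have sq : - q * (2 / mu) = - (2 * r) by rewrite /q; field; rewrite gt_eqF.
have q2r : 2 * r < q + 1 by rewrite /q; lra.
have q2r' : q <= 2 * r by rewrite /q ler_wpM2r// ltW.
have sg0 : 0 <= 2 / mu by rewrite divr_ge0// ltW.
pose d := c * (e / 2) `^ (2 / mu) / 2.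
have e2 : 0 < e / 2 by lra.
have d0 : 0 < d by rewrite !mulr_gt0// powR_gt0.
have [n1 H1] := nu_small _ d0.
have [n2 H2] := nu_small _ e0.
have [n3 H3] := cvg0_eventually a_cvg
  (ltac:(by rewrite invr_gt0; lra) : 0 < (2 * (1 + q))^-1).
have [n4 H4] := @clock_powR_small (q + 1 - 2 * r) (d / (e * q))
  ltac:(lra) ltac:(by rewrite divr_gt0// mulr_gt0).
have [n5 H5] := cvg0_eventually w0 (ltr01 : 0 < 1 :> R).
pose n6 := (n1 + n2 + n3 + n4 + n5)%N.
(* Above the barrier half of the drift absorbs the noise, and w would decrease
   at the noiseless rate with exponent 1 / iq > q, hence below the barrier. *)
have [n0 nn0 wn0] : exists2 n0, (n6 <= n0)%N & w n0 <= e * t n0 `^ (- q).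
  apply: contrapT => nex.
  have wgt n : (n6 <= n)%N -> e * t n `^ (- q) < w n.
    by move=> nn; rewrite ltNge; apply/negP => wle; apply: nex; exists n.
  pose iq := ((2 - mu) + r^-1) / (2 * mu).
  have ir0 : 0 < r^-1 by rewrite invr_gt0.
  have iq0 : 0 < iq by rewrite divr_gt0//; lra.
  have sgi : 2 / mu <= 1 + iq^-1^-1.
    rewrite invrK /iq -subr_ge0.
    have -> : 1 + (2 - mu + r^-1) / (2 * mu) - 2 / mu = (r^-1 - (2 - mu)) / (2 * mu).
      by field; rewrite !gt_eqF.
    rewrite divr_ge0 ?mulr_ge0 ?(ltW mu0)// subr_ge0.
    by rewrite -(ler_pM2l r0) divff ?gt_eqF// ltW.
  have wpos n : (n6 <= n)%N -> 0 < w n.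
    move=> nn; apply: lt_trans (wgt _ nn).
    by rewrite mulr_gt0 ?powR_gt0.
  have step n : (n6 <= n)%N ->
      w n.+1 <= w n - c / 2 * a n * w n `^ (1 + iq^-1^-1).
    move=> nn; have wn := wpos _ nn; have := drift n wn.
    have h1 : nu n <= c / 2 * w n `^ (2 / mu).
      apply: le_trans (H1 n ltac:(nat_lia)) _.
      have -> : d * t n `^ (- (2 * r)) =
          c / 2 * ((e / 2) `^ (2 / mu) * t n `^ (- (2 * r))) by rewrite /d; ring.
      have -> : t n `^ (- (2 * r)) = (t n `^ (- q)) `^ (2 / mu).
        by rewrite -sq; exact: powRrM.
      rewrite -(powRM _ (ltW e2) (powR_ge0 _ _)).
      rewrite ler_wpM2l ?divr_ge0 ?(ltW c0)//.
      apply: powR_mono => //; first by rewrite mulr_ge0 ?powR_ge0 ?(ltW e2).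
      apply: le_trans (ltW (wgt _ nn)).
      by rewrite ler_wpM2r ?powR_ge0//; lra.
    have h2 : w n `^ (1 + iq^-1^-1) <= w n `^ (2 / mu).
      apply: ger_powR => //; rewrite wn /=.
      by apply: le_trans (ler_norm _) _; apply: H5; nat_lia.
    have h3 : a n * nu n <= a n * (c / 2 * w n `^ (2 / mu)).
      by rewrite ler_wpM2l ?(ltW (a_gt0 n)).
    have h4 : a n * (c / 2 * w n `^ (1 + iq^-1^-1)) <= a n * (c / 2 * w n `^ (2 / mu)).
      rewrite ler_wpM2l ?(ltW (a_gt0 n))// ler_wpM2l//.
      by rewrite divr_ge0// ltW.
    lra.
  have [||||A [A0 [n7 H7]]] :=
      @upper_rate_bigO w iq^-1 (c / 2) 0 n6 _ _ (lexx _).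
  - by rewrite invr_gt0.
  - by rewrite divr_gt0.
  - move=> n nn; rewrite mul0r mulr0 addr0; apply: le_trans (step _ nn) _.
    by rewrite gerBl !mulr_ge0 ?powR_ge0 ?(ltW (a_gt0 n)) ?(ltW c0).
  - by move=> n nn _; rewrite mul0r mulr0 addr0; exact: step.
  have iqq : 0 < iq^-1 - q.
    have -> : iq^-1 - q = (1 - r * (2 - mu)) / (2 - mu + r^-1) * mu.
      rewrite /iq /q; field; rewrite !gt_eqF//.
      have h : 0 <= (2 - mu) * r by rewrite mulr_ge0 ?(ltW r0)//; lra.
      by lra.
    by rewrite mulr_gt0// divr_gt0; lra.
  have [n8 H8] := @clock_powR_small (iq^-1 - q) (e / A) iqq ltac:(by rewrite divr_gt0).
  pose n := (n6 + n7 + n8)%N.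
  have := wgt n ltac:(nat_lia); have := H7 n ltac:(nat_lia); have := H8 n ltac:(nat_lia).
  rewrite ler_pdivlMr// => h8 h7 h6.
  have : t n `^ (- iq^-1) = t n `^ (- (iq^-1 - q)) * t n `^ (- q).
    rewrite -powRD; first by congr (_ `^ _); ring.
    by rewrite (gt_eqF (t_gt0 n)) implybT.
  move=> tE; have : A * t n `^ (- iq^-1) <= e * t n `^ (- q).
    rewrite tE mulrA ler_wpM2r ?powR_ge0//; lra.
  lra.
exists n0.
apply: (@barrier a t w nu q (2 / mu) c e n0) => //.
- exact: ltW.
- move=> n nn; have := H3 n ltac:(nat_lia); rewrite gtr0_norm// => h.
  have q1 : 0 < 2 * (1 + q) by lra.
  by rewrite -(@ler_pM2l _ (2 * (1 + q))^-1) ?invr_gt0// mulrA mulVf ?gt_eqF// mul1r mulr1.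
- move=> n nn; apply: le_trans (H2 n ltac:(nat_lia)) _.
  by rewrite ler_wpM2l ?(ltW e0)//; apply: ler_powR; rewrite ?t_ge1//; lra.
- move=> n nn.
  rewrite powRM ?powR_ge0 ?(ltW e2)// -powRrM sq.
  have h1 := H1 n ltac:(nat_lia).
  have h4 := H4 n ltac:(nat_lia).
  have tE : t n `^ (- q - 1) = t n `^ (- (q + 1 - 2 * r)) * t n `^ (- (2 * r)).
    rewrite -powRD; first by congr (_ `^ _); ring.
    by rewrite (gt_eqF (t_gt0 n)) implybT.
  have eq0 : 0 < e * q by rewrite mulr_gt0.
  have h5 : e * (q * t n `^ (- q - 1)) <= d * t n `^ (- (2 * r)).
    rewrite tE (mulrA q) (mulrA e) (mulrA e q) ler_wpM2r ?powR_ge0//.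
    by move: h4; rewrite ler_pdivlMr// [X in X <= _]mulrC.
  have -> : c * ((e / 2) `^ (2 / mu) * t n `^ (- (2 * r))) =
     d * t n `^ (- (2 * r)) + d * t n `^ (- (2 * r)) by rewrite /d; field.
  lra.
- by move=> n _; exact: drift.
Qed.

(** g is Lipschitz along the path, so it stays above a fixed fraction of g n during a window of
    algorithmic time 1 / (4 L); over this window w drops by a multiple of (g n)^2. The other case
    is g n <= 10 b n. *)
Lemma gradient_window b w g (L : R) :
  (forall n, 0 < b n) -> (forall n, b n.+1 <= b n) -> (forall n, 0 <= g n) ->
  0 < L -> (forall n, 4 * L * a n <= 1) ->
  (forall n, w n.+1 <= w n - a n * g n ^+ 2 / 4 + 3 * a n * b n ^+ 2) ->
  (forall n, (1 - L * a n) * g n - L * a n * b n <= g n.+1) ->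
  forall n, exists2 m, (n <= m)%N &
    g n ^+ 2 <= (100 + 200 * L) * (`|w n - w m| + b n ^+ 2).
Proof.
move=> b0 b_dec g0 L0 La dsc gS n.
have C0 : 0 < 100 + 200 * L by lra.
have bn0 := b0 n.
have b20 := sqr_ge0 (b n).
have [gb|gb] := leP (g n) (10 * b n).
  exists n => //; rewrite subrr normr0 add0r.
  have h : g n ^+ 2 <= (10 * b n) ^+ 2.
    by rewrite ler_sqr ?nnegrE ?g0// mulr_ge0// ltW.
  have : 0 <= L * b n ^+ 2 by rewrite mulr_ge0 ?(ltW L0).
  lra.
have g2 : (10 * b n) ^+ 2 <= g n ^+ 2.
  by rewrite ler_sqr ?nnegrE ?g0 ?(ltW gb)// mulr_ge0// ltW.
have bdec k : b (n + k)%N <= b n.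
  elim: k => [|k IH]; first by rewrite addn0.
  by rewrite addnS; apply: le_trans (b_dec _) IH.
have win k : L * (t (n + k)%N - t n) <= 1 / 2 ->
    [/\ 0 <= t (n + k)%N - t n,
      (1 - L * (t (n + k)%N - t n)) * g n - L * (t (n + k)%N - t n) * b n <= g (n + k)%N &
      w (n + k)%N <= w n - (t (n + k)%N - t n) * g n ^+ 2 / 50].
  elim: k => [|k IH]; first by rewrite addn0 subrr => _; split; lra.
  rewrite addnS t_step; set m := (n + k)%N in IH *; set h := t m - t n in IH *.
  have -> : t m + a m - t n = h + a m by rewrite /h; ring.
  move=> Lh; have am := a_gt0 m; have Lam : 0 < L * a m by rewrite mulr_gt0.
  have [|h0 IHg IHw] := IH; first by lra.
  have Lh0 : 0 <= L * h by rewrite mulr_ge0// ltW.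
  have bm := bdec k; rewrite -/m in bm.
  have Lamb : L * a m * b m <= L * a m * b n by rewrite ler_wpM2l ?(ltW Lam).
  have La1 := La m.
  split; first lra.
    apply: le_trans (gS m).
    have h1 : (1 - L * a m) * ((1 - L * h) * g n - L * h * b n) <= (1 - L * a m) * g m.
      by rewrite ler_wpM2l//; lra.
    have h2 : 0 <= L * a m * (L * h) * g n.
      by rewrite !mulr_ge0 ?(ltW L0) ?(ltW am).
    have h3 : 0 <= L * a m * (L * h) * b n.
      by rewrite !mulr_ge0 ?(ltW L0) ?(ltW am) ?(ltW bn0).
    lra.
  have gm : 9 / 20 * g n <= g m.
    have h1 : 0 <= (1 / 2 - L * h) * g n by rewrite mulr_ge0//; lra.
    have h2 : 0 <= (1 / 2 - L * h) * b n by rewrite mulr_ge0//; lra.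
    lra.
  have gm2 : (9 / 20 * g n) ^+ 2 <= g m ^+ 2.
    by rewrite ler_sqr ?nnegrE ?g0// mulr_ge0.
  have bm2 : b m ^+ 2 <= b n ^+ 2 by rewrite ler_sqr ?nnegrE// ltW.
  have := dsc m.
  have h1 : a m * (g n ^+ 2 / 50) <= a m * (g m ^+ 2 / 4 - 3 * b m ^+ 2).
    by rewrite ler_wpM2l ?(ltW am)//; lra.
  lra.
have ex : exists k, 1 / 4 <= L * (t (n + k)%N - t n).
  have /cvgryPge/(_ (t n + (4 * L)^-1)) [k _ H] := t_cvg.
  exists k; have /= := H (n + k)%N (leq_addl _ _); rewrite -lerBrDl => h.
  have := ler_wpM2l (ltW L0) h; apply: le_trans.
  by rewrite le_eqVlt; apply/orP; left; apply/eqP; field; rewrite gt_eqF.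
case: (ex_minnP ex) => [[|k]] Hk kmin.
  by move: Hk; rewrite addn0 subrr mulr0; lra.
have Lk : L * (t (n + k)%N - t n) < 1 / 4.
  by rewrite ltNge; apply/negP => /kmin; rewrite ltnn.
have La1 := La (n + k)%N.
have [|h0 _ hw] := win k.+1; first by rewrite addnS t_step; lra.
exists (n + k.+1)%N; first exact: leq_addr.
set h := t (n + k.+1)%N - t n in Hk h0 hw.
have h1 : 1 / 4 * g n ^+ 2 <= L * h * g n ^+ 2 by rewrite ler_wpM2r ?sqr_ge0.
have h2 : L * (h * g n ^+ 2 / 50) <= L * `|w n - w (n + k.+1)%N|.
  rewrite ler_wpM2l ?(ltW L0)//; apply: le_trans (ler_norm _); lra.
have h3 : 0 <= L * b n ^+ 2 by rewrite mulr_ge0 ?(ltW L0).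
have h4 := normr_ge0 (w n - w (n + k.+1)%N).
lra.
Qed.

Lemma clock_mono n k : t n <= t (n + k)%N.
Proof.
elim: k => [|k IH]; first by rewrite addn0.
by rewrite addnS t_step; have := a_gt0 (n + k)%N; lra.
Qed.

End Clock.
End Rates.

(** * Decay of the value, the gradient and the distance *)

(** The Landau relations for a nonnegative comparison sequence, with the threshold made explicit:
    in this form they combine freely with index shifts and with bounds valid from some index on. *)
Definition rate_o (R : realType) (u v : nat -> R) :=
  forall e : R, 0 < e -> exists n0, forall n, (n0 <= n)%N -> `|u n| <= e * v n.

Definition rate_O (R : realType) (u v : nat -> R) :=
  exists2 C : R, 0 < C & exists n0, forall n, (n0 <= n)%N -> `|u n| <= C * v n.

Section ScalarRates.
Variable R : realType.
Implicit Types (a t eps b w g D : nat -> R) (r mu K L delta Gm : R).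

Definition noise r eps t n : R := eps n * t n `^ (- r).
(** Comparison of the sum of a k * noise k over k >= n with the integral of t^(-r); the factor 2^r
    accounts for t n.+1 <= 2 t n. *)
Definition noise_tail r eps t n : R := 2 `^ r / (r - 1) * (eps n * t n `^ (- (r - 1))).

Section Noise.
Variables (a t eps : nat -> R) (r : R).
Hypothesis r_gt1 : 1 < r.
Hypothesis a_gt0 : forall n, 0 < a n.
Hypothesis a_le1 : forall n, a n <= 1.
Hypothesis t_ge1 : forall n, 1 <= t n.
Hypothesis t_step : forall n, t n.+1 = t n + a n.
Hypothesis eps_gt0 : forall n, 0 < eps n.
Hypothesis eps_noninc : forall n, eps n.+1 <= eps n.
Hypothesis eps_cvg : eps n @[n --> \oo] --> 0.

Let t_gt0 n : 0 < t n. Proof. exact: lt_le_trans (t_ge1 n). Qed.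

Lemma noise_gt0 n : 0 < noise r eps t n.
Proof. by rewrite /noise mulr_gt0 ?powR_gt0. Qed.

Lemma clock_powR_noninc q n : 0 <= q -> t n.+1 `^ (- q) <= t n `^ (- q).
Proof.
move=> q0; apply: powR_anti => //; last by rewrite oppr_le0.
by rewrite t_step lerDl ltW.
Qed.

Lemma clock_powR_le (q q' : R) n : q <= q' -> t n `^ (- q') <= t n `^ (- q).
Proof. by move=> qq; apply: ler_powR; rewrite ?t_ge1// lerN2. Qed.

Lemma noise_noninc n : noise r eps t n.+1 <= noise r eps t n.
Proof.
have r0 := r_gt1.
apply: ler_pM; rewrite ?powR_ge0 ?(ltW (eps_gt0 _)) ?eps_noninc//.
by apply: clock_powR_noninc; lra.
Qed.

Lemma noise_tail_ge0 n : 0 <= noise_tail r eps t n.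
Proof.
have r0 := r_gt1.
rewrite /noise_tail mulr_ge0 ?divr_ge0 ?powR_ge0//; first by lra.
by rewrite mulr_ge0 ?powR_ge0// ltW.
Qed.

Lemma noise_tail_step n :
  a n * noise r eps t n <= noise_tail r eps t n - noise_tail r eps t n.+1.
Proof.
have r0 := r_gt1; have tn := t_gt0 n; have an := a_gt0 n; have t1 := t_ge1 n.
have a1 := a_le1 n.
have tt : t n <= t n.+1 by rewrite t_step lerDl ltW.
have r1 : 0 < r - 1 by lra.
have := powRN_diff_ge tn tt (ltW r1).
rewrite (_ : t n.+1 - t n = a n); last by rewrite t_step; ring.
rewrite (_ : - (r - 1) - 1 = - r); last by ring.
move=> diff.
have t2 : 2 `^ (- r) * t n `^ (- r) <= t n.+1 `^ (- r).
  rewrite -powRM ?(ltW tn)//; apply: powR_anti; rewrite ?t_step; lra.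
have pos : 0 < 2 `^ r / (r - 1) by rewrite divr_gt0// powR_gt0.
have -> : a n * noise r eps t n = 2 `^ r / (r - 1) *
   (eps n * ((r - 1) * (2 `^ (- r) * t n `^ (- r)) * a n)).
  rewrite /noise (powRN 2); field.
  by rewrite (gt_eqF r1) gt_eqF// powR_gt0.
rewrite /noise_tail -mulrBr ler_wpM2l ?(ltW pos)//.
have en := eps_gt0 n.
have h1 : eps n * ((r - 1) * (2 `^ (- r) * t n `^ (- r)) * a n) <=
   eps n * ((r - 1) * t n.+1 `^ (- r) * a n).
  by rewrite ler_wpM2l ?(ltW en)// ler_wpM2r ?(ltW an)// ler_wpM2l ?(ltW r1).
have h2 : eps n * ((r - 1) * t n.+1 `^ (- r) * a n) <=
   eps n * (t n `^ (- (r - 1)) - t n.+1 `^ (- (r - 1))).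
  by rewrite ler_wpM2l ?(ltW en).
have h3 : eps n.+1 * t n.+1 `^ (- (r - 1)) <= eps n * t n.+1 `^ (- (r - 1)).
  by rewrite ler_wpM2r ?powR_ge0.
lra.
Qed.

Lemma eps_small e : 0 < e -> exists n0, forall n, (n0 <= n)%N -> eps n <= e.
Proof.
move=> e0; have [n0 H] := cvg0_eventually eps_cvg e0; exists n0 => n nn.
exact: le_trans (ler_norm _) (H _ nn).
Qed.

Lemma noise_powR_small mu p e : 0 < mu -> p <= mu * r -> 0 < e ->
  exists n0, forall n, (n0 <= n)%N -> noise r eps t n `^ mu <= e * t n `^ (- p).
Proof.
move=> mu0 pr e0; have [n0 H] := @eps_small (e `^ mu^-1) (powR_gt0 _ e0).
exists n0 => n nn; rewrite /noise powRM ?powR_ge0 ?(ltW (eps_gt0 n))//.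
apply: ler_pM; rewrite ?powR_ge0//.
  have := powR_mono (ltW (eps_gt0 n)) (H _ nn) (ltW mu0).
  by rewrite -powRrM mulVf ?gt_eqF// powRr1// ltW.
by rewrite -powRrM; apply: ler_powR; rewrite ?t_ge1//; lra.
Qed.

Lemma noise_tail_small q e : q <= r - 1 -> 0 < e ->
  exists n0, forall n, (n0 <= n)%N -> noise_tail r eps t n <= e * t n `^ (- q).
Proof.
have r0 := r_gt1; move=> qr e0.
have pos : 0 < 2 `^ r / (r - 1) by rewrite divr_gt0// ?powR_gt0//; lra.
have [n0 H] := @eps_small (e / (2 `^ r / (r - 1))) (divr_gt0 e0 pos).
exists n0 => n nn; rewrite /noise_tail mulrA.
apply: ler_pM; rewrite ?powR_ge0//.
- by rewrite mulr_ge0 ?(ltW pos) ?(ltW (eps_gt0 n)).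
- by have := H _ nn; rewrite ler_pdivlMr// mulrC.
- exact: clock_powR_le.
Qed.

Lemma noise_cvg : noise r eps t n @[n --> \oo] --> 0.
Proof.
apply/cvgrPdist_le => e e0.
have r0 := r_gt1; have [n0 H] := @noise_powR_small 1 0 e ltr01 ltac:(lra) e0.
exists n0 => // n nn /=; have := H _ nn; have n1 := noise_gt0 n.
by rewrite oppr0 powRr0 mulr1 powRr1 ?(ltW n1)// sub0r normrN gtr0_norm.
Qed.

Lemma noise_tail_cvg : noise_tail r eps t n @[n --> \oo] --> 0.
Proof.
apply/cvgrPdist_le => e e0.
have r0 := r_gt1; have [n0 H] := @noise_tail_small 0 e ltac:(lra) e0.
exists n0 => // n nn /=; have := H _ nn; have n1 := noise_tail_ge0 n.
by rewrite oppr0 powRr0 mulr1 sub0r normrN ger0_norm.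
Qed.

End Noise.

(** Here the path has already been trapped, so that the Lojasiewicz inequality and the bound of the
    distance by the potential hold at all indices. *)
Section Settled.
Variables (a t eps w g D : nat -> R) (r mu K L Ca Cb : R).
Hypothesis r_gt1 : 1 < r.
Hypothesis mu_bnd : 1 < mu <= 2.
Hypothesis K_ge1 : 1 <= K.
Hypothesis L_gt0 : 0 < L.
Hypothesis Ca_ge0 : 0 <= Ca.
Hypothesis Cb_ge0 : 0 <= Cb.
Hypothesis a_gt0 : forall n, 0 < a n.
Hypothesis a_le1 : forall n, a n <= 1.
Hypothesis La : forall n, 4 * L * a n <= 1.
Hypothesis a_cvg : a n @[n --> \oo] --> 0.
Hypothesis t_ge1 : forall n, 1 <= t n.
Hypothesis t_step : forall n, t n.+1 = t n + a n.
Hypothesis t_cvg : t n @[n --> \oo] --> +oo.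
Hypothesis eps_gt0 : forall n, 0 < eps n.
Hypothesis eps_noninc : forall n, eps n.+1 <= eps n.
Hypothesis eps_cvg : eps n @[n --> \oo] --> 0.
Hypothesis g_ge0 : forall n, 0 <= g n.
Let b := noise r eps t.
Hypothesis descent : forall n,
  w n.+1 <= w n - a n * g n ^+ 2 / 4 + 3 * a n * b n ^+ 2.
Hypothesis g_step : forall n, (1 - L * a n) * g n - L * a n * b n <= g n.+1.
Hypothesis lojasiewicz : forall n, `|w n| <= K * g n `^ mu.
Hypothesis w_cvg : w n @[n --> \oo] --> 0.
Hypothesis D_ge0 : forall n, 0 <= D n.
Hypothesis D_le : forall n,
  D n <= Ca * (`|w n| + b n `^ mu) `^ (1 - mu^-1) + Cb * noise_tail r eps t n.

Let b_gt0 := noise_gt0 r t_ge1 eps_gt0.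
Let b_noninc := noise_noninc r_gt1 a_gt0 t_ge1 t_step eps_gt0 eps_noninc.
Let t_gt0 n : 0 < t n. Proof. exact: lt_le_trans (t_ge1 n). Qed.

Let mu0 : 0 < mu. Proof. by case/andP: mu_bnd => *; lra. Qed.
Let window_gt0 : 0 < 100 + 200 * L. Proof.
apply: addr_gt0; first exact: ltr0Sn.
by apply: mulr_gt0 L_gt0; exact: ltr0Sn.
Qed.
Let window3_gt0 : 0 < 3 * (100 + 200 * L).
Proof. by apply: mulr_gt0 window_gt0; exact: ltr0Sn. Qed.

(** Since w <= K g^mu, the descent term a g^2 is at least a (w / K)^(2/mu). *)
Lemma drift_from_lojasiewicz n : 0 < w n ->
  w n.+1 <= w n - K^-1 `^ (2 / mu) / 4 * a n * w n `^ (2 / mu)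
            + a n * (3 * b n ^+ 2).
Proof.
move=> wn; have K0 : 0 < K by exact: lt_le_trans K_ge1.
have h : K^-1 `^ (2 / mu) * w n `^ (2 / mu) <= g n ^+ 2.
  rewrite -powRM ?invr_ge0 ?(ltW K0) ?(ltW wn)//.
  have -> : g n ^+ 2 = (g n `^ mu) `^ (2 / mu).
    by rewrite -powRrM mulrC divfK ?gt_eqF// powR_mulrn.
  apply: powR_mono; last by rewrite divr_ge0// ltW.
    by rewrite mulr_ge0 ?invr_ge0 ?(ltW K0) ?(ltW wn).
  rewrite mulrC ler_pdivrMr// mulrC.
  exact: le_trans (ler_norm _) (lojasiewicz n).
have := ler_wpM2l (ltW (a_gt0 n)) h; have := descent n; lra.
Qed.

Lemma noise_sq_small p e : p <= 2 * r -> 0 < e ->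
  exists n0, forall n, (n0 <= n)%N -> b n ^+ 2 <= e * t n `^ (- p).
Proof.
move=> pr e0; have [n0 H] := noise_powR_small t_ge1 eps_gt0 eps_cvg
  (ltac:(lra) : 0 < 2 :> R) pr e0.
exists n0 => n nn; have := H _ nn; rewrite -powR_mulrn//.
exact: ltW.
Qed.

Lemma lower_side p : p <= mu * r -> forall e : R, 0 < e ->
  exists n0, forall n, (n0 <= n)%N -> - (e * t n `^ (- p)) <= w n.
Proof.
move=> pr e e0; have K0 : 0 < K by exact: lt_le_trans K_ge1.
have C0 : 0 < K * 5 `^ mu by rewrite mulr_gt0// powR_gt0.
have [n0 H] := noise_powR_small t_ge1 eps_gt0 eps_cvg mu0 pr (divr_gt0 e0 C0).
exists n0 => n nn.
apply: le_trans (lower_rate a_gt0 b_gt0 b_noninc g_ge0 mu0 K0 descent lojasiewicz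
  w_cvg n).
rewrite lerN2; have := H _ nn; rewrite mulrAC ler_pdivlMr//.
by rewrite [X in X <= _ -> _]mulrC.
Qed.

(** When r (2 - mu) < 1, the exponent mu r imposed by the noise is smaller than the exponent
    mu / (2 - mu) of the noiseless decay (for mu = 2 the latter is infinite). *)
Lemma value_rate_o : r * (2 - mu) < 1 -> rate_o w (fun n => t n `^ (- (mu * r))).
Proof.
case/andP: mu_bnd => mu1 mu2 rmu e e0.
have K0 : 0 < K by exact: lt_le_trans K_ge1.
have c0 : 0 < K^-1 `^ (2 / mu) / 4.
  by rewrite divr_gt0// powR_gt0// invr_gt0.
have [||n1 H1] := @upper_rate_littleo R a t a_gt0 t_ge1 t_step a_cvg t_cvg w
  (fun n => 3 * b n ^+ 2) r mu _ r_gt1 mu1 mu2 rmu c0 w_cvg _ _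
  drift_from_lojasiewicz e e0.
- move=> e' e'0; have e'3 : 0 < e' / 3 by rewrite divr_gt0.
  have [n0 H] := noise_sq_small (lexx _) e'3.
  by exists n0 => n nn; have := H _ nn; lra.
- move=> n; have := descent n.
  have : 0 <= a n * g n ^+ 2 by rewrite mulr_ge0 ?sqr_ge0 ?(ltW (a_gt0 n)).
  lra.
have [n2 H2] := lower_side (lexx _) e0.
exists (n1 + n2)%N => n nn; rewrite ler_norml H1 ?H2//; nat_lia.
Qed.

(** When 1 <= r (2 - mu), noise is of order at most t^(-mu/(2 - mu) - 1), and the decay is that of
    y' = - c y^(2/mu). *)
Lemma value_rate_O : 1 <= r * (2 - mu) ->
  rate_O w (fun n => t n `^ (- (mu / (2 - mu)))).
Proof.
case/andP: mu_bnd => mu1 mu2 rmu.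
have m2 : 0 < 2 - mu.
  rewrite ltNge; apply/negP => h; have r0 := r_gt1.
  have : 0 <= r * (mu - 2) by rewrite mulr_ge0; lra.
  lra.
have K0 : 0 < K by exact: lt_le_trans K_ge1.
have c0 : 0 < K^-1 `^ (2 / mu) / 4.
  by rewrite divr_gt0// powR_gt0// invr_gt0.
have q0 : 0 < mu / (2 - mu) by rewrite divr_gt0.
have rle : (2 - mu)^-1 <= r by rewrite -div1r ler_pdivrMr.
have q1 : mu / (2 - mu) + 1 <= 2 * r.
  have -> : mu / (2 - mu) + 1 = 2 * (2 - mu)^-1 by field; rewrite gt_eqF.
  by rewrite ler_wpM2l.
have qr : mu / (2 - mu) <= mu * r by rewrite ler_wpM2l ?(ltW mu0).
have [n0 H] := noise_sq_small q1 ltr01.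
have eqs : 1 + (mu / (2 - mu))^-1 = 2 / mu.
  by field; rewrite !gt_eqF.
have bs n : (n0 <= n)%N ->
    a n * (3 * b n ^+ 2) <= a n * (3 * t n `^ (- (mu / (2 - mu)) - 1)).
  move=> nn; rewrite ler_wpM2l ?(ltW (a_gt0 n))// ler_wpM2l//.
  have := H _ nn; rewrite mul1r; congr (_ <= _ `^ _); ring.
have [||A [A0 [n1 H1]]] := @upper_rate_bigO R a t a_gt0 t_ge1 t_step a_cvg w
   (mu / (2 - mu)) (K^-1 `^ (2 / mu) / 4) 3 n0 q0 c0 (ltac:(lra)).
- move=> n nn; have := descent n; have := bs _ nn.
  have : 0 <= a n * g n ^+ 2 by rewrite mulr_ge0 ?sqr_ge0 ?(ltW (a_gt0 n)).
  lra.
- move=> n nn wn; rewrite eqs; have := drift_from_lojasiewicz wn.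
  by have := bs _ nn; lra.
have [n2 H2] := lower_side qr A0.
exists A => //; exists (n1 + n2)%N => n nn; rewrite ler_norml H1 ?H2//; nat_lia.
Qed.

(** A rate for the value gives one for the gradient by [gradient_window] and one for the distance by
    the potential, whose exponent is 1 - 1/mu times that of the value. The explicit constants let
    the same statement serve both Landau relations. *)
Lemma rates_from_value (p q e : R) : 0 <= p -> p <= mu * r -> q <= r - 1 ->
  q <= p * (1 - mu^-1) -> 0 < e ->
  (exists n0, forall n, (n0 <= n)%N -> `|w n| <= e * t n `^ (- p)) ->
  exists n0, forall n, (n0 <= n)%N ->
    g n ^+ 2 <= 3 * (100 + 200 * L) * e * t n `^ (- p) /\
    D n <= (Ca * (2 * e) `^ (1 - mu^-1) + Cb * e) * t n `^ (- q).
Proof.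
case/andP: (mu_bnd) => mu1 mu2 p0 pr qr qs e0 [n1 H1].
have L0 := L_gt0; have r0 : 0 <= r by have := r_gt1; lra.
have s0 : 0 <= 1 - mu^-1 by rewrite subr_ge0 invf_le1// ltW.
have p2r : p <= 2 * r by apply: le_trans pr _; rewrite ler_wpM2r.
have [n2 H2] := noise_powR_small t_ge1 eps_gt0 eps_cvg mu0 pr e0.
have [n3 H3] := noise_sq_small p2r e0.
have [n4 H4] := noise_tail_small r_gt1 t_ge1 eps_gt0 eps_cvg qr e0.
exists (n1 + n2 + n3 + n4)%N => n nn.
have h1 := H1 n ltac:(nat_lia); have h2 := H2 n ltac:(nat_lia).
have h3 := H3 n ltac:(nat_lia); have h4 := H4 n ltac:(nat_lia).
split.
  have [m nm Hm] := gradient_window a_gt0 t_step t_cvg b_gt0 b_noninc g_ge0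
    L_gt0 La descent g_step n.
  have h1m := H1 m ltac:(nat_lia).
  have tm : t m `^ (- p) <= t n `^ (- p).
    apply: powR_anti => //; last by rewrite oppr_le0.
    by rewrite -(subnKC nm); exact: (clock_mono a_gt0 t_step).
  apply: le_trans Hm _.
  have -> : 3 * (100 + 200 * L) * e * t n `^ (- p) =
     (100 + 200 * L) * (3 * (e * t n `^ (- p))) by ring.
  rewrite ler_wpM2l ?(ltW window_gt0)//.
  have h3' : noise r eps t n ^+ 2 <= e * t n `^ (- p) := h3.
  have := ler_normB (w n) (w m).
  have : e * t m `^ (- p) <= e * t n `^ (- p) by rewrite ler_wpM2l ?(ltW e0).
  lra.
apply: le_trans (D_le n) _; rewrite mulrDl; apply: lerD; last first.
  by rewrite -mulrA ler_wpM2l.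
rewrite -mulrA ler_wpM2l//.
have e2 : 0 <= 2 * e by lra.
apply: (@le_trans _ _ ((2 * e * t n `^ (- p)) `^ (1 - mu^-1))).
  apply: powR_mono => //; first by rewrite addr_ge0// powR_ge0.
  lra.
rewrite powRM ?powR_ge0// ler_wpM2l ?powR_ge0//.
by rewrite -powRrM mulNr; exact: clock_powR_le.
Qed.

Lemma rates_o p q : 0 <= p -> p <= mu * r -> q <= r - 1 ->
  q <= p * (1 - mu^-1) -> rate_o w (fun n => t n `^ (- p)) ->
  rate_o (fun n => g n ^+ 2) (fun n => t n `^ (- p)) /\
  rate_o D (fun n => t n `^ (- q)).
Proof.
move=> p0 pr qr qs ow; have L0 := L_gt0.
have s0 : 0 < 1 - mu^-1.
  by case/andP: mu_bnd => mu1 _; rewrite subr_gt0 invf_lt1.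
split=> e e0.
  have e1 : 0 < e / (3 * (100 + 200 * L)) := divr_gt0 e0 window3_gt0.
  have [n0 H] := rates_from_value p0 pr qr qs e1 (ow _ e1).
  exists n0 => n nn; have [] := H _ nn => h _.
  rewrite ger0_norm ?sqr_ge0//; apply: le_trans h _.
  by rewrite mulrCA divff ?mulr1// (gt_eqF window3_gt0).
pose e1 := Num.min ((e / (2 * (Ca + 1))) `^ (1 - mu^-1)^-1 / 2) (e / (2 * (Cb + 1))).
have Ca1 : 0 < 2 * (Ca + 1) by have := Ca_ge0; lra.
have Cb1 : 0 < 2 * (Cb + 1) by have := Cb_ge0; lra.
have e10 : 0 < e1.
  by rewrite lt_min !divr_gt0// powR_gt0// divr_gt0.
have [n0 H] := rates_from_value p0 pr qr qs e10 (ow _ e10).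
exists n0 => n nn; have [] := H _ nn => _ h.
rewrite ger0_norm ?D_ge0//; apply: le_trans h _.
rewrite ler_wpM2r ?powR_ge0//.
have h1 : (2 * e1) `^ (1 - mu^-1) <= e / (2 * (Ca + 1)).
  have : 2 * e1 <= (e / (2 * (Ca + 1))) `^ (1 - mu^-1)^-1.
    by rewrite mulrC -ler_pdivlMr// ge_min lexx.
  have e12 : 0 <= 2 * e1 by lra.
  move=> /(powR_mono e12) /(_ (ltW s0)).
  by rewrite -powRrM mulVf ?gt_eqF// powRr1// divr_ge0// ltW.
have h2 : e1 <= e / (2 * (Cb + 1)) by rewrite ge_min lexx orbT.
have h3 : Ca * (2 * e1) `^ (1 - mu^-1) <= e / 2.
  apply: le_trans (ler_wpM2l Ca_ge0 h1) _.
  by rewrite mulrA ler_pdivrMr//; lra.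
have h4 : Cb * e1 <= e / 2.
  apply: le_trans (ler_wpM2l Cb_ge0 h2) _.
  by rewrite mulrA ler_pdivrMr//; lra.
lra.
Qed.

Lemma rates_O p q : 0 <= p -> p <= mu * r -> q <= r - 1 ->
  q <= p * (1 - mu^-1) -> rate_O w (fun n => t n `^ (- p)) ->
  rate_O (fun n => g n ^+ 2) (fun n => t n `^ (- p)) /\
  rate_O D (fun n => t n `^ (- q)).
Proof.
move=> p0 pr qr qs [e e0 ow]; have L0 := L_gt0.
have [n0 H] := rates_from_value p0 pr qr qs e0 ow.
split.
  exists (3 * (100 + 200 * L) * e); first exact: mulr_gt0.
  by exists n0 => n nn; have [] := H _ nn; rewrite ger0_norm ?sqr_ge0.
exists (Ca * (2 * e) `^ (1 - mu^-1) + Cb * e + 1).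
  by rewrite ltr_wpDl// addr_ge0// mulr_ge0 ?powR_ge0 ?Ca_ge0 ?Cb_ge0// ltW.
exists n0 => n nn; have [_ h] := H _ nn; rewrite ger0_norm ?D_ge0//.
by apply: le_trans h _; rewrite ler_wpM2r ?powR_ge0// lerDl.
Qed.

Lemma settled_rates_o : r * (2 - mu) < 1 ->
  [/\ rate_o w (fun n => t n `^ (- (mu * r))),
      rate_o (fun n => g n ^+ 2) (fun n => t n `^ (- (mu * r))) &
      rate_o D (fun n => t n `^ (- (r - 1)))].
Proof.
move=> rmu; have ow := value_rate_o rmu.
have r0 := r_gt1.
have [] := @rates_o (mu * r) (r - 1) _ _ _ _ ow => //.
- by rewrite mulr_ge0 ?(ltW mu0)//; lra.
- have -> : mu * r * (1 - mu^-1) = r * (mu - 1) by field; rewrite gt_eqF.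
  lra.
Qed.

Lemma settled_rates_O : 1 <= r * (2 - mu) ->
  [/\ rate_O w (fun n => t n `^ (- (mu / (2 - mu)))),
      rate_O (fun n => g n ^+ 2) (fun n => t n `^ (- (mu / (2 - mu)))) &
      rate_O D (fun n => t n `^ (- ((2 - mu)^-1 - 1)))].
Proof.
move=> rmu; have ow := value_rate_O rmu.
have r0 : 0 < r by have := r_gt1; lra.
have m2 : 0 < 2 - mu by rewrite -(pmulr_rgt0 _ r0); lra.
have rle : (2 - mu)^-1 <= r by rewrite -div1r ler_pdivrMr.
have [] := @rates_O (mu / (2 - mu)) ((2 - mu)^-1 - 1) _ _ _ _ ow => //.
- by rewrite divr_ge0 ?ltW.
- by rewrite ler_wpM2l ?(ltW mu0).
- by rewrite lerD2r.
- rewrite le_eqVlt; apply/orP; left; apply/eqP.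
  by field; rewrite !gt_eqF.
Qed.

Lemma settled_gradient_cvg : g n @[n --> \oo] --> 0.
Proof.
apply/cvgrPdist_le => e e0.
have r0 := r_gt1; have L0 := L_gt0.
have e1 : 0 < e ^+ 2 / (3 * (100 + 200 * L)).
  by rewrite divr_gt0 ?exprn_gt0.
have [n0 H0] := cvg0_eventually w_cvg e1.
have mu1 : 1 - mu^-1 >= 0.
  by case/andP: mu_bnd => mu1 _; rewrite subr_ge0 invf_le1// ltW.
have [||||n1 H1] := @rates_from_value 0 0 _ (lexx _) _ _ _ e1.
- by rewrite mulr_ge0 ?(ltW mu0)//; lra.
- lra.
- by rewrite mul0r.
- by exists n0 => n nn; rewrite oppr0 powRr0 mulr1; exact: H0.
exists n1 => // n nn /=; have [+ _] := H1 n nn.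
rewrite oppr0 powRr0 mulr1 sub0r normrN ger0_norm//.
rewrite mulrCA divff ?mulr1 ?(gt_eqF window3_gt0)//.
by rewrite ler_sqr ?nnegrE// ltW.
Qed.

End Settled.

End ScalarRates.

(** * Perturbed gradient descent near a cluster point *)

Section ShiftRates.
Variable R : realType.
Implicit Types (u v : nat -> R).

Lemma rate_o_shift u v k :
  rate_o (fun n => u (n + k)%N) (fun n => v (n + k)%N) -> rate_o u v.
Proof.
move=> uv e e0; have [n0 H] := uv e e0; exists (n0 + k)%N => n nn.
have kn : (k <= n)%N by apply: leq_trans nn; exact: leq_addl.
by have := H (n - k)%N; rewrite subnK//; apply; rewrite leq_subRL// addnC.
Qed.

Lemma rate_O_shift u v k :
  rate_O (fun n => u (n + k)%N) (fun n => v (n + k)%N) -> rate_O u v.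
Proof.
move=> [C C0 [n0 H]]; exists C => //; exists (n0 + k)%N => n nn.
have kn : (k <= n)%N by apply: leq_trans nn; exact: leq_addl.
by have := H (n - k)%N; rewrite subnK//; apply; rewrite leq_subRL// addnC.
Qed.

Lemma cvg_shift u (l : R) k :
  u n @[n --> \oo] --> l -> u (n + k)%N @[n --> \oo] --> l.
Proof. by move=> h; rewrite (cvg_shiftn k u). Qed.

End ShiftRates.

Section PerturbedDescent.
Variable R : realType.
Variables (a t eps w g D : nat -> R) (r mu K L delta Gm : R).
Hypothesis r_gt1 : 1 < r.
Hypothesis mu_bnd : 1 < mu <= 2.
Hypothesis K_ge1 : 1 <= K.
Hypothesis L_gt0 : 0 < L.
Hypothesis delta_gt0 : 0 < delta.
Hypothesis a_gt0 : forall n, 0 < a n.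
Hypothesis a_le1 : forall n, a n <= 1.
Hypothesis La : forall n, 4 * L * a n <= 1.
Hypothesis a_cvg : a n @[n --> \oo] --> 0.
Hypothesis t_ge1 : forall n, 1 <= t n.
Hypothesis t_step : forall n, t n.+1 = t n + a n.
Hypothesis t_cvg : t n @[n --> \oo] --> +oo.
Hypothesis eps_gt0 : forall n, 0 < eps n.
Hypothesis eps_noninc : forall n, eps n.+1 <= eps n.
Hypothesis eps_cvg : eps n @[n --> \oo] --> 0.
Hypothesis g_ge0 : forall n, 0 <= g n.
Hypothesis g_le : forall n, g n <= Gm.
Hypothesis descent : forall n,
  w n.+1 <= w n - a n * g n ^+ 2 / 4 + 3 * a n * noise r eps t n ^+ 2.
Hypothesis w_step : forall n,
  `|w n.+1 - w n| <= a n * (g n ^+ 2 + 3 * noise r eps t n ^+ 2).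
Hypothesis g_step : forall n,
  (1 - L * a n) * g n - L * a n * noise r eps t n <= g n.+1.
Hypothesis D_step : forall n, `|D n.+1 - D n| <= a n * (g n + noise r eps t n).
Hypothesis lojasiewicz : forall n, D n <= delta -> `|w n| <= K * g n `^ mu.
Hypothesis w_cvg : w n @[n --> \oo] --> 0.
Hypothesis D_ge0 : forall n, 0 <= D n.
Hypothesis D_frequently : forall e, 0 < e -> forall n,
  exists2 m, (n <= m)%N & D m <= e.

(** The potential traps the sequence near the cluster point; from the trapping time on, the scalar
    recursions apply, and shifting the index does not affect the rates. *)
Theorem perturbed_descent_rates :
  [/\ D n @[n --> \oo] --> 0,
      g n @[n --> \oo] --> 0,
      r * (2 - mu) < 1 ->
        [/\ rate_o w (fun n => t n `^ (- (mu * r))),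
            rate_o (fun n => g n ^+ 2) (fun n => t n `^ (- (mu * r))) &
            rate_o D (fun n => t n `^ (- (r - 1)))] &
      1 <= r * (2 - mu) ->
        [/\ rate_O w (fun n => t n `^ (- (mu / (2 - mu)))),
            rate_O (fun n => g n ^+ 2) (fun n => t n `^ (- (mu / (2 - mu)))) &
            rate_O D (fun n => t n `^ (- ((2 - mu)^-1 - 1)))]].
Proof.
have b_gt0 := noise_gt0 r t_ge1 eps_gt0.
have b_noninc := noise_noninc r_gt1 a_gt0 t_ge1 t_step eps_gt0 eps_noninc.
have b_cvg := noise_cvg r_gt1 t_ge1 eps_gt0 eps_cvg.
have tau_step := noise_tail_step r_gt1 a_gt0 a_le1 t_ge1 t_step eps_gt0 eps_noninc.
have tau_ge0 := noise_tail_ge0 t r_gt1 eps_gt0.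
have tau_cvg := noise_tail_cvg r_gt1 t_ge1 eps_gt0 eps_cvg.
have D_cvg := trapped_cvg a_gt0 a_le1 b_gt0 b_noninc g_ge0 g_le mu_bnd K_ge1
  descent w_step D_step lojasiewicz tau_step D_ge0 w_cvg b_cvg tau_ge0 tau_cvg
  delta_gt0 D_frequently.
have [Ca [Cb [Ca0 Cb0 [k H]]]] := distance_le_potential a_gt0 a_le1 b_gt0 b_noninc
  g_ge0 g_le mu_bnd K_ge1
  descent w_step D_step lojasiewicz tau_step D_ge0 w_cvg b_cvg tau_ge0 tau_cvg
  delta_gt0 D_frequently.
pose sh (u : nat -> R) n := u (n + k)%N.
have a_cvg' : sh a n @[n --> \oo] --> 0 by exact: cvg_shift.
have w_cvg' : sh w n @[n --> \oo] --> 0 by exact: cvg_shift.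
have eps_cvg' : sh eps n @[n --> \oo] --> 0 by exact: cvg_shift.
have t_cvg' : sh t n @[n --> \oo] --> +oo.
  by rewrite /sh (cvg_shiftn k t).
have t_step' n : sh t n.+1 = sh t n + sh a n by rewrite /sh addSn t_step.
have D_le' n : sh D n <= Ca * (`|sh w n| + noise r (sh eps) (sh t) n `^ mu)
    `^ (1 - mu^-1) + Cb * noise_tail r (sh eps) (sh t) n.
  by have [] := H (n + k)%N (leq_addl _ _).
have loj' n : `|sh w n| <= K * sh g n `^ mu.
  by apply: lojasiewicz; have [] := H (n + k)%N (leq_addl _ _).
split => //.
- have h : sh g n @[n --> \oo] --> 0.
    exact: (@settled_gradient_cvg R (sh a) (sh t) (sh eps) (sh w) (sh g) (sh D)
      r mu L Ca Cb r_gt1 mu_bnd L_gt0 Ca0 Cb0 (fun=> a_gt0 _) (fun=> La _)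
      (fun=> t_ge1 _) t_step' t_cvg' (fun=> eps_gt0 _) (fun=> eps_noninc _)
      eps_cvg' (fun=> g_ge0 _) (fun=> descent _) (fun=> g_step _) w_cvg' D_le').
  by rewrite -(cvg_shiftn k g).
- move=> rmu.
  have [h1 h2 h3] := @settled_rates_o R (sh a) (sh t) (sh eps) (sh w) (sh g) (sh D)
    r mu K L Ca Cb r_gt1 mu_bnd K_ge1 L_gt0 Ca0 Cb0 (fun=> a_gt0 _) (fun=> La _)
    a_cvg' (fun=> t_ge1 _) t_step' t_cvg' (fun=> eps_gt0 _) (fun=> eps_noninc _)
    eps_cvg' (fun=> g_ge0 _) (fun=> descent _) (fun=> g_step _) loj' w_cvg'
    (fun=> D_ge0 _) D_le' rmu.
  by split; apply: rate_o_shift; [exact: h1|exact: h2|exact: h3].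
- move=> rmu.
  have [h1 h2 h3] := @settled_rates_O R (sh a) (sh t) (sh eps) (sh w) (sh g) (sh D)
    r mu K L Ca Cb r_gt1 mu_bnd K_ge1 L_gt0 Ca0 Cb0 (fun=> a_gt0 _) (fun=> La _)
    a_cvg' (fun=> t_ge1 _) t_step' t_cvg' (fun=> eps_gt0 _) (fun=> eps_noninc _)
    eps_cvg' (fun=> g_ge0 _) (fun=> descent _) (fun=> g_step _) loj' w_cvg'
    (fun=> D_ge0 _) D_le' rmu.
  by split; apply: rate_O_shift; [exact: h1|exact: h2|exact: h3].
Qed.

End PerturbedDescent.

(** * The Euclidean norm of matrices *)

Section Frobenius.
Variable R : realType.
Implicit Types m n : nat.

Definition dot m n (A B : 'M[R]_(m, n)) : R := \sum_i \sum_j A i j * B i j.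

Lemma dotC m n (A B : 'M[R]_(m, n)) : dot A B = dot B A.
Proof. by apply: eq_bigr => i _; apply: eq_bigr => j _; rewrite mulrC. Qed.

Lemma dotDl m n (A B C : 'M[R]_(m, n)) : dot (A + B) C = dot A C + dot B C.
Proof.
rewrite -big_split; apply: eq_bigr => i _ /=; rewrite -big_split.
by apply: eq_bigr => j _; rewrite !mxE mulrDl.
Qed.

Lemma dotZl m n (c : R) (A B : 'M[R]_(m, n)) : dot (c *: A) B = c * dot A B.
Proof.
rewrite /dot mulr_sumr; apply: eq_bigr => i _; rewrite mulr_sumr.
by apply: eq_bigr => j _; rewrite !mxE mulrA.
Qed.

Lemma dotDr m n (A B C : 'M[R]_(m, n)) : dot A (B + C) = dot A B + dot A C.
Proof. by rewrite dotC dotDl !(dotC A). Qed.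

Lemma dotZr m n (c : R) (A B : 'M[R]_(m, n)) : dot A (c *: B) = c * dot A B.
Proof. by rewrite dotC dotZl dotC. Qed.

Lemma dot_ge0 m n (A : 'M[R]_(m, n)) : 0 <= dot A A.
Proof. by do 2 (apply: sumr_ge0 => ? _); rewrite -expr2 sqr_ge0. Qed.

Lemma dot_trace m n (A B : 'M[R]_(m, n)) : dot A B = \tr (A^T *m B).
Proof.
rewrite /dot /mxtrace exchange_big; apply: eq_bigr => j _; rewrite mxE.
by apply: eq_bigr => i _; rewrite mxE.
Qed.

Lemma dot_delta m n (A : 'M[R]_(m, n)) i j : dot A (delta_mx i j) = A i j.
Proof.
rewrite /dot (bigD1 i)//= (bigD1 j)//= !mxE !eqxx mulr1.
rewrite big1 ?addr0; last by move=> k kj; rewrite mxE (negPf kj) andbF mulr0.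
rewrite big1 ?addr0// => l li; rewrite big1// => k _.
by rewrite mxE (negPf li) mulr0.
Qed.

Lemma enormE m n (A : 'M[R]_(m, n)) : enorm A = Num.sqrt (dot A A).
Proof.
by congr Num.sqrt; apply: eq_bigr => i _; apply: eq_bigr => j _.
Qed.

Lemma enorm_ge0 m n (A : 'M[R]_(m, n)) : 0 <= enorm A.
Proof. by rewrite enormE sqrtr_ge0. Qed.

Lemma sqr_enorm m n (A : 'M[R]_(m, n)) : enorm A ^+ 2 = dot A A.
Proof. by rewrite enormE sqr_sqrtr ?dot_ge0. Qed.

Lemma enorm_le_sqr m n (A : 'M[R]_(m, n)) e :
  0 <= e -> dot A A <= e ^+ 2 -> enorm A <= e.
Proof. by move=> e0 h; rewrite -(@ler_sqr _ (enorm A)) ?nnegrE ?enorm_ge0// sqr_enorm. Qed.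

(** Expand the square of |B|^2 A - <A, B> B. *)
Lemma dot_sqr_le m n (A B : 'M[R]_(m, n)) : dot A B ^+ 2 <= dot A A * dot B B.
Proof.
have [B0|B0] := eqVneq (dot B B) 0.
  suff -> : dot A B = 0 by rewrite B0 expr0n mulr0.
  rewrite /dot; apply: big1 => i _; apply: big1 => j _.
  suff -> : B i j = 0 by rewrite mulr0.
  apply/eqP; rewrite -sqrf_eq0; apply/eqP.
  move: B0 => /eqP; rewrite psumr_eq0; last first.
    by move=> k _; apply: sumr_ge0 => l _; rewrite -expr2 sqr_ge0.
  move=> /allP /(_ i (mem_index_enum _)) /=; rewrite psumr_eq0; last first.
    by move=> l _; rewrite -expr2 sqr_ge0.
  by move=> /allP /(_ j (mem_index_enum _)) /= /eqP; rewrite expr2.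
have Bp : 0 < dot B B by rewrite lt_def B0 dot_ge0.
have := dot_ge0 (dot B B *: A + (- dot A B) *: B).
rewrite !(dotDl, dotDr, dotZl, dotZr) (dotC B A).
set x := dot A A; set y := dot A B; set z := dot B B.
rewrite (_ : _ + _ = z * (x * z - y ^+ 2)); last by ring.
by rewrite pmulr_rge0// subr_ge0.
Qed.

Lemma dot_le m n (A B : 'M[R]_(m, n)) : `|dot A B| <= enorm A * enorm B.
Proof.
rewrite -ler_sqr ?nnegrE ?mulr_ge0 ?enorm_ge0// exprMn !sqr_enorm.
by rewrite real_normK ?num_real// dot_sqr_le.
Qed.

Lemma enormZ m n c (A : 'M[R]_(m, n)) : enorm (c *: A) = `|c| * enorm A.
Proof.
by rewrite !enormE dotZl dotZr mulrA -expr2 sqrtrM ?sqr_ge0// sqrtr_sqr.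
Qed.

Lemma enormN m n (A : 'M[R]_(m, n)) : enorm (- A) = enorm A.
Proof. by rewrite -scaleN1r enormZ normrN1 mul1r. Qed.

Lemma enormD m n (A B : 'M[R]_(m, n)) : enorm (A + B) <= enorm A + enorm B.
Proof.
apply: enorm_le_sqr; first by rewrite addr_ge0 ?enorm_ge0.
rewrite dotDl !dotDr (dotC B A) sqrrD !sqr_enorm.
have := le_trans (ler_norm _) (dot_le A B); lra.
Qed.

Lemma enormB m n (A B : 'M[R]_(m, n)) : enorm (A - B) = enorm (B - A).
Proof. by rewrite -enormN opprB. Qed.

Lemma enorm_dist m n (A B : 'M[R]_(m, n)) : `|enorm A - enorm B| <= enorm (A - B).
Proof.
have h1 := enormD (A - B) B; have h2 := enormD (B - A) A.
rewrite !subrK in h1 h2; rewrite (enormB B) in h2.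
by rewrite ler_norml; apply/andP; split; lra.
Qed.

Lemma entry_le_enorm m n (A : 'M[R]_(m, n)) i j : `|A i j| <= enorm A.
Proof.
rewrite -ler_sqr ?nnegrE ?enorm_ge0// sqr_enorm real_normK ?num_real//.
rewrite /dot (bigD1 i)//= (bigD1 j)//= -addrA -expr2 lerDl addr_ge0//.
  by apply: sumr_ge0 => k _; rewrite -expr2 sqr_ge0.
by do 2 (apply: sumr_ge0 => ? _); rewrite -expr2 sqr_ge0.
Qed.

Lemma enorm_le_entries m n (A : 'M[R]_(m, n)) :
  enorm A <= \sum_i \sum_j `|A i j|.
Proof.
have -> : A = \sum_i \sum_j (A i j *: delta_mx i j) by exact: matrix_sum_delta.
set S := (X in enorm X).
have E i j : S i j = A i j by rewrite /S -matrix_sum_delta.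
under [leRHS]eq_bigr do under eq_bigr do rewrite E.
have tri (I : Type) (s : seq I) (P : pred I) (F : I -> 'M[R]_(m, n)) (G : I -> R) :
    (forall i, enorm (F i) <= G i) ->
    enorm (\sum_(i <- s | P i) F i) <= \sum_(i <- s | P i) G i.
  move=> FG; elim/big_rec2: _ => [|i x y _ h].
    by rewrite -(scale0r 0) enormZ normr0 mul0r.
  by apply: le_trans (enormD _ _) _; rewrite lerD.
rewrite /S; apply: (tri) => i; apply: (tri) => j; rewrite enormZ.
suff -> : enorm (delta_mx i j : 'M[R]_(m, n)) = 1 by rewrite mulr1.
by rewrite enormE dot_delta mxE !eqxx sqrtr1.
Qed.

Lemma mx_norm_le_enorm m n (A : 'M[R]_(m, n)) : `|A| <= enorm A.
Proof.
rewrite [leLHS]/Num.Def.normr /= mx_normrE; apply/bigmax_leP; split; first exact: enorm_ge0.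
by move=> [i j] _ /=; exact: entry_le_enorm.
Qed.

Lemma entry_le_mx_norm m n (A : 'M[R]_(m, n)) i j : `|A i j| <= `|A|.
Proof.
by rewrite [leRHS]/Num.Def.normr /= mx_normrE; apply/bigmax_geP; right => /=; exists (i, j).
Qed.

Lemma enorm_le_mx_norm m n (A : 'M[R]_(m, n)) :
  enorm A <= (n * m)%:R * `|A|.
Proof.
apply: le_trans (enorm_le_entries A) _.
apply: (@le_trans _ _ (\sum_(i < m) \sum_(j < n) `|A|)).
  by do 2 (apply: ler_sum => ? _); exact: entry_le_mx_norm.
by rewrite sumr_const card_ord sumr_const card_ord -mulrnA -[leLHS]mulr_natl.
Qed.

Lemma enorm_cvg m n (Y : nat -> 'M[R]_(m, n)) A :
  enorm (Y k - A) @[k --> \oo] --> 0 -> Y k @[k --> \oo] --> A.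
Proof.
move=> /cvgrPdist_le h; apply/cvgrPdist_le => e e0.
apply: filterS (h e e0) => k; rewrite sub0r normrN ger0_norm ?enorm_ge0// => le.
by apply: le_trans (mx_norm_le_enorm _) _; rewrite enormB.
Qed.

(** Bolzano-Weierstrass, applied to the entries listed as one row vector. *)
Lemma bounded_cluster m n (Y : nat -> 'M[R]_(m, n)) (Q : R) :
  (forall k, enorm (Y k) <= Q) ->
  exists A, forall e, 0 < e -> forall k, exists2 l, (k <= l)%N & enorm (Y l - A) <= e.
Proof.
move=> YQ.
have Kc : compact [set v : 'rV[R]_(m * n) | forall i, `[- Q, Q]%classic (v ord0 i)].
  apply: (@rV_compact R _ (fun=> `[- Q, Q]%classic)) => _; exact: segment_compact.
have [|v [_ vcl]] := Kc ((fun k => mxvec (Y k)) @ \oo) _.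
  exists 0%N => // k _ /= i; rewrite in_itv /= -ler_norml.
  case/mxvec_indexP: i => i j; rewrite mxvecE.
  exact: le_trans (entry_le_enorm _ _ _) (YQ k).
exists (vec_mx v) => e e0 k.
have e1 : 0 < e / ((n * m)%:R + 1).
  by rewrite divr_gt0// ltr_wpDl// mulr_ge0.
have [||u [[l /= kl <-] vu]] := vcl [set u | exists2 l, (k <= l)%N & mxvec (Y l) = u]
   (ball v (e / ((n * m)%:R + 1))).
- by exists k => // l /= kl; exists l.
- exact: nbhsx_ballx.
exists l => //; apply: le_trans (enorm_le_mx_norm _) _.
have h : `|Y l - vec_mx v| <= e / ((n * m)%:R + 1).
  move: vu; rewrite mx_norm_ball /ball_ /= => /ltW; rewrite -normrN opprB.
  apply: le_trans.
  rewrite [leLHS]/Num.Def.normr /= mx_normrE; apply/bigmax_leP; split => //.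
  move=> [i j] _ /=.
  have -> : (Y l - vec_mx v) i j = (mxvec (Y l) - v) ord0 (mxvec_index i j).
    by rewrite !mxE mxvecE.
  exact: entry_le_mx_norm.
apply: le_trans (ler_wpM2l _ h) _; first exact: ler0n.
rewrite mulrA ler_pdivrMr ?ltr_wpDl ?ler0n//.
by rewrite mulrC ler_wpM2l ?(ltW e0)// lerDl.
Qed.

End Frobenius.

(** * The quartic objective and its gradient *)

Section LocallyLipschitz.
Variables (R : realType) (m n : nat).
Implicit Types (F : 'M[R]_(m, n) -> R).

Definition locally_lipschitz F := forall Q : R, exists2 L, 0 <= L &
  forall A B, enorm A <= Q -> enorm B <= Q -> `|F A - F B| <= L * enorm (A - B).

Lemma locally_lipschitz_bounded F : locally_lipschitz F ->
  forall Q : R, exists2 C, 0 <= C & forall A, enorm A <= Q -> `|F A| <= C.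
Proof.
move=> FL Q; have [L L0 H] := FL `|Q|.
exists (`|F 0| + L * `|Q|); first by rewrite addr_ge0 ?mulr_ge0.
move=> A AQ; have AQ' : enorm A <= `|Q| by exact: le_trans AQ (ler_norm _).
have e0 : enorm (0 : 'M[R]_(m, n)) <= `|Q|.
  by rewrite -(scale0r 0) enormZ normr0 mul0r.
have := H A 0 AQ' e0; rewrite subr0 => h.
have := ler_normD (F 0) (F A - F 0); rewrite addrC subrK => h2.
have := ler_wpM2l L0 AQ'; lra.
Qed.

Lemma locally_lipschitz_cst c : locally_lipschitz (fun=> c).
Proof. by move=> Q; exists 0 => // A B _ _; rewrite subrr normr0 mul0r. Qed.

Lemma locally_lipschitz_entry i j : locally_lipschitz (fun A => A i j).
Proof.
move=> Q; exists 1 => // A B _ _; rewrite mul1r.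
by apply: le_trans (entry_le_enorm (A - B) i j); rewrite !mxE.
Qed.

Lemma locally_lipschitzD F G : locally_lipschitz F -> locally_lipschitz G ->
  locally_lipschitz (fun A => F A + G A).
Proof.
move=> FL GL Q; have [L1 L10 H1] := FL Q; have [L2 L20 H2] := GL Q.
exists (L1 + L2); first exact: addr_ge0.
move=> A B AQ BQ; rewrite opprD addrACA mulrDl.
by apply: le_trans (ler_normD _ _) _; rewrite lerD ?H1 ?H2.
Qed.

Lemma locally_lipschitzM F G : locally_lipschitz F -> locally_lipschitz G ->
  locally_lipschitz (fun A => F A * G A).
Proof.
move=> FL GL Q; have [L1 L10 H1] := FL Q; have [L2 L20 H2] := GL Q.
have [C1 C10 B1] := locally_lipschitz_bounded FL Q.
have [C2 C20 B2] := locally_lipschitz_bounded GL Q.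
exists (L1 * C2 + C1 * L2); first by rewrite addr_ge0 ?mulr_ge0.
move=> A B AQ BQ.
have -> : F A * G A - F B * G B = (F A - F B) * G A + F B * (G A - G B) by ring.
apply: le_trans (ler_normD _ _) _; rewrite !normrM mulrDl; apply: lerD.
  by rewrite mulrAC; apply: ler_pM => //; [exact: H1|exact: B2].
by rewrite -mulrA; apply: ler_pM => //; [exact: B1|exact: H2].
Qed.

Lemma locally_lipschitz_sum (I : Type) (s : seq I) (Fi : I -> 'M[R]_(m, n) -> R) :
  (forall i, locally_lipschitz (Fi i)) ->
  locally_lipschitz (fun A => \sum_(i <- s) Fi i A).
Proof.
move=> FL; elim: s => [|i s IH].
  under eq_fun do rewrite big_nil.
  exact: locally_lipschitz_cst.
under eq_fun do rewrite big_cons.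
exact: locally_lipschitzD.
Qed.

Definition locally_lipschitz_mx p q (F : 'M[R]_(m, n) -> 'M[R]_(p, q)) :=
  forall i j, locally_lipschitz (fun A => F A i j).

Lemma locally_lipschitz_mx_cst p q (A : 'M[R]_(p, q)) :
  locally_lipschitz_mx (fun=> A).
Proof. by move=> i j; exact: locally_lipschitz_cst. Qed.

Lemma locally_lipschitz_mx_id : locally_lipschitz_mx id.
Proof. by move=> i j; exact: locally_lipschitz_entry. Qed.

Lemma locally_lipschitz_mx_tr p q (F : 'M[R]_(m, n) -> 'M[R]_(p, q)) :
  locally_lipschitz_mx F -> locally_lipschitz_mx (fun A => (F A)^T).
Proof. by move=> FL i j; under eq_fun do rewrite mxE; exact: FL. Qed.

Lemma locally_lipschitz_mxD p q (F G : 'M[R]_(m, n) -> 'M[R]_(p, q)) :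
  locally_lipschitz_mx F -> locally_lipschitz_mx G ->
  locally_lipschitz_mx (fun A => F A + G A).
Proof.
move=> FL GL i j; under eq_fun do rewrite mxE.
exact: locally_lipschitzD.
Qed.

Lemma locally_lipschitz_mxM p q k (F : 'M[R]_(m, n) -> 'M[R]_(p, q))
    (G : 'M[R]_(m, n) -> 'M[R]_(q, k)) :
  locally_lipschitz_mx F -> locally_lipschitz_mx G ->
  locally_lipschitz_mx (fun A => F A *m G A).
Proof.
move=> FL GL i j; under eq_fun do rewrite mxE.
by apply: locally_lipschitz_sum => l; exact: locally_lipschitzM.
Qed.

Lemma locally_lipschitz_mxZ p q c (F : 'M[R]_(m, n) -> 'M[R]_(p, q)) :
  locally_lipschitz_mx F -> locally_lipschitz_mx (fun A => c *: F A).
Proof.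
move=> FL i j; under eq_fun do rewrite mxE.
apply: locally_lipschitzM => //; exact: locally_lipschitz_cst.
Qed.

Lemma locally_lipschitz_mxB p q (F G : 'M[R]_(m, n) -> 'M[R]_(p, q)) :
  locally_lipschitz_mx F -> locally_lipschitz_mx G ->
  locally_lipschitz_mx (fun A => F A - G A).
Proof.
move=> FL GL; under eq_fun do rewrite -scaleN1r.
by apply: locally_lipschitz_mxD => //; exact: locally_lipschitz_mxZ.
Qed.

Lemma locally_lipschitz_mx_enorm p q (F : 'M[R]_(m, n) -> 'M[R]_(p, q)) :
  locally_lipschitz_mx F -> forall Q : R, exists2 L, 0 <= L &
  forall A B, enorm A <= Q -> enorm B <= Q ->
    enorm (F A - F B) <= L * enorm (A - B).
Proof.
move=> FL Q.
have /choice [Li HLi] : forall ij : 'I_p * 'I_q, exists L, 0 <= L /\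
    forall A B, enorm A <= Q -> enorm B <= Q ->
    `|F A ij.1 ij.2 - F B ij.1 ij.2| <= L * enorm (A - B).
  by move=> [i j]; have [L L0 H] := FL i j Q; exists L.
exists (\sum_i \sum_j Li (i, j)).
  by apply: sumr_ge0 => i _; apply: sumr_ge0 => j _; have [] := HLi (i, j).
move=> A B AQ BQ; apply: le_trans (enorm_le_entries _) _.
rewrite mulr_suml; apply: ler_sum => i _; rewrite mulr_suml; apply: ler_sum => j _.
have [_ H] := HLi (i, j); rewrite mxE [X in _ + X]mxE; exact: H.
Qed.

Lemma locally_lipschitz_mx_bounded p q (F : 'M[R]_(m, n) -> 'M[R]_(p, q)) :
  locally_lipschitz_mx F -> forall Q : R, exists2 C, 0 <= C &
  forall A, enorm A <= Q -> enorm (F A) <= C.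
Proof.
move=> FL Q; have [L L0 H] := locally_lipschitz_mx_enorm FL `|Q|.
exists (enorm (F 0) + L * `|Q|); first by rewrite addr_ge0 ?mulr_ge0 ?enorm_ge0.
move=> A AQ; have AQ' : enorm A <= `|Q| by exact: le_trans AQ (ler_norm _).
have e0 : enorm (0 : 'M[R]_(m, n)) <= `|Q|.
  by rewrite -(scale0r 0) enormZ normr0 mul0r.
have := H A 0 AQ' e0; rewrite subr0 => h.
have := enormD (F 0) (F A - F 0); rewrite addrC subrK => h2.
have := ler_wpM2l L0 AQ'; lra.
Qed.

End LocallyLipschitz.

Section Quartic.
Variable R : realType.

(** Only the linear coefficient survives in the limit of the difference quotients. *)
Lemma is_derive_quartic (V : normedModType R) (f : V -> R) (a v : V)
    (c1 c2 c3 c4 : R) :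
  (forall h : R, f (h *: v + a) =
     f a + h * c1 + h ^+ 2 * c2 + h ^+ 3 * c3 + h ^+ 4 * c4) ->
  is_derive a v f c1.
Proof.
move=> fE.
suff H : (fun h : R => h^-1 *: ((f \o shift a) (h *: v) - f a)) @ 0^' --> c1.
  by split; [exact: cvgP H|exact: cvg_lim].
pose g (h : R) := c1 + h * c2 + h ^+ 2 * c3 + h ^+ 3 * c4.
have gc : g h @[h --> 0^'] --> c1.
  have -> : c1 = g 0 by rewrite /g; ring.
  apply: (@cvg_within_filter _ _ g (nbhs 0)).
  rewrite /g; apply: cvgD; [apply: cvgD; [apply: cvgD|]|].
  - exact: cvg_cst.
  - by apply: cvgM; [exact: cvg_id|exact: cvg_cst].
  - by apply: cvgM; [exact: exprn_continuous|exact: cvg_cst].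
  - by apply: cvgM; [exact: exprn_continuous|exact: cvg_cst].
apply: cvg_trans gc; apply: near_eq_cvg; near=> h.
have h0 : h != 0 by near: h; exact: nbhs_dnbhs_neq.
rewrite /= fE /g /GRing.scale /=; field.
exact: h0.
Unshelve. all: by end_near. Qed.

End Quartic.

Section Objective.
Variables (R : realType) (N M : nat) (C : 'M[R]_N).
Hypothesis C_sym : C^T = C.
Implicit Types (A Z : 'M[R]_(N, M)) (T U : 'M[R]_N).

Definition residual A : 'M[R]_N := 1%:M - A *m A^T.

(** The expectation of <T x, U x> for a random vector x whose matrix of second moments is C. *)
Definition covform T U : R := \tr (T *m C *m U^T).

Definition objective A : R := covform (residual A) (residual A).

Definition objective_grad A : 'M[R]_(N, M) :=
  (- 2) *: ((C *m residual A + residual A *m C) *m A).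

Lemma covformDl T U V : covform (T + U) V = covform T V + covform U V.
Proof. by rewrite /covform !mulmxDl mxtraceD. Qed.

Lemma covformZl c T U : covform (c *: T) U = c * covform T U.
Proof. by rewrite /covform -!scalemxAl mxtraceZ. Qed.

Lemma covformC T U : covform T U = covform U T.
Proof.
by rewrite /covform -mxtrace_tr !trmx_mul trmxK C_sym mulmxA.
Qed.

Lemma covformDr T U V : covform V (T + U) = covform V T + covform V U.
Proof. by rewrite covformC covformDl !(covformC V). Qed.

Lemma covformZr c T U : covform T (c *: U) = c * covform T U.
Proof. by rewrite covformC covformZl covformC. Qed.

Let D1 A Z : 'M[R]_N := A *m Z^T + Z *m A^T.
Let D2 Z : 'M[R]_N := Z *m Z^T.

Lemma residual_line A Z h :
  residual (h *: Z + A) = residual A + (- h) *: D1 A Z + (- h ^+ 2) *: D2 Z.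
Proof.
rewrite /residual /D1 /D2 linearD linearZ /= mulmxDl !mulmxDr.
rewrite -!scalemxAl -!scalemxAr scalerA -expr2 !scaleNr scalerDr.
set a := A *m A^T; set b := A *m Z^T; set c := Z *m A^T; set d := Z *m Z^T.
by apply/matrixP => i j; rewrite !mxE; ring.
Qed.

Lemma residual_sym A : (residual A)^T = residual A.
Proof. by rewrite /residual linearB /= trmx1 trmx_mul trmxK. Qed.

Lemma covform_grad A Z : - 2 * covform (D1 A Z) (residual A) = dot (objective_grad A) Z.
Proof.
rewrite dotC dotZr; congr (_ * _).
rewrite /covform; move: (residual A) (residual_sym A) => T Ts.
rewrite Ts /D1 !mulmxDl mxtraceD -!mulmxA dotDr !dot_trace; congr (_ + _).
  by rewrite mxtrace_mulC !mulmxA.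
by rewrite -[LHS]mxtrace_tr !trmx_mul trmxK C_sym Ts mxtrace_mulC !mulmxA.
Qed.

(** The residual is quadratic in A and the form is bilinear; expanding along a line gives the
    derivative at once. *)
Lemma objective_line A Z : exists c2 c3 c4, forall h,
  objective (h *: Z + A) = objective A + h * dot (objective_grad A) Z
     + h ^+ 2 * c2 + h ^+ 3 * c3 + h ^+ 4 * c4.
Proof.
exists (covform (D1 A Z) (D1 A Z) - 2 * covform (D2 Z) (residual A)).
exists (2 * covform (D1 A Z) (D2 Z)), (covform (D2 Z) (D2 Z)) => h.
rewrite -covform_grad /objective residual_line.
move: (residual A) (D1 A Z) (D2 Z) => T d1 d2.
rewrite !(covformDl, covformDr, covformZl, covformZr).
rewrite !(covformC T) (covformC d2 d1).
ring.
Qed.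

Lemma is_derive_objective A Z : is_derive A Z objective (dot (objective_grad A) Z).
Proof. by have [c2 [c3 [c4 H]]] := objective_line A Z; exact: is_derive_quartic H. Qed.

Lemma grad_objective A : grad objective A = objective_grad A.
Proof.
apply/matrixP => i j; rewrite mxE.
by have [_ ->] := is_derive_objective A (delta_mx i j); rewrite dot_delta.
Qed.

Lemma objective_mvt A Z : exists2 c, 0 <= c <= 1 &
  objective (A + Z) - objective A = dot (objective_grad (c *: Z + A)) Z.
Proof.
pose f h := objective (h *: Z + A).
have fd (h : R) : is_derive h (1 : R) f (dot (objective_grad (h *: Z + A)) Z).
  have [c2 [c3 [c4 H]]] := objective_line (h *: Z + A) Z.
  apply: (is_derive_quartic (c2 := c2) (c3 := c3) (c4 := c4)) => k.
  rewrite /f -H; congr objective.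
  by rewrite addrA -scalerDl /GRing.scale /= mulr1.
have [|c c01] := @MVT_segment R f _ 0 1 ler01 (fun x _ => fd x).
  apply: derivable_within_continuous => x _; by have [] := fd x.
rewrite /f scale1r scale0r add0r subr0 mulr1 (addrC Z) => ->.
by exists c => //; move: c01; rewrite in_itv.
Qed.

Lemma residual_lipschitz : locally_lipschitz_mx residual.
Proof.
apply: locally_lipschitz_mxB; first exact: locally_lipschitz_mx_cst.
apply: locally_lipschitz_mxM; first exact: locally_lipschitz_mx_id.
by apply: locally_lipschitz_mx_tr; exact: locally_lipschitz_mx_id.
Qed.

Lemma objective_grad_lipschitz : locally_lipschitz_mx objective_grad.
Proof.
apply: locally_lipschitz_mxZ; apply: locally_lipschitz_mxM; last first.
  exact: locally_lipschitz_mx_id.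
have cC := @locally_lipschitz_mx_cst R N M _ _ C.
by apply: locally_lipschitz_mxD; apply: locally_lipschitz_mxM => //;
  exact: residual_lipschitz.
Qed.

(** On a ball the gradient, being polynomial, is Lipschitz, and the mean value theorem gives the
    second order estimate. *)
Lemma objective_taylor (Q : R) : exists2 L, 0 < L &
  [/\ forall A B, enorm A <= Q -> enorm B <= Q ->
        enorm (objective_grad A - objective_grad B) <= L * enorm (A - B),
      forall A Z, enorm A <= Q -> enorm (A + Z) <= Q ->
        `|objective (A + Z) - objective A - dot (objective_grad A) Z|
          <= L * enorm Z ^+ 2,
      forall A, enorm A <= Q -> enorm (objective_grad A) <= L &
      forall A, enorm A <= Q -> `|objective A| <= L].
Proof.
have [L L0 HL] := locally_lipschitz_mx_enorm objective_grad_lipschitz Q.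
have [G G0 HG] := locally_lipschitz_mx_bounded objective_grad_lipschitz Q.
have oL : locally_lipschitz objective.
  rewrite /objective /covform /mxtrace.
  apply: locally_lipschitz_sum => i.
  apply: locally_lipschitz_mxM; last by apply: locally_lipschitz_mx_tr; exact: residual_lipschitz.
  apply: locally_lipschitz_mxM; first exact: residual_lipschitz.
  exact: locally_lipschitz_mx_cst.
have [B B0 HB] := locally_lipschitz_bounded oL Q.
exists (L + G + B + 1); first by lra.
split.
- move=> A A' AQ AQ'; apply: le_trans (HL _ _ AQ AQ') _.
  by rewrite ler_wpM2r ?enorm_ge0//; lra.
- move=> A Z AQ AZQ; have [c /andP[c0 c1] ->] := objective_mvt A Z.
  have cQ : enorm (c *: Z + A) <= Q.
    have -> : c *: Z + A = c *: (A + Z) + (1 - c) *: A.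
      by apply/matrixP => i j; rewrite !mxE; ring.
    apply: le_trans (enormD _ _) _; rewrite !enormZ !ger0_norm ?subr_ge0//.
    have := ler_wpM2l c0 AZQ; have := ler_wpM2l (ltac:(lra) : 0 <= 1 - c) AQ.
    lra.
  rewrite -[- dot _ _]mulN1r -dotZl scaleN1r -dotDl.
  apply: le_trans (dot_le _ _) _; rewrite expr2 mulrA ler_wpM2r ?enorm_ge0//.
  apply: le_trans (HL _ _ cQ AQ) _.
  rewrite addrK enormZ (ger0_norm c0).
  have e0 := enorm_ge0 Z.
  have h1 : c * enorm Z <= 1 * enorm Z by rewrite ler_wpM2r.
  have h2 := ler_wpM2l L0 h1.
  have h3 : 0 <= (G + B + 1) * enorm Z by rewrite mulr_ge0//; lra.
  lra.
- by move=> A AQ; apply: le_trans (HG _ AQ) _; lra.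
- by move=> A AQ; apply: le_trans (HB _ AQ) _; lra.
Qed.

End Objective.

(** * Abel summation and orders of decay *)

Section Abel.
Variable R : realType.
Implicit Types (x c u : nat -> R).

(** Summation by parts: the weights decrease, so their increments telescope. *)
Lemma abel_bound x c (e : R) n k :
  (forall i, (i <= k)%N -> 0 <= c (n + i)%N) ->
  (forall i, (i < k)%N -> c (n + i).+1 <= c (n + i)%N) ->
  (forall i, (i <= k)%N -> `|\sum_(n <= j < n + i) x j| <= e) ->
  `|\sum_(n <= j < n + k) c j * x j| <= e * c n.
Proof.
move=> c0 cdec xe.
pose Z i := \sum_(n <= j < n + i) c j * x j -
            c (n + i)%N * \sum_(n <= j < n + i) x j.
have H i : (i <= k)%N -> `|Z i| <= e * (c n - c (n + i)%N).
  elim: i => [|i IH] ik.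
    by rewrite /Z addn0 !big_geq// mulr0 !subrr normr0 mulr0.
  have -> : Z i.+1 = Z i + (c (n + i)%N - c (n + i).+1) * \sum_(n <= j < n + i.+1) x j.
    by rewrite /Z addnS !big_nat_recr ?leq_addr//=; ring.
  apply: le_trans (ler_normD _ _) _.
  have h1 := IH (ltnW ik); have h2 := xe _ ik.
  have h3 : 0 <= c (n + i)%N - c (n + i).+1 by rewrite subr_ge0 cdec.
  rewrite normrM (ger0_norm h3).
  have := ler_wpM2l h3 h2; rewrite addnS; lra.
have hk := H k (leqnn k); have h2 := xe _ (leqnn k); have h3 := c0 _ (leqnn k).
have -> : \sum_(n <= j < n + k) c j * x j =
   Z k + c (n + k)%N * \sum_(n <= j < n + k) x j by rewrite /Z subrK.
apply: le_trans (ler_normD _ _) _; rewrite normrM (ger0_norm h3).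
have := ler_wpM2l h3 h2; lra.
Qed.

(** Removing the weights 1 / c from a convergent series of terms x: the tails of the series of
    c n * x n are o(c n) by summation by parts. *)
Lemma weighted_tail x c (n1 : nat) :
  (forall i, (n1 <= i)%N -> 0 <= c i) ->
  (forall i, (n1 <= i)%N -> c i.+1 <= c i) ->
  cvgn (series x) ->
  cvgn (series (fun n => c n * x n)) /\
  rate_o (fun n => limn (series (fun n => c n * x n)) -
                   series (fun n => c n * x n) n) c.
Proof.
move=> c0 cdec /cauchy_cvgP/cauchy_seriesP xc.
have main (e : R) : 0 < e -> exists n0, (n1 <= n0)%N /\ forall n m, (n0 <= n)%N -> (n <= m)%N ->
    `|\sum_(n <= j < m) c j * x j| <= e * c n.
  move=> e0; have [[A B] /= [[a _ Aa] [b _ Bb]] AB] := xc _ e0.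
  exists (n1 + a + b)%N; split; first by lia.
  move=> n m nn nm; rewrite -(subnKC nm); apply: abel_bound.
  - by move=> i _; apply: c0; lia.
  - by move=> i _; apply: cdec; lia.
  - move=> i _; apply: ltW; apply: (AB (n, n + i)%N).
    by split => /=; [apply: Aa => /=; lia|apply: Bb => /=; lia].
have ccvg : cvgn (series (fun n => c n * x n)).
  apply/cauchy_cvgP/cauchy_seriesP => e e0.
  have C0 : 0 < c n1 + 1 by have := c0 n1 (leqnn _); lra.
  have [n0 [n10 H]] := main (e / 2 / (c n1 + 1)) ltac:(by rewrite !divr_gt0).
  have cle k : c (n1 + k)%N <= c n1.
    elim: k => [|k IH]; first by rewrite addn0.
    by rewrite addnS; apply: le_trans IH; apply: cdec; lia.
  have sm n m : (n0 <= n)%N -> `|\sum_(n <= j < m) c j * x j| < e.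
    move=> nn; have [nm|mn] := leqP n m; last by rewrite big_geq ?normr0// ltnW.
    apply: le_lt_trans (H _ _ nn nm) _.
    have n1n : (n1 <= n)%N by exact: leq_trans nn.
    have := cle (n - n1)%N; rewrite subnKC// => cn.
    have e2 : 0 <= e / 2 / (c n1 + 1) by rewrite !divr_ge0// ltW.
    have := ler_wpM2l e2 cn.
    have : e / 2 / (c n1 + 1) * c n1 <= e / 2.
      by rewrite -mulrA ler_piMr ?divr_ge0 ?(ltW e0)// mulrC ler_pdivrMr// mul1r; lra.
    lra.
  exists ([set n | (n0 <= n)%N], [set n | (n0 <= n)%N]) => /=.
    by split; exists n0.
  by move=> [n m] [/= nn _]; exact: sm.
split=> // e e0.
have [n0 [_ H]] := main _ e0.
exists n0 => n nn.
have hcv : `|series (fun n => c n * x n) m - series (fun n => c n * x n) n|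
   @[m --> \oo] --> `|limn (series (fun n => c n * x n)) -
   series (fun n => c n * x n) n|.
  by apply: cvg_norm; apply: cvgB => //; exact: cvg_cst.
rewrite -(cvg_lim _ hcv)//; apply: limr_le; first by apply/cvg_ex; eexists; exact: hcv.
exists n => // m /= nm; rewrite sub_series nm; exact: H.
Qed.

(** The suprema of the tails are nonincreasing; adding 1 / (n + 1) makes them positive. *)
Lemma noninc_majorant u : (forall n, 0 <= u n) -> u n @[n --> \oo] --> 0 ->
  exists eps : nat -> R, [/\ forall n, 0 < eps n, forall n, eps n.+1 <= eps n,
    eps n @[n --> \oo] --> 0 & forall n, u n <= eps n].
Proof.
move=> u0 ucv.
have [B [_ HB]] := cvg_seq_bounded (cvgP _ ucv).
have ub : has_ubound (range u).
  exists (B + 1) => _ [n _ <-].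
  by apply: le_trans (ler_norm _) _; apply: HB; rewrite ?ltrDl.
have usup n : u n <= sups u n.
  apply: ub_le_sup; last by exists n => /=.
  by case: ub => b Hb; exists b => _ [k _ <-]; apply: Hb; exists k.
exists (fun n => sups u n + n.+1%:R^-1); split.
- by move=> n; rewrite ltr_wpDl ?invr_gt0// (le_trans (u0 n)).
- move=> n; apply: lerD; first by apply: (nonincreasing_sups ub).
  by rewrite lef_pV2 ?posrE// ler_nat.
- rewrite -[X in _ --> X](addr0 0); apply: cvgD; first exact: cvg_sups.
  exact: cvg_harmonic.
- by move=> n; apply: le_trans (usup n) _; rewrite lerDl invr_ge0.
Qed.

End Abel.

Section RateAlgebra.
Variable R : realType.
Implicit Types (u v : nat -> R).

Lemma rate_o_le u u' v : (forall n, `|u n| <= `|u' n|) -> rate_o u' v -> rate_o u v.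
Proof.
move=> uu h e e0; have [n0 H] := h e e0; exists n0 => n nn.
exact: le_trans (uu n) (H n nn).
Qed.

Lemma rate_O_le u u' v : (forall n, `|u n| <= `|u' n|) -> rate_O u' v -> rate_O u v.
Proof.
move=> uu [C C0 [n0 H]]; exists C => //; exists n0 => n nn.
exact: le_trans (uu n) (H n nn).
Qed.

Lemma rate_oD u u' v : rate_o u v -> rate_o u' v -> rate_o (fun n => u n + u' n) v.
Proof.
move=> h h' e e0; have e2 : 0 < e / 2 by lra.
have [n0 H] := h _ e2; have [n1 H'] := h' _ e2; exists (n0 + n1)%N => n nn.
have := ler_normD (u n) (u' n); have := H n ltac:(nat_lia).
have := H' n ltac:(nat_lia); lra.
Qed.

Lemma rate_OD u u' v : rate_O u v -> rate_O u' v -> rate_O (fun n => u n + u' n) v.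
Proof.
move=> [C C0 [n0 H]] [C' C'0 [n1 H']]; exists (C + C'); first exact: addr_gt0.
exists (n0 + n1)%N => n nn.
have := ler_normD (u n) (u' n); have := H n ltac:(nat_lia).
have := H' n ltac:(nat_lia); lra.
Qed.

Lemma rate_oZ u v c : rate_o u v -> rate_o (fun n => c * u n) v.
Proof.
move=> h e e0; have c0 : 0 < `|c| + 1 by rewrite ltr_wpDl.
have [n0 H] := h _ (divr_gt0 e0 c0); exists n0 => n nn.
have h1 := H n nn; have := ler_wpM2l (ltW c0) h1; rewrite mulrA mulrCA divff ?gt_eqF// mulr1.
have := normr_ge0 (u n); rewrite normrM; lra.
Qed.

Lemma rate_OZ u v c : rate_O u v -> rate_O (fun n => c * u n) v.
Proof.
move=> [C C0 [n0 H]]; exists ((`|c| + 1) * C).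
  by rewrite mulr_gt0// ltr_wpDl.
exists n0 => n nn; rewrite normrM -mulrA.
have h1 := H n nn; have := ler_wpM2l (normr_ge0 c) h1.
have := normr_ge0 (u n); lra.
Qed.

Lemma rate_oO u v : rate_o u v -> rate_O u v.
Proof. by move=> h; exists 1 => //; exact: h. Qed.

Lemma rate_o_sum (I : Type) (s : seq I) (u : I -> nat -> R) v :
  (forall n, 0 <= v n) ->
  (forall i, rate_o (u i) v) -> rate_o (fun n => \sum_(i <- s) u i n) v.
Proof.
move=> v0 h; elim: s => [|i s IH].
  move=> e e0; exists 0%N => n _; rewrite big_nil normr0.
  by apply: mulr_ge0 => //; exact: ltW.
apply: (@rate_o_le _ (fun n => u i n + \sum_(j <- s) u j n)).
  by move=> n; rewrite big_cons.
exact: rate_oD.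
Qed.

End RateAlgebra.

(** * Convergence along one path *)

Section OneStep.
Variable R : realType.

(** F and F' are the values before and after a step of length zn, d is the linear term of the
    expansion, and b bounds the error of the direction; 8 L a <= 1 lets the descent term absorb the
    quadratic remainder. *)
Lemma perturbed_step_bounds (a g b L F F' d zn : R) :
  0 <= a -> 0 <= g -> 0 <= b -> 0 <= L -> 8 * L * a <= 1 ->
  0 <= zn -> zn <= a * (g / 2 + b) ->
  `|d + a * g ^+ 2 / 2| <= a * (g * b) ->
  `|F' - F - d| <= L * zn ^+ 2 ->
  F' <= F - a * g ^+ 2 / 4 + 3 * a * b ^+ 2 /\
  `|F' - F| <= a * (g ^+ 2 + 3 * b ^+ 2).
Proof.
move=> a0 g0 b0 L0 La zn0 zna hd hF.
have s1 : (g / 2 + b) ^+ 2 <= g ^+ 2 / 2 + 2 * b ^+ 2.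
  by have := sqr_ge0 (g / 2 - b); lra.
have s2 : g * b <= g ^+ 2 / 8 + 2 * b ^+ 2 by have := sqr_ge0 (g - 4 * b); lra.
have gb0 : 0 <= g / 2 + b by lra.
have h1 : zn ^+ 2 <= (a * (g / 2 + b)) ^+ 2.
  by rewrite ler_sqr ?nnegrE// mulr_ge0.
have h2 : L * zn ^+ 2 <= a / 8 * (g / 2 + b) ^+ 2.
  apply: le_trans (ler_wpM2l L0 h1) _.
  have -> : L * (a * (g / 2 + b)) ^+ 2 = (8 * L * a) * (a / 8 * (g / 2 + b) ^+ 2) by field.
  by rewrite ler_piMl// mulr_ge0 ?sqr_ge0// divr_ge0.
have h3 : a / 8 * (g / 2 + b) ^+ 2 <= a / 8 * (g ^+ 2 / 2 + 2 * b ^+ 2).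
  by rewrite ler_wpM2l// divr_ge0.
have h4 := ler_wpM2l a0 s2.
have ag : 0 <= a * g ^+ 2 by rewrite mulr_ge0 ?sqr_ge0.
have ab : 0 <= a * b ^+ 2 by rewrite mulr_ge0 ?sqr_ge0.
move: hd hF; rewrite !ler_norml => /andP[d1 d2] /andP[F1 F2].
split; first lra.
by apply/andP; split; lra.
Qed.

End OneStep.

Section Pathwise.
Variables (R : realType) (N M : nat) (C : 'M[R]_N).
Variables (alpha : nat -> R) (r Q0 : R) (Theta xi : nat -> 'M[R]_(N, M)).
Variables (delta mu K : 'M[R]_(N, M) -> R).
Hypothesis C_sym : C^T = C.
Hypothesis r_gt1 : 1 < r.
Hypothesis alpha_gt0 : forall n, 0 < alpha n.
Hypothesis alpha_cvg : alpha n @[n --> \oo] --> 0.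
Hypothesis gamma_cvg : gamma alpha n @[n --> \oo] --> +oo.
Hypothesis recursion : forall n, Theta n.+1 =
  Theta n + alpha n *: (- 2^-1 *: objective_grad C (Theta n) + xi n).
Hypothesis Theta_le : forall n, enorm (Theta n) <= Q0.
Hypothesis xi_cvg : forall i j,
  cvgn (series (fun n => alpha n * gamma alpha n `^ r * xi n i j)).
Hypothesis delta_gt0 : forall A, 0 < delta A.
Hypothesis mu_bnd : forall A, 1 < mu A <= 2.
Hypothesis K_ge1 : forall A, 1 <= K A.
Hypothesis lojasiewicz : forall A A', enorm (A' - A) <= delta A ->
  `|objective C A' - objective C A| <= K A * enorm (objective_grad C A') `^ mu A.

Let gam := gamma alpha.

Lemma gammaS n : gam n.+1 = gam n + alpha n.
Proof. by rewrite /gam /gamma big_ord_recr. Qed.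

Lemma gamma_gt0 n : (0 < n)%N -> 0 < gam n.
Proof.
case: n => // n _; elim: n => [|n IH]; rewrite gammaS.
  by rewrite /gam /gamma big_ord0 add0r.
by rewrite addr_gt0.
Qed.

(** T n is the tail of the series of alpha k * xi k. This series converges, with tails o(gamma^(-r)),
    because the one with the additional weights gamma^r does; index 0 is left out as gamma 0 = 0. *)
Lemma noise_tail_exists : exists T : nat -> 'M[R]_(N, M),
  (forall n, (0 < n)%N -> T n.+1 = T n - alpha n *: xi n) /\
  rate_o (fun n => enorm (T n)) (fun n => gam n `^ (- r)).
Proof.
have r0 : 0 < r by have := r_gt1; lra.
pose x i j n := alpha n * gam n `^ r * xi n i j.
pose c n := gam n `^ (- r).
have c_dec n : (1 <= n)%N -> c n.+1 <= c n.
  move=> n1; apply: powR_anti; first exact: gamma_gt0.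
    by rewrite gammaS lerDl ltW.
  by rewrite oppr_le0 ltW.
have tail i j := @weighted_tail R (x i j) c 1 (fun n _ => powR_ge0 _ _)
  c_dec (@xi_cvg i j).
pose T n : 'M[R]_(N, M) := \matrix_(i, j)
  (limn (series (fun n => c n * x i j n)) - series (fun n => c n * x i j n) n).
exists T; split.
  move=> n n0; apply/matrixP => i j; rewrite !mxE seriesSr /c /x.
  have g0 : gam n `^ r != 0 by rewrite gt_eqF// powR_gt0// gamma_gt0.
  by rewrite powRN; field.
apply: (@rate_o_le _ _ (fun n => \sum_i \sum_j `|T n i j|)).
  move=> n; rewrite ger0_norm ?enorm_ge0//; apply: le_trans (ler_norm _).
  exact: enorm_le_entries.
apply: rate_o_sum => [n|i]; first exact: powR_ge0.
apply: rate_o_sum => [n|j]; first exact: powR_ge0.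
have [_ h] := tail i j.
by apply: rate_o_le h => n; rewrite normr_id mxE.
Qed.

(** Adding the noise tail to the iterates produces a sequence Y which performs gradient steps with an
    error proportional to that tail, so a summable one. The values at Y converge, Y has a cluster
    point A, and A is its limit by [perturbed_descent_rates]. *)
Theorem pathwise_convergence : exists A,
  [/\ Theta n @[n --> \oo] --> A,
      objective_grad C A = 0,
      r * (2 - mu A) < 1 ->
        [/\ rate_o (fun n => enorm (objective_grad C (Theta n)) ^+ 2)
              (fun n => gam n `^ (- (mu A * r))),
            rate_o (fun n => objective C (Theta n) - objective C A)
              (fun n => gam n `^ (- (mu A * r))) &
            rate_o (fun n => enorm (Theta n - A)) (fun n => gam n `^ (- (r - 1)))] &
      1 <= r * (2 - mu A) ->
        [/\ rate_O (fun n => enorm (objective_grad C (Theta n)) ^+ 2)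
              (fun n => gam n `^ (- (mu A / (2 - mu A)))),
            rate_O (fun n => objective C (Theta n) - objective C A)
              (fun n => gam n `^ (- (mu A / (2 - mu A)))) &
            rate_O (fun n => enorm (Theta n - A))
              (fun n => gam n `^ (- ((2 - mu A)^-1 - 1)))]].
Proof.
have r1 := r_gt1.
have r0 : 0 < r by lra.
have [T [TS Tsmall]] := noise_tail_exists.
have [L L0 [GL taylor GB FB]] := @objective_taylor R N M C C_sym (Q0 + 1).
have L1 : 0 < L + 1 by lra.
have L8 : 0 < (8 * (L + 1))^-1 by rewrite invr_gt0; lra.
(* The factor L + 1 makes b below dominate both the tail and L times the tail. *)
pose v n := (L + 1) * (enorm (T n) * gam n `^ r).
have v0 n : 0 <= v n by rewrite !mulr_ge0 ?enorm_ge0 ?powR_ge0 ?(ltW L1).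
have v_cvg : v n @[n --> \oo] --> 0.
  apply/cvgrPdist_le => e e0; have [n0 H] := Tsmall _ (divr_gt0 e0 L1).
  exists n0.+1 => // n /= nn; rewrite sub0r normrN ger0_norm//.
  have gn : 0 < gam n by apply: gamma_gt0; exact: leq_ltn_trans nn.
  have := H n (ltnW nn); rewrite ger0_norm ?enorm_ge0// powRN ler_pdivlMr ?powR_gt0//.
  by rewrite ler_pdivlMr// mulrC.
have [eps' [eps'0 eps'S eps'_cvg veps]] := noninc_majorant v0 v_cvg.
(* The one-step estimates hold once the step sizes and the tails are small, so
   all sequences are shifted by a fixed number k of steps. *)
have [k1 H1] := cvg0_eventually alpha_cvg (ltr01 : 0 < 1 :> R).
have [k2 H2] := cvg0_eventually alpha_cvg L8.
have [k3 _ H3] : \forall n \near \oo, 1 <= gam n by move/cvgryPge: gamma_cvg; exact.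
have [k4 H4] : exists k, forall n, (k <= n)%N -> enorm (T n) <= 1.
  have [k H] := Tsmall 1 ltr01; exists (k + k3)%N => n nn.
  apply: le_trans (ler_norm _) (le_trans (H n ltac:(nat_lia)) _); rewrite mul1r.
  rewrite -[leRHS](powRr0 (gam n)); apply: ler_powR; last by rewrite oppr_le0 ltW.
  by apply: H3 => /=; nat_lia.
pose k := (k1 + k2 + k3 + k4).+1.
pose a n := alpha (n + k)%N.
pose t n := gam (n + k)%N.
pose eps n := eps' (n + k)%N.
pose Tk n := T (n + k)%N.
pose Y n := Theta (n + k)%N + Tk n.
pose b := noise r eps t.
have a_gt0 n : 0 < a n by exact: alpha_gt0.
have a_le1 n : a n <= 1.
  by apply: le_trans (ler_norm _) _; apply: H1; rewrite /k; lia.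
have La n : 8 * L * a n <= 1.
  have h : a n <= (8 * (L + 1))^-1.
    by apply: le_trans (ler_norm _) _; apply: H2; rewrite /k; lia.
  have h2 : 8 * (L + 1) * a n <= 1.
    by rewrite -(@ler_pM2l _ (8 * (L + 1))^-1)// mulrA mulVf ?mul1r ?mulr1// gt_eqF//; lra.
  have := a_gt0 n; lra.
have a_cvg : a n @[n --> \oo] --> 0 by exact: cvg_shift.
have t_ge1 n : 1 <= t n by apply: H3 => /=; rewrite /k; lia.
have t_step n : t n.+1 = t n + a n by rewrite /t addSn gammaS.
have t_cvg : t n @[n --> \oo] --> +oo by rewrite /t (cvg_shiftn k gam).
have eps_gt0 n : 0 < eps n by exact: eps'0.
have eps_noninc n : eps n.+1 <= eps n by exact: eps'S.
have eps_cvg : eps n @[n --> \oo] --> 0 by exact: cvg_shift.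
have t_gt0 n : 0 < t n by exact: lt_le_trans (t_ge1 n).
have b_gt0 n : 0 < b n := noise_gt0 r t_ge1 eps_gt0 n.
have Tb n : (L + 1) * enorm (Tk n) <= b n.
  rewrite /b /noise powRN ler_pdivlMr ?powR_gt0// -mulrA; exact: veps.
have T_ge0 n := enorm_ge0 (Tk n).
have T_le n : enorm (Tk n) <= b n.
  by have := Tb n; have := mulr_ge0 (ltW L0) (T_ge0 n); lra.
have LT_le n : L * enorm (Tk n) <= b n by have := Tb n; have := T_ge0 n; lra.
have TQ n : enorm (Theta (n + k)%N) <= Q0 + 1 by have := Theta_le (n + k)%N; lra.
have YQ n : enorm (Y n) <= Q0 + 1.
  apply: le_trans (enormD _ _) _; rewrite lerD//.
  by apply: H4; rewrite /k; nat_lia.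
have YT n : Theta (n + k)%N - Y n = - Tk n by rewrite /Y opprD addNKr.
(* The noise cancels between Theta and its tail; what remains is the error e of
   the gradient, which is Lipschitz. *)
pose e n := 2^-1 *: (objective_grad C (Theta (n + k)%N) - objective_grad C (Y n)).
have YS n : Y n.+1 - Y n = - a n *: (2^-1 *: objective_grad C (Y n) + e n).
  rewrite /Y /Tk addSn recursion TS; last by rewrite /k; lia.
  rewrite /e -/(Tk n) -/(Y n) /a.
  by apply/matrixP => i j; rewrite !mxE; ring.
have e_le n : enorm (e n) <= b n.
  rewrite /e enormZ ger0_norm ?invr_ge0//.
  have := GL _ _ (TQ n) (YQ n); rewrite YT enormN => h.
  by have := LT_le n; have := b_gt0 n; lra.
pose g n := enorm (objective_grad C (Y n)).
have g_ge0 n : 0 <= g n by exact: enorm_ge0.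
have g_le n : g n <= L by apply: GB; exact: YQ.
have Z_le n : enorm (Y n.+1 - Y n) <= a n * (g n / 2 + b n).
  rewrite YS enormZ normrN (gtr0_norm (a_gt0 n)) ler_wpM2l ?(ltW (a_gt0 n))//.
  apply: le_trans (enormD _ _) _; rewrite lerD//.
  by rewrite enormZ ger0_norm ?invr_ge0// mulrC.
have bg n : 0 <= b n * g n by rewrite mulr_ge0 ?(ltW (b_gt0 n)).
have Z_le' n : enorm (Y n.+1 - Y n) <= a n * (g n + b n).
  apply: le_trans (Z_le n) _; rewrite ler_wpM2l ?(ltW (a_gt0 n))//.
  by have := g_ge0 n; lra.
have steps n := @perturbed_step_bounds R (a n) (g n) (b n) L (objective C (Y n))
   (objective C (Y n.+1)) (dot (objective_grad C (Y n)) (Y n.+1 - Y n))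
   (enorm (Y n.+1 - Y n)) (ltW (a_gt0 n)) (g_ge0 n) (ltW (b_gt0 n)) (ltW L0) (La n)
   (enorm_ge0 _) (Z_le n).
have {}steps n : objective C (Y n.+1) <=
      objective C (Y n) - a n * g n ^+ 2 / 4 + 3 * a n * b n ^+ 2 /\
    `|objective C (Y n.+1) - objective C (Y n)| <= a n * (g n ^+ 2 + 3 * b n ^+ 2).
  apply: steps.
    rewrite YS dotZr dotDr dotZr -sqr_enorm -/(g n).
    rewrite (_ : _ + _ = - (a n * dot (objective_grad C (Y n)) (e n))); last by field.
    rewrite normrN normrM (gtr0_norm (a_gt0 n)) ler_wpM2l ?(ltW (a_gt0 n))//.
    apply: le_trans (dot_le _ _) _; rewrite ler_wpM2l//; exact: enorm_ge0.
  have := taylor (Y n) (Y n.+1 - Y n) (YQ n); rewrite addrC subrK; exact.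
have [A HA] := bounded_cluster YQ.
pose w n := objective C (Y n) - objective C A.
pose D n := enorm (Y n - A).
have AQ : enorm A <= Q0 + 1.
  apply/ler_addgt0Pr => x x0; have [l _ Hl] := HA x x0 0%N.
  have := enormD (Y l) (- (Y l - A)); rewrite opprB addrC subrK enormB => h.
  by apply: le_trans h _; rewrite lerD// YQ.
have D_step n : `|D n.+1 - D n| <= a n * (g n + b n).
  apply: le_trans (enorm_dist _ _) _.
  by rewrite opprB addrA subrK; exact: Z_le'.
have descent n : w n.+1 <= w n - a n * g n ^+ 2 / 4 + 3 * a n * b n ^+ 2.
  have [h _] := steps n; rewrite /w; clear -h; lra.
have w_step n : `|w n.+1 - w n| <= a n * (g n ^+ 2 + 3 * b n ^+ 2).
  have [_] := steps n; rewrite /w opprD addrACA opprK addNr addr0; exact.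
have g_step n : (1 - L * a n) * g n - L * a n * b n <= g n.+1.
  have h1 := GL _ _ (YQ n.+1) (YQ n).
  have h2 := ler_wpM2l (ltW L0) (Z_le' n).
  have := enorm_dist (objective_grad C (Y n.+1)) (objective_grad C (Y n)).
  by rewrite -/(g n) -/(g n.+1) ler_norml => /andP[h3 _]; lra.
have loj n : D n <= delta A -> `|w n| <= K A * g n `^ mu A by exact: lojasiewicz.
have w_near n : `|w n| <= (L + L * D n) * D n.
  have := taylor A (Y n - A) AQ; rewrite addrC subrK => /(_ (YQ n)) h.
  have h2 := dot_le (objective_grad C A) (Y n - A).
  have h3 := ler_wpM2r (enorm_ge0 (Y n - A)) (GB A AQ).
  have := ler_normD (objective C (Y n) - objective C A -
    dot (objective_grad C A) (Y n - A)) (dot (objective_grad C A) (Y n - A)).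
  rewrite subrK -/(w n) -/(D n) in h h2 h3 *; lra.
(* The values plus a multiple of the noise tail are nonincreasing and bounded,
   so they converge; at the cluster point w is arbitrarily small. *)
have b_noninc := noise_noninc r_gt1 a_gt0 t_ge1 t_step eps_gt0 eps_noninc.
have tau_step := noise_tail_step r_gt1 a_gt0 a_le1 t_ge1 t_step eps_gt0 eps_noninc.
have tau_ge0 := noise_tail_ge0 t r_gt1 eps_gt0.
have tau_cvg := noise_tail_cvg r_gt1 t_ge1 eps_gt0 eps_cvg.
have b_le n : b n <= b 0%N.
  by elim: n => // n IH; apply: le_trans (b_noninc n) IH.
have w_cvg : w n @[n --> \oo] --> 0.
  pose u n := w n + 3 * b 0%N * noise_tail r eps t n.
  have u_noninc : nonincreasing_seq u.
    apply/nonincreasing_seqP => n; rewrite /u.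
    have h1 := ler_wpM2l (ltW (b_gt0 0%N)) (tau_step n).
    have h2 : a n * (b n * b n) <= a n * (b 0%N * b n).
      by rewrite ler_wpM2l ?(ltW (a_gt0 n))// ler_wpM2r ?(ltW (b_gt0 n)).
    have h3 : 0 <= a n * g n ^+ 2 by rewrite mulr_ge0 ?sqr_ge0 ?(ltW (a_gt0 n)).
    have := descent n; rewrite -/(b n) in h1; lra.
  have u_cvg : cvgn u.
    apply: nonincreasing_is_cvgn => //.
    exists (- L - objective C A) => _ [n _ <-].
    have h1 := FB _ (YQ n); have h2 := tau_ge0 n.
    have h3 : 0 <= 3 * b 0%N * noise_tail r eps t n.
      by apply: mulr_ge0 => //; apply: mulr_ge0 => //; exact: ltW.
    by move: h1; rewrite ler_norml => /andP[h1 _]; rewrite /u /w; lra.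
  have w_cvg : w n @[n --> \oo] --> limn u.
    have -> : w = (fun n => u n - 3 * b 0%N * noise_tail r eps t n).
      by apply/funext => n; rewrite /u addrK.
    rewrite -[X in _ --> X]subr0; apply: cvgB => //.
    by rewrite -[X in _ --> X](mulr0 (3 * b 0%N)); apply: cvgMr.
  suff <- : limn u = 0 by [].
  apply/eqP; rewrite -normr_le0; apply/ler_addgt0Pr => x x0; rewrite add0r.
  have x2 : 0 < x / 2 by lra.
  move/cvgrPdist_le: w_cvg => /(_ _ x2) [n0 _ Hn0].
  have y0 : 0 < Num.min 1 (x / 2 / (2 * L)).
    by rewrite lt_min ltr01/= divr_gt0// mulr_gt0.
  have [l n0l] := HA _ y0 n0; rewrite -/(D l) le_min => /andP[Dl1 Dl2].
  have D0 : 0 <= D l by exact: enorm_ge0.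
  move: Dl2; rewrite ler_pdivlMr ?mulr_gt0// => Dl2.
  have := Hn0 l n0l => /= h1; have h2 := w_near l.
  have h3 : (L + L * D l) * D l <= (L + L * 1) * D l.
    by rewrite ler_wpM2r// lerD2l ler_wpM2l// ltW.
  have := ler_normD (limn u - w l) (w l); rewrite subrK; lra.
have D_ge0 n : 0 <= D n by exact: enorm_ge0.
have La4 n : 4 * L * a n <= 1.
  by have := La n; have := mulr_ge0 (ltW L0) (ltW (a_gt0 n)); lra.
have [D_cvg g_cvg case_o case_O] := @perturbed_descent_rates R a t eps w g D r
  (mu A) (K A) L (delta A) L r_gt1 (mu_bnd A) (K_ge1 A) L0 (delta_gt0 A)
  a_gt0 a_le1 La4 a_cvg t_ge1 t_step t_cvg eps_gt0 eps_noninc eps_cvg g_ge0 g_le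
  descent w_step g_step D_step loj w_cvg D_ge0 HA.
(* The tails enter the first two rates through their squares; they are of
   smaller order than each rate, so passing from Y back to Theta is harmless. *)
have T_small p : p <= r -> rate_o (fun n => enorm (Tk n)) (fun n => t n `^ (- p)).
  move=> pr x x0.
  have [n0 H] := noise_powR_small t_ge1 eps_gt0 eps_cvg ltr01
    (ltac:(by rewrite mul1r) : p <= 1 * r) x0.
  exists n0 => n nn; rewrite ger0_norm//; apply: le_trans (T_le n) _.
  by have := H n nn; rewrite powRr1// ltW.
have T2_small p : p <= 2 * r -> rate_o (fun n => enorm (Tk n) ^+ 2) (fun n => t n `^ (- p)).
  move=> pr x x0.
  have [n0 H] := noise_powR_small t_ge1 eps_gt0 eps_cvg (ltac:(lra) : 0 < 2 :> R) pr x0.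
  exists n0 => n nn; rewrite ger0_norm ?sqr_ge0//.
  have := H n nn; rewrite powR_mulrn ?(ltW (b_gt0 n))//; apply: le_trans.
  by rewrite ler_sqr ?nnegrE// ?T_le ?(ltW (b_gt0 n)).
have G_le n : enorm (objective_grad C (Theta (n + k)%N)) ^+ 2 <=
    2 * g n ^+ 2 + 2 * L ^+ 2 * enorm (Tk n) ^+ 2.
  have h := GL _ _ (TQ n) (YQ n); rewrite YT enormN in h.
  have h2 := enormD (objective_grad C (Theta (n + k)%N) - objective_grad C (Y n))
    (objective_grad C (Y n)); rewrite subrK -/(g n) in h2.
  have h3 : enorm (objective_grad C (Theta (n + k)%N)) <= g n + L * enorm (Tk n) by lra.
  have h4 : enorm (objective_grad C (Theta (n + k)%N)) ^+ 2 <= (g n + L * enorm (Tk n)) ^+ 2.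
    by rewrite ler_sqr ?nnegrE ?enorm_ge0// addr_ge0// mulr_ge0// ltW.
  by have := sqr_ge0 (g n - L * enorm (Tk n)); lra.
have F_le n : `|objective C (Theta (n + k)%N) - objective C A| <=
    `|w n| + g n ^+ 2 + (1 + L) * enorm (Tk n) ^+ 2.
  have := taylor (Y n) (Theta (n + k)%N - Y n) (YQ n).
  rewrite addrC subrK => /(_ (TQ n)); rewrite YT enormN => h.
  have h2 := dot_le (objective_grad C (Y n)) (- Tk n).
  rewrite enormN -/(g n) in h2.
  have h3 := ler_normD (objective C (Theta (n + k)%N) - objective C (Y n) -
     dot (objective_grad C (Y n)) (- Tk n)) (dot (objective_grad C (Y n)) (- Tk n)).
  rewrite subrK in h3.
  have h4 := ler_normD (objective C (Theta (n + k)%N) - objective C (Y n)) (w n).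
  rewrite /w addrA subrK -/(w n) in h4.
  have h5 := sqr_ge0 (g n - enorm (Tk n)).
  have h6 := sqr_ge0 (g n); have h7 := sqr_ge0 (enorm (Tk n)).
  lra.
have DT_le n : enorm (Theta (n + k)%N - A) <= D n + enorm (Tk n).
  have := enormD (Y n - A) (Theta (n + k)%N - Y n).
  by rewrite YT enormN -YT addrC addrA subrK.
exists A; split.
- have h : enorm (Theta n - A) @[n --> \oo] --> 0.
    rewrite -(cvg_shiftn k (fun n => enorm (Theta n - A))).
    apply: (@squeeze_cvgr _ _ _ _ (fun=> 0) (fun n => D n + enorm (Tk n))).
    - by apply: nearW => n; rewrite enorm_ge0 DT_le.
    - exact: cvg_cst.
    - rewrite -[X in _ --> X](addr0 0); apply: cvgD => //.
      apply: (@squeeze_cvgr _ _ _ _ (fun=> 0) b).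
      + by apply: nearW => n; rewrite T_ge0 T_le.
      + exact: cvg_cst.
      + exact: (noise_cvg r_gt1 t_ge1 eps_gt0 eps_cvg).
  exact: enorm_cvg.
- suff : enorm (objective_grad C A) <= 0.
    move=> h; apply/matrixP => i j; rewrite [RHS]mxE; apply/eqP; rewrite -normr_le0.
    exact: le_trans (entry_le_enorm _ _ _) h.
  apply/ler_addgt0Pr => x x0; rewrite add0r.
  have x2 : 0 < x / 2 by lra.
  have [n1 Hn1] := cvg0_eventually g_cvg x2.
  have [n2 Hn2] := cvg0_eventually D_cvg (divr_gt0 x2 L0).
  have h1 := Hn1 (n1 + n2)%N ltac:(nat_lia); have h2 := Hn2 (n1 + n2)%N ltac:(nat_lia).
  rewrite ger0_norm// in h1; rewrite ger0_norm// ler_pdivlMr// mulrC in h2.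
  have h3 := GL _ _ (YQ (n1 + n2)%N) AQ.
  have := enorm_dist (objective_grad C (Y (n1 + n2)%N)) (objective_grad C A).
  rewrite -/(D (n1 + n2)%N) in h3.
  by rewrite -/(g (n1 + n2)%N) ler_norml => /andP[h4 _]; lra.
- move=> rmu; have [ow og oD] := case_o rmu.
  have m2 : mu A * r <= 2 * r by rewrite ler_wpM2r ?(ltW r0)//; case/andP: (mu_bnd A).
  split; apply: (@rate_o_shift _ _ _ k).
  + apply: (@rate_o_le _ _ (fun n => 2 * g n ^+ 2 + 2 * L ^+ 2 * enorm (Tk n) ^+ 2)).
      by move=> n; rewrite ger0_norm ?sqr_ge0//; apply: le_trans (ler_norm _).
    by apply: rate_oD; apply: rate_oZ => //; exact: T2_small.
  + apply: (@rate_o_le _ _ (fun n => `|w n| + g n ^+ 2 + (1 + L) * enorm (Tk n) ^+ 2)).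
      by move=> n; apply: le_trans (ler_norm _).
    apply: rate_oD; last by apply: rate_oZ; exact: T2_small.
    by apply: rate_oD => //; apply: rate_o_le ow => n; rewrite normr_id.
  + apply: (@rate_o_le _ _ (fun n => D n + enorm (Tk n))).
      by move=> n; rewrite ger0_norm ?enorm_ge0//; apply: le_trans (ler_norm _).
    by apply: rate_oD => //; apply: T_small; lra.
- move=> rmu; have [ow og oD] := case_O rmu.
  have m2 : 0 < 2 - mu A by rewrite -(pmulr_rgt0 _ r0); lra.
  have rle : (2 - mu A)^-1 <= r by rewrite -div1r ler_pdivrMr.
  have p2 : mu A / (2 - mu A) <= 2 * r.
    by apply: ler_pM => //; rewrite ?invr_ge0 ?(ltW m2)//; case/andP: (mu_bnd A); lra.
  split; apply: (@rate_O_shift _ _ _ k).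
  + apply: (@rate_O_le _ _ (fun n => 2 * g n ^+ 2 + 2 * L ^+ 2 * enorm (Tk n) ^+ 2)).
      by move=> n; rewrite ger0_norm ?sqr_ge0//; apply: le_trans (ler_norm _).
    by apply: rate_OD; apply: rate_OZ => //; apply: rate_oO; exact: T2_small.
  + apply: (@rate_O_le _ _ (fun n => `|w n| + g n ^+ 2 + (1 + L) * enorm (Tk n) ^+ 2)).
      by move=> n; apply: le_trans (ler_norm _).
    apply: rate_OD; last by apply: rate_OZ; apply: rate_oO; exact: T2_small.
    by apply: rate_OD => //; apply: rate_O_le ow => n; rewrite normr_id.
  + apply: (@rate_O_le _ _ (fun n => D n + enorm (Tk n))).
      by move=> n; rewrite ger0_norm ?enorm_ge0//; apply: le_trans (ler_norm _).
    by apply: rate_OD => //; apply: rate_oO; apply: T_small; lra.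
Qed.

End Pathwise.

(** * Independence of the past and the present *)

Section Past.
Context d d' (Omega : measurableType d) (U : measurableType d') (R : realType).
Variables (P : probability Omega R) (X : nat -> Omega -> U).
Hypothesis X_meas : forall n, measurable_fun setT (X n).
Hypothesis X_indep : mutually_independent P X.

(** These events form a pi-system, which generates the information available before time j; the
    product rule extends from it to the generated sigma-algebra. *)
Definition past (j : nat) : set (set Omega) :=
  [set A | exists2 B : nat -> set U, (forall i, measurable (B i)) &
     A = \bigcap_(i in [set i | (i < j)%N]) (X i @^-1` B i)].

Local Notation past_type j := (g_sigma_algebraType (past j)).

Lemma preimage_measurable n B : measurable B -> measurable (X n @^-1` B).
Proof. by move=> mB; rewrite -[X in measurable X]setTI; exact: X_meas. Qed.

Lemma past_sub j : past j `<=` measurable.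
Proof.
move=> _ [B mB ->]; apply: bigcap_measurableType => i _.
exact: preimage_measurable.
Qed.

Lemma past_measurable j A : <<s past j >> A -> measurable A.
Proof.
apply: smallest_sub; first exact: sigma_algebra_measurable.
exact: past_sub.
Qed.

Lemma past_mono j k : (j <= k)%N -> <<s past j >> `<=` <<s past k >>.
Proof.
move=> jk; apply: smallest_sub; first exact: smallest_sigma_algebra.
move=> _ [B mB ->]; apply: sub_sigma_algebra.
exists (fun i => if (i < j)%N then B i else setT).
  by move=> i; case: ifP.
apply/seteqP; split => w Hw i /= ik.
  by case: ifP => // ij; exact: Hw.
by have := Hw i (leq_trans ik jk); rewrite ik.
Qed.

Lemma past_setT j : past j setT.
Proof. by exists (fun=> setT); [|apply/seteqP; split]. Qed.

Lemma past_setI j : setI_closed (past j).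
Proof.
move=> _ _ [B mB ->] [B' mB' ->]; exists (fun i => B i `&` B' i).
  by move=> i; exact: measurableI.
by rewrite -bigcapI.
Qed.

Lemma past_fun_mono j k (f : Omega -> R) : (j <= k)%N ->
  measurable_fun setT (f : past_type j -> R) ->
  measurable_fun setT (f : past_type k -> R).
Proof.
move=> jk mf _ B mB; have := mf measurableT B mB.
exact: past_mono.
Qed.

Lemma past_fun_measurable j (f : Omega -> R) :
  measurable_fun setT (f : past_type j -> R) -> measurable_fun setT f.
Proof. by move=> mf _ B mB; have := mf measurableT B mB; exact: past_measurable. Qed.

Lemma X_past j i : (i < j)%N -> measurable_fun setT (X i : past_type j -> U).
Proof.
move=> ij _ B mB; rewrite setTI; apply: sub_sigma_algebra.
exists (fun k => if k == i then B else setT); first by move=> k; case: ifP.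
apply/seteqP; split => w /= Hw.
  by move=> k _ /=; case: eqP => // ->.
by have := Hw i ij; rewrite /= eqxx.
Qed.

Fixpoint upto (n : nat) : {fset nat} :=
  if n is n'.+1 then (n' |` upto n')%fset else fset0.

Lemma in_upto i n : (i \in upto n) = (i < n)%N.
Proof.
elim: n => [|n IH] /=; first by rewrite in_fset0.
by rewrite in_fset1U IH ltnS [in RHS]leq_eqVlt.
Qed.

Local Open Scope ereal_scope.

(** Both sides are finite measures in A which agree on the generating pi-system. *)
Lemma past_indep j A B : <<s past j >> A -> measurable B ->
  P (A `&` (X j @^-1` B)) = P A * P (X j @^-1` B).
Proof.
move=> sA mB; have mE := preimage_measurable j mB.
pose c : {nonneg R} := NngNum (fine_ge0 (measure_ge0 P (X j @^-1` B))).
have cE : (c%:num)%:E = P (X j @^-1` B) by rewrite /= fineK// fin_num_measure.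
have := @g_sigma_algebra_measure_unique _ R Omega (past j)
  (@past_sub j) (fun=> setT) (fun=> past_setT j) _ (mrestr P mE) (mscale c P) (@past_setI j).
have -> : P A * P (X j @^-1` B) = mscale c P A by rewrite /= /mscale cE muleC.
apply => //.
- by rewrite bigcup_const//; exists 0%N.
- move=> _ [B0 mB0 ->]; rewrite /= /mrestr /mscale cE.
  pose B1 i := if i == j then B else B0 i.
  have mB1 i : measurable (B1 i) by rewrite /B1; case: ifP.
  have h1 := X_indep (upto j.+1) mB1; have h0 := X_indep (upto j) mB1.
  have E0 : \bigcap_(i in [set` upto j]) (X i @^-1` B1 i) =
     \bigcap_(i in [set i | (i < j)%N]) (X i @^-1` B0 i).
    apply/seteqP; split => w Hw i /= ij.
      by have := Hw i; rewrite /= in_upto /B1 => /(_ ij); rewrite ltn_eqF.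
    by move: ij; rewrite in_upto => ij; rewrite /B1 ltn_eqF//; exact: Hw.
  have E1 : \bigcap_(i in [set` upto j.+1]) (X i @^-1` B1 i) =
     \bigcap_(i in [set i | (i < j)%N]) (X i @^-1` B0 i) `&` (X j @^-1` B).
    rewrite -E0; apply/seteqP; split => w.
      move=> Hw; split.
        by move=> i /= ij; apply: Hw; rewrite /= in_fset1U ij orbT.
      by have := Hw j; rewrite /= in_fset1U eqxx /B1 eqxx => /(_ isT).
    move=> [Hw Hj] i /=; rewrite in_fset1U => /orP[/eqP ->|ij]; last exact: Hw.
    by rewrite /B1 eqxx.
  rewrite -E1 h1 /= big_fsetU1 ?in_upto ?ltnn// -h0 E0.
  by congr (P _ * _); rewrite /B1 eqxx.
- by move=> _; rewrite /= /mrestr setTI (le_lt_trans (probability_le1 P mE))// ltry.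
Qed.

(** The pair of the past and X j has a product law, so Fubini's theorem applies. *)
Lemma past_mean0 j (V : Omega -> R) (h : U -> R) :
  measurable_fun setT (V : past_type j -> R) ->
  measurable_fun setT h ->
  P.-integrable setT (fun w => (h (X j w))%:E) ->
  \int[P]_w (h (X j w))%:E = 0 ->
  P.-integrable setT (fun w => (V w * h (X j w))%:E) ->
  \int[P]_w (V w * h (X j w))%:E = 0.
Proof.
move=> mV mh ih h0 iVh.
pose idp : Omega -> past_type j := id.
have midp : measurable_fun setT idp.
  by move=> _ B mB; rewrite setTI; exact: past_measurable mB.
have mX := X_meas j.
pose idm : {mfun Omega >-> past_type j} :=
  HB.pack idp (isMeasurableFun.Build _ _ _ _ _ midp).
pose Xm : {mfun Omega >-> U} := HB.pack (X j) (isMeasurableFun.Build _ _ _ _ _ mX).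
pose Phi w := (idp w, X j w).
have mPhi : measurable_fun setT Phi by exact: measurable_fun_pair.
pose Phim : {mfun Omega >-> (past_type j * U)%type} :=
  HB.pack Phi (isMeasurableFun.Build _ _ _ _ _ mPhi).
pose P1 := distribution P idm.
pose P2 := distribution P Xm.
pose F (z : past_type j * U) := (V z.1 * h z.2)%:E.
have mF : measurable_fun setT F.
  apply/measurable_EFinP; apply: measurable_funM.
    by apply: (measurableT_comp mV); exact: measurable_fst.
  by apply: (measurableT_comp mh); exact: measurable_snd.
have prodE A : measurable A -> (P1 \x P2) A = distribution P Phim A.
  apply: product_measure_unique => A1 A2 mA1 mA2.
  rewrite /= /distribution /pushforward /= -past_indep//.
have eqint (f : past_type j * U -> \bar R) :
    \int[P1 \x P2]_z f z = \int[distribution P Phim]_z f z.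
  by apply: eq_measure_integral => A mA _; exact: prodE.
have iF : (P1 \x P2).-integrable setT F.
  apply/integrableP; split=> //; rewrite eqint.
  by have /integrableP[] := integrable_pushforward mPhi mF iVh measurableT.
transitivity (\int[distribution P Phim]_z F z).
  by rewrite (integral_pushforward mPhi mF iVh measurableT).
rewrite -eqint -(integral12_prod_meas1 iF).
apply: integral0_eq => x _.
have ih2 : P2.-integrable setT (EFin \o h).
  by apply: integrable_pushforward => //; exact/measurable_EFinP.
rewrite /fubini_F /F /=; under eq_integral do rewrite EFinM.
rewrite integralZl//.
have mEh : measurable_fun setT (EFin \o h) by exact/measurable_EFinP.
by rewrite (integral_pushforward mX mEh ih measurableT) preimage_setT h0 mule0.
Qed.

End Past.

(** * Almost sure convergence of weighted noise *)

Lemma sqr_integrable_integrable d (T : measurableType d) (R : realType)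
    (P : probability T R) (g : T -> R) : measurable_fun setT g ->
  P.-integrable setT (fun w => (g w ^+ 2)%:E) ->
  P.-integrable setT (fun w => (g w)%:E).
Proof.
move=> mg ig.
apply: (@le_integrable _ _ _ P setT _ _ (fun w => 1%:E + (g w ^+ 2)%:E)%E) => //.
- exact/measurable_EFinP.
- move=> w _; rewrite -EFinD !abse_EFin lee_fin [leRHS]ger0_norm ?addr_ge0 ?sqr_ge0//.
  have h0 := sqr_ge0 (`|g w| - 1); have h1 := sqr_ge0 `|g w|.
  by rewrite -[X in _ <= 1 + X](@real_normK _ _ (num_real _)); lra.
- apply: integrableD => //; exact: finite_measure_integrable_cst.
Qed.

(** The terms are martingale differences: H n depends on X 0, .., X (n - 1) only, while h (X n) is
    centred and independent of them. Their variances are summable, so the series converges almost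
    surely, by Kolmogorov's maximal inequality. *)
Section WeightedNoise.
Context d d' (Omega : measurableType d) (U : measurableType d') (R : realType).
Variables (P : probability Omega R) (X : nat -> Omega -> U).
Hypothesis X_meas : forall n, measurable_fun setT (X n).
Hypothesis X_indep : mutually_independent P X.
Variables (h : U -> R) (sig B : R) (c : nat -> R) (H : nat -> Omega -> R).
Hypothesis h_meas : measurable_fun setT h.
Hypothesis h_sq : forall n, P.-integrable setT (fun w => (h (X n w) ^+ 2)%:E).
Hypothesis h_mean : forall n, (\int[P]_w (h (X n w))%:E = 0)%E.
Hypothesis h_var : forall n, (\int[P]_w (h (X n w) ^+ 2)%:E <= sig%:E)%E.
Hypothesis H_past : forall n,
  measurable_fun setT (H n : g_sigma_algebraType (past X n) -> R).
Hypothesis H_le : forall n w, `|H n w| <= B.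

Let term n w := c n * (h (X n w) * H n w).

(** Freezing the partial sum at its first passage of the level e preserves the orthogonality of the
    increments, since the decision depends on the past only. The event that the maximum reaches e is
    then the event that the last value does, and the maximal inequality becomes Chebyshev's. *)
Fixpoint stopped_sum (n0 : nat) (e : R) (k : nat) (w : Omega) : R :=
  if k is k'.+1 then
    stopped_sum n0 e k' w +
      (if `|stopped_sum n0 e k' w| < e then term (n0 + k') w else 0)
  else 0.

Lemma stopped_sum_hits n0 e m w k : (k <= m)%N ->
  e <= `|\sum_(n0 <= i < n0 + k) term i w| -> e <= `|stopped_sum n0 e m w|.
Proof.
have inv j : (stopped_sum n0 e j w = \sum_(n0 <= i < n0 + j) term i w /\
    forall l, (l < j)%N -> `|\sum_(n0 <= i < n0 + l) term i w| < e) \/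
    e <= `|stopped_sum n0 e j w|.
  elim: j => [|j [[IH1 IH2]|IH]].
  - by left; split => //=; rewrite addn0 big_geq.
  - have [lt|ge] := ltP `|stopped_sum n0 e j w| e; last first.
      by right; rewrite /= ltNge ge /= addr0.
    left; split.
      by rewrite /= lt IH1 addnS big_nat_recr ?leq_addr.
    move=> l; rewrite ltnS leq_eqVlt => /orP[/eqP ->|]; last exact: IH2.
    by rewrite -IH1.
  - by right; rewrite /= ltNge IH /= addr0.
have [[E Hl]|//] := inv m.
rewrite leq_eqVlt => /orP[/eqP ->|km]; first by rewrite E.
by rewrite leNgt Hl.
Qed.

Lemma stopped_sum_mono n0 e m w :
  e <= `|stopped_sum n0 e m w| -> e <= `|stopped_sum n0 e m.+1 w|.
Proof. by move=> h1; rewrite /= ltNge h1 /= addr0. Qed.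

Let hX_past n : measurable_fun setT
  ((fun w => h (X n w)) : g_sigma_algebraType (past X n.+1) -> R).
Proof. apply: (measurableT_comp h_meas); exact: X_past. Qed.

Let hX_meas n : measurable_fun setT (fun w => h (X n w)).
Proof. by apply: (measurableT_comp h_meas); exact: X_meas. Qed.

Let stopped_coef n0 e k w : R :=
  if `|stopped_sum n0 e k w| < e then c (n0 + k)%N * H (n0 + k)%N w else 0.

Lemma stopped_sumS n0 e k w : stopped_sum n0 e k.+1 w =
  stopped_sum n0 e k w + stopped_coef n0 e k w * h (X (n0 + k)%N w).
Proof.
rewrite /= /stopped_coef /term; case: ifP => _; last by rewrite mul0r.
by congr (_ + _); ring.
Qed.

Lemma stopped_coef_past n0 e k :
  measurable_fun setT
    (stopped_sum n0 e k : g_sigma_algebraType (past X (n0 + k)) -> R) ->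
  measurable_fun setT
    (stopped_coef n0 e k : g_sigma_algebraType (past X (n0 + k)) -> R).
Proof.
move=> mS; apply: measurable_fun_ifT => //.
  apply: measurable_fun_ltr => //; exact: measurableT_comp.
exact: measurable_funM.
Qed.

Lemma stopped_sum_past n0 e k : measurable_fun setT
  (stopped_sum n0 e k : g_sigma_algebraType (past X (n0 + k)) -> R).
Proof.
elim: k => [|k IH]; first exact: measurable_cst.
have mono (f : Omega -> R) : measurable_fun setT
     (f : g_sigma_algebraType (past X (n0 + k)) -> R) ->
   measurable_fun setT (f : g_sigma_algebraType (past X (n0 + k.+1)) -> R).
  by apply: past_fun_mono; rewrite addnS.
rewrite (_ : stopped_sum n0 e k.+1 = fun w => stopped_sum n0 e k w +
    stopped_coef n0 e k w * h (X (n0 + k)%N w)); last first.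
  by apply/funext => w; exact: stopped_sumS.
apply: measurable_funD; first exact: mono.
apply: measurable_funM; first by apply: mono; exact: stopped_coef_past.
by rewrite addnS; exact: hX_past.
Qed.

Lemma stopped_sum_meas n0 e k : measurable_fun setT (stopped_sum n0 e k).
Proof. by apply: past_fun_measurable => //; exact: stopped_sum_past. Qed.

Lemma stopped_coef_meas n0 e k : measurable_fun setT (stopped_coef n0 e k).
Proof.
by apply: past_fun_measurable => //; apply: stopped_coef_past; exact: stopped_sum_past.
Qed.

Lemma stopped_coef_le n0 e k w : `|stopped_coef n0 e k w| <= `|c (n0 + k)%N| * B.
Proof.
have B0 : 0 <= B by exact: le_trans (H_le 0 w).
rewrite /stopped_coef; case: ifP => _; last by rewrite normr0 mulr_ge0.
by rewrite normrM ler_wpM2l.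
Qed.

Let h_int n : P.-integrable setT (fun w => (h (X n w))%:E).
Proof. exact: sqr_integrable_integrable (h_sq n). Qed.

(** The mixed term 2 S G z of the square of S + G z has mean 0 by [past_mean0]. *)
Lemma stopped_sum_L2 n0 e k :
  P.-integrable setT (fun w => (stopped_sum n0 e k w ^+ 2)%:E) /\
  (\int[P]_w (stopped_sum n0 e k w ^+ 2)%:E <=
     (B ^+ 2 * sig * \sum_(n0 <= i < n0 + k) c i ^+ 2)%:E)%E.
Proof.
elim: k => [|k [IH1 IH2]].
  rewrite /= addn0 big_geq// mulr0; under eq_fun do rewrite expr0n/=.
  by split; [exact: integrable0|rewrite integral0].
set n := (n0 + k)%N.
pose S := stopped_sum n0 e k; pose G := stopped_coef n0 e k.
pose z w := h (X n w).
have mS : measurable_fun setT S by exact: stopped_sum_meas.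
have mG : measurable_fun setT G by exact: stopped_coef_meas.
have mz : measurable_fun setT z by exact: hX_meas.
have Gle w : `|G w| <= `|c n| * B := stopped_coef_le n0 e k w.
have cB0 : 0 <= `|c n| * B by exact: le_trans (Gle point).
have GG w : G w ^+ 2 <= (`|c n| * B) ^+ 2.
  by rewrite -[X in X <= _](@real_normK _ _ (num_real _)) ler_sqr ?nnegrE.
have iz2 : P.-integrable setT (fun w => (z w ^+ 2)%:E) by exact: h_sq.
have i2 : P.-integrable setT (fun w => (G w ^+ 2 * z w ^+ 2)%:E).
  apply: (@le_integrable _ _ _ P setT _ _ (fun w => ((`|c n| * B) ^+ 2)%:E * (z w ^+ 2)%:E)%E) => //.
  - apply/measurable_EFinP; apply: measurable_funM; exact: measurable_funX.
  - move=> w _; rewrite -EFinM !abse_EFin lee_fin.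
    rewrite (ger0_norm (mulr_ge0 (sqr_ge0 (G w)) (sqr_ge0 (z w)))).
    rewrite (ger0_norm (mulr_ge0 (sqr_ge0 (`|c n| * B)) (sqr_ge0 (z w)))).
    by rewrite ler_wpM2r ?sqr_ge0.
  - exact: integrableZl.
have i1 : P.-integrable setT (fun w => (2 * S w * G w * z w)%:E).
  apply: (@le_integrable _ _ _ P setT _ _ (fun w => (S w ^+ 2)%:E + (G w ^+ 2 * z w ^+ 2)%:E)%E) => //.
  - apply/measurable_EFinP; apply: measurable_funM => //; apply: measurable_funM => //.
    exact: measurable_funM.
  - move=> w _; rewrite -EFinD !abse_EFin lee_fin.
    have p0 : 0 <= S w ^+ 2 + G w ^+ 2 * z w ^+ 2.
      by rewrite addr_ge0 ?sqr_ge0//; apply: mulr_ge0; exact: sqr_ge0.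
    rewrite (ger0_norm p0).
    have h1 := sqr_ge0 (S w - G w * z w); have h2 := sqr_ge0 (S w + G w * z w).
    by rewrite ler_norml; apply/andP; split; lra.
  - exact: integrableD.
have z1 : (\int[P]_w (2 * S w * G w * z w)%:E = 0)%E.
  apply: (@past_mean0 _ _ _ _ _ P X X_meas X_indep n (fun w => 2 * S w * G w)) => //.
  apply: measurable_funM; last by apply: stopped_coef_past; exact: stopped_sum_past.
  by apply: measurable_funM => //; exact: stopped_sum_past.
have E w : (stopped_sum n0 e k.+1 w ^+ 2)%:E =
    ((S w ^+ 2)%:E + (2 * S w * G w * z w)%:E + (G w ^+ 2 * z w ^+ 2)%:E)%E.
  by rewrite stopped_sumS -!EFinD; congr EFin; rewrite /S /G /z /n; ring.
have i12 : P.-integrable setT (fun w => ((S w ^+ 2)%:E + (2 * S w * G w * z w)%:E)%E).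
  exact: integrableD.
split.
  by under eq_fun do rewrite E; exact: integrableD.
under eq_integral do rewrite E.
rewrite integralD// integralD// z1 adde0.
rewrite addnS big_nat_recr ?leq_addr//= mulrDr EFinD; apply: leeD => //.
apply: (@le_trans _ _ (\int[P]_w (((`|c n| * B) ^+ 2)%:E * (z w ^+ 2)%:E))%E).
  apply: ge0_le_integral => //.
  - by move=> w _; rewrite lee_fin mulr_ge0 ?sqr_ge0.
  - by apply/measurable_EFinP; apply: measurable_funM; exact: measurable_funX.
  - apply/measurable_EFinP; apply: measurable_funM => //; exact: measurable_funX.
  - by move=> w _; rewrite -EFinM lee_fin ler_wpM2r ?sqr_ge0.
rewrite integralZl//.
apply: (@le_trans _ _ (((`|c n| * B) ^+ 2)%:E * sig%:E)%E).
  by apply: lee_wpmul2l; [rewrite lee_fin sqr_ge0|exact: h_var].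
rewrite -EFinM lee_fin exprMn (@real_normK _ _ (num_real _)) -/n; lra.
Qed.

Lemma level_set_measurable n0 e k :
  measurable [set w | e <= `|stopped_sum n0 e k w|].
Proof.
rewrite -[X in measurable X]setTI.
have := @measurable_fun_ler _ _ R setT (fun=> e) (fun w => `|stopped_sum n0 e k w|)
  (measurable_cst _) (measurableT_comp (@normr_measurable R setT) (stopped_sum_meas n0 e k)).
by move=> /(_ measurableT [set true]); apply.
Qed.

Lemma stopped_sum_chebyshev n0 e k : 0 < e ->
  (P [set w | (e <= `|stopped_sum n0 e k w|)%R] <=
     (B ^+ 2 * sig * (\sum_(n0 <= i < n0 + k) c i ^+ 2) / e ^+ 2)%:E)%E.
Proof.
move=> e0; have [iS S2] := stopped_sum_L2 n0 e k.
have mS := stopped_sum_meas n0 e k.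
set A := [set w | _].
have mA : measurable A by exact: level_set_measurable.
have e2 : 0 < e ^+ 2 by rewrite exprn_gt0.
rewrite EFinM lee_pdivlMr// muleC.
apply: le_trans S2.
apply: (@le_trans _ _ (\int[P]_(w in A) (stopped_sum n0 e k w ^+ 2)%:E)%E).
  rewrite -integral_cst//; apply: ge0_le_integral => //.
  - by move=> w _; rewrite lee_fin sqr_ge0.
  - by apply: measurable_funTS; apply/measurable_EFinP; exact: measurable_funX.
  - move=> w Aw; rewrite lee_fin -[leRHS](@real_normK _ _ (num_real _)).
    by rewrite ler_sqr ?nnegrE// ltW.
apply: ge0_subset_integral => //.
- by apply/measurable_EFinP; exact: measurable_funX.
- by move=> w _; rewrite lee_fin sqr_ge0.
Qed.

Hypothesis c_sq : cvgn (series (fun n => c n ^+ 2)).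
Hypothesis sig_ge0 : 0 <= sig.

Let crossing e n0 : set Omega :=
  \bigcup_k [set w | e <= `|stopped_sum n0 e k w|].

Lemma crossing_measurable e n0 : measurable (crossing e n0).
Proof. by apply: bigcup_measurable => k _; exact: level_set_measurable. Qed.

Lemma crossing_le e n0 (s : R) : 0 < e ->
  (forall k, \sum_(n0 <= i < n0 + k) c i ^+ 2 <= s) ->
  (P (crossing e n0) <= (B ^+ 2 * sig * s / e ^+ 2)%:E)%E.
Proof.
move=> e0 cs.
have cvgP : P [set w | e <= `|stopped_sum n0 e k w|] @[k --> \oo] --> P (crossing e n0).
  apply: nondecreasing_cvg_mu.
  - by move=> k; exact: level_set_measurable.
  - exact: crossing_measurable.
  - apply/nondecreasing_seqP => k; apply/subsetPset => w.
    exact: stopped_sum_mono.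
rewrite -(cvg_lim _ cvgP)//; apply: lime_le; first by apply/cvg_ex; eexists; exact: cvgP.
apply: nearW => k; apply: le_trans (stopped_sum_chebyshev n0 k e0) _.
rewrite lee_fin ler_wpM2r ?invr_ge0 ?sqr_ge0//.
by rewrite ler_wpM2l// mulr_ge0// sqr_ge0.
Qed.

(** The partial sums started at n0 leave a given interval with probability at most a multiple of the
    tail of the series of c i ^+ 2 beyond n0. *)
Lemma crossing_null e : 0 < e -> P (\bigcap_n0 crossing e n0) = 0%E.
Proof.
move=> e0; have mN : measurable (\bigcap_n0 crossing e n0).
  by apply: bigcapT_measurable => n0; exact: crossing_measurable.
apply/eqP; rewrite eq_le measure_ge0 andbT; apply/lee_addgt0Pr => x x0.
rewrite add0e.
have K0 : 0 < B ^+ 2 * sig + 1 by rewrite ltr_wpDl// mulr_ge0// sqr_ge0.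
have e2 : 0 < e ^+ 2 by rewrite exprn_gt0.
pose s := x * e ^+ 2 / (B ^+ 2 * sig + 1).
have s0 : 0 < s by rewrite divr_gt0// mulr_gt0.
move/cauchy_cvgP/cauchy_seriesP: c_sq => /(_ _ s0) [[A1 A2] /= [[a _ Aa] [b _ Ab]] H1].
pose n0 := (a + b)%N.
apply: (@le_trans _ _ (P (crossing e n0))).
  by apply: le_measure; rewrite ?inE//; [exact: crossing_measurable|exact: bigcap_inf].
apply: le_trans (@crossing_le e n0 s e0 _) _.
  move=> k; apply: le_trans (ler_norm _) (ltW _).
  apply: (H1 (n0, (n0 + k)%N)); split => /=.
    by apply: Aa; rewrite /= /n0 leq_addr.
  by apply: Ab; rewrite /= /n0 -addnA addnCA leq_addr.
rewrite lee_fin ler_pdivrMr// /s mulrA ler_pdivrMr//.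
have m0 := mulr_gt0 x0 e2; lra.
Qed.

(** Outside a null set, for every p the partial sums started late enough stay below 1 / (p + 1): the
    series is Cauchy. *)
Theorem weighted_noise_cvg : {ae P, forall w,
  cvgn (series (fun n => c n * (h (X n w) * H n w)))}.
Proof.
exists (\bigcup_p \bigcap_n0 crossing p.+1%:R^-1 n0); split.
- apply: bigcup_measurable => p _; apply: bigcapT_measurable => n0.
  exact: crossing_measurable.
- apply/negligibleP.
    apply: bigcup_measurable => p _; apply: bigcapT_measurable => n0.
    exact: crossing_measurable.
  apply: negligible_bigcup => p; apply/negligibleP.
    by apply: bigcapT_measurable => n0; exact: crossing_measurable.
  by apply: crossing_null; rewrite invr_gt0.
move=> w /= ncvg; apply: contrapT => nin; apply: ncvg.
apply/cauchy_cvgP/cauchy_seriesP => e e0.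
have [p pe] : exists p : nat, p.+1%:R^-1 < e / 2.
  have e2 : 0 < e / 2 by lra.
  have := @cvg_harmonic R => /cvgrPdist_lt /(_ _ e2) [p _ Hp].
  exists p; have := Hp p (leqnn p); rewrite /= sub0r normrN gtr0_norm ?invr_gt0//.
have [n0 Hn0] : exists n0, ~ crossing p.+1%:R^-1 n0 w.
  apply: contrapT => nex; apply: nin; exists p => // n0 _.
  by apply: contrapT => nc; apply: nex; exists n0.
have small k : `|\sum_(n0 <= i < n0 + k) term i w| < p.+1%:R^-1.
  rewrite ltNge; apply/negP => hit; apply: Hn0; exists k => //=.
  exact: (stopped_sum_hits (leqnn k) hit).
exists ([set n | (n0 <= n)%N], [set n | (n0 <= n)%N]) => /=.
  by split; exists n0.
move=> [n m] [/= nn nm].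
have [mn|mn] := leqP m n; first by rewrite big_geq ?normr0.
have := small (n - n0)%N; have := small (m - n0)%N; rewrite !subnKC// => h1 h2.
have E : \sum_(n0 <= i < m) term i w = \sum_(n0 <= i < n) term i w +
    \sum_(n <= i < m) term i w by rewrite -big_cat_nat// ltnW.
have -> : \sum_(n <= i < m) term i w =
   \sum_(n0 <= i < m) term i w - \sum_(n0 <= i < n) term i w by rewrite E addrC addKr.
apply: le_lt_trans (ler_normB _ _) _.
have := lt_trans h1 pe; have := lt_trans h2 pe; lra.
Qed.

End WeightedNoise.

(** * Series, expectations and measurable matrices *)

Section SeriesFacts.
Variable R : realType.

Lemma divergent_partial_sums (a : nat -> R) : (forall n, 0 < a n) ->
  (\sum_(0 <= n <oo) (a n)%:E = +oo)%E -> gamma a n @[n --> \oo] --> +oo.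
Proof.
move=> a0 asum; apply: nondecreasing_dvgn_lt.
  apply/nondecreasing_seqP => n; rewrite /gamma big_ord_recr /= lerDl.
  exact: ltW.
move=> /cvg_ex[l gl].
have : (\sum_(0 <= i < n) (a i)%:E)%E @[n --> \oo] --> l%:E.
  have -> : (fun n => \sum_(0 <= i < n) (a i)%:E)%E = EFin \o gamma a.
    by apply/funext => n /=; rewrite sumEFin /gamma big_mkord.
  by apply: cvg_EFin; [exact: nearW | exact: gl].
by move=> /cvg_lim; rewrite asum => /(_ (@ereal_hausdorff R)).
Qed.

Lemma finite_sum_cvg (u : nat -> R) : (forall n, 0 <= u n) ->
  (\sum_(0 <= n <oo) (u n)%:E < +oo)%E -> cvgn (series u).
Proof.
move=> u0 usum.
have u0' k : (0 <= k)%N -> xpredT k -> (0 <= (u k)%:E)%E by rewrite lee_fin.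
apply: nondecreasing_is_cvgn.
  apply/nondecreasing_seqP => n; rewrite seriesSr lerDl; exact: u0.
have Sfin : (\sum_(0 <= n <oo) (u n)%:E)%E \is a fin_num.
  by rewrite ge0_fin_numE//; exact: nneseries_ge0.
exists (fine (\sum_(0 <= n <oo) (u n)%:E)%E) => _ [n _ <-].
rewrite -lee_fin fineK// /series /= -sumEFin.
exact: nneseries_lim_ge.
Qed.

Lemma cvg_series_sum (I : Type) (s : seq I) (u : I -> nat -> R) :
  (forall i, cvgn (series (u i))) ->
  cvgn (series (fun n => \sum_(i <- s) u i n)).
Proof.
move=> uc; elim: s => [|i s IH].
  rewrite (_ : series _ = fun=> 0); first exact: is_cvg_cst.
  apply/funext => n; rewrite /series /=; apply: big1 => k _.
  by rewrite big_nil.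
rewrite (_ : (fun n => \sum_(j <- i :: s) u j n) =
   u i + (fun n => \sum_(j <- s) u j n)).
  exact: is_cvg_seriesD.
by apply/funext => n; rewrite big_cons.
Qed.

End SeriesFacts.

Section LinearExpectation.
Context d (T : measurableType d) (R : realType) (P : probability T R).

Lemma integral_sum_real (I : Type) (s : seq I) (g : I -> T -> R) :
  (forall i, P.-integrable setT (fun w => (g i w)%:E)) ->
  P.-integrable setT (fun w => (\sum_(i <- s) g i w)%:E) /\
  (\int[P]_w (\sum_(i <- s) g i w)%:E =
     (\sum_(i <- s) fine (\int[P]_w (g i w)%:E))%:E)%E.
Proof.
move=> ig; elim: s => [|i s [IH1 IH2]].
  under eq_fun do rewrite big_nil.
  by rewrite big_nil integral0; split => //; exact: integrable0.
have E : (fun w => (\sum_(j <- i :: s) g j w)%:E) =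
    (fun w => ((g i w)%:E + (\sum_(j <- s) g j w)%:E)%E).
  by apply/funext => w; rewrite big_cons.
rewrite E; split; first exact: integrableD.
by rewrite integralD// IH2 big_cons EFinD fineK//; exact: integrable_fin_num.
Qed.

Lemma integralZ_real (c : R) (g : T -> R) :
  P.-integrable setT (fun w => (g w)%:E) ->
  P.-integrable setT (fun w => (c * g w)%:E) /\
  fine (\int[P]_w (c * g w)%:E)%E = c * fine (\int[P]_w (g w)%:E)%E.
Proof.
move=> ig; have E : (fun w => (c * g w)%:E) = (fun w => (c%:E * (g w)%:E)%E).
  by apply/funext => w; rewrite EFinM.
split; first by rewrite E; exact: integrableZl.
rewrite E integralZl// fineM//; exact: integrable_fin_num.
Qed.

End LinearExpectation.

Section SameLaw.
Context d d' (Omega : measurableType d) (U : measurableType d') (R : realType).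
Variables (P : probability Omega R) (X : nat -> Omega -> U).
Hypothesis X_meas : forall n, measurable_fun setT (X n).
Hypothesis X_id : identically_distributed P X.

(** Both integrals are integrals with respect to the common law of X n and X 0. *)
Lemma same_law n (g : U -> R) : measurable_fun setT g ->
  P.-integrable setT (fun w => (g (X 0%N w))%:E) ->
  P.-integrable setT (fun w => (g (X n w))%:E) /\
  (\int[P]_w (g (X n w))%:E = \int[P]_w (g (X 0%N w))%:E)%E.
Proof.
move=> mg ig0.
pose Xm k : {mfun Omega >-> U} := HB.pack (X k) (isMeasurableFun.Build _ _ _ _ _ (X_meas k)).
have mEg : measurable_fun setT (EFin \o g) by exact/measurable_EFinP.
have eqd (f : U -> \bar R) : (\int[distribution P (Xm n)]_y f y =
    \int[distribution P (Xm 0%N)]_y f y)%E.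
  by apply: eq_measure_integral => A mA _; exact: X_id.
have push k : (\int[P]_w (`|(g (X k w))%:E|) =
    \int[distribution P (Xm k)]_y (abse \o (EFin \o g)) y)%E.
  have mag : measurable_fun setT (abse \o (EFin \o g)) by exact: measurableT_comp.
  have := ge0_integral_pushforward (X_meas k) P measurableT mag.
  by rewrite preimage_setT => E; symmetry; apply: E => y _ /=; rewrite lee_fin.
have eqabs : (\int[P]_w (`|(g (X n w))%:E|) = \int[P]_w (`|(g (X 0%N w))%:E|))%E.
  by rewrite !push eqd.
have ign : P.-integrable setT (fun w => (g (X n w))%:E).
  apply/integrableP; split.
    by apply/measurable_EFinP; apply: (measurableT_comp mg).
  by rewrite eqabs; have /integrableP[] := ig0.
split=> //.
have := eqd (EFin \o g).
rewrite (integral_pushforward (X_meas n) mEg ign measurableT).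
by rewrite (integral_pushforward (X_meas 0%N) mEg ig0 measurableT).
Qed.

End SameLaw.

Section MatrixMeasurability.
Context d (T : measurableType d) (R : realType).

Definition measurable_mx p q (F : T -> 'M[R]_(p, q)) :=
  forall i j, measurable_fun setT (fun w => F w i j).

Lemma measurable_mx_cst p q (A : 'M[R]_(p, q)) : measurable_mx (fun=> A).
Proof. by move=> i j; exact: measurable_cst. Qed.

Lemma measurable_mxD p q (F G : T -> 'M[R]_(p, q)) :
  measurable_mx F -> measurable_mx G -> measurable_mx (fun w => F w + G w).
Proof.
by move=> mF mG i j; under eq_fun do rewrite mxE; exact: measurable_funD.
Qed.

Lemma measurable_mxZ p q c (F : T -> 'M[R]_(p, q)) :
  measurable_mx F -> measurable_mx (fun w => c *: F w).
Proof.
by move=> mF i j; under eq_fun do rewrite mxE; exact: measurable_funM.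
Qed.

Lemma measurable_mxB p q (F G : T -> 'M[R]_(p, q)) :
  measurable_mx F -> measurable_mx G -> measurable_mx (fun w => F w - G w).
Proof.
move=> mF mG; under eq_fun do rewrite -scaleN1r.
by apply: measurable_mxD => //; exact: measurable_mxZ.
Qed.

Lemma measurable_mx_tr p q (F : T -> 'M[R]_(p, q)) :
  measurable_mx F -> measurable_mx (fun w => (F w)^T).
Proof. by move=> mF i j; under eq_fun do rewrite mxE; exact: mF. Qed.

Lemma measurable_mxM p q k (F : T -> 'M[R]_(p, q)) (G : T -> 'M[R]_(q, k)) :
  measurable_mx F -> measurable_mx G -> measurable_mx (fun w => F w *m G w).
Proof.
move=> mF mG i j; under eq_fun do rewrite mxE.
by apply: measurable_sum => l; exact: measurable_funM.
Qed.

Lemma measurable_dot p q (F : T -> 'M[R]_(p, q)) :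
  measurable_mx F -> measurable_fun setT (fun w => dot (F w) (F w)).
Proof.
move=> mF; apply: measurable_sum => i; apply: measurable_sum => j.
exact: measurable_funM.
Qed.

End MatrixMeasurability.

Lemma borel_entry_measurable (R : realType) (m n : nat) i j :
  measurable_fun setT ((fun A : 'M[R]_(m, n) => A i j) : borel_mx R m n -> R).
Proof.
move=> mD; apply: (measurability _ (RGenOInfty.measurableE R)) => // _ [_ [x ->] <-].
rewrite setTI; apply: sub_sigma_algebra => /=.
have op : open `]x, +oo[%classic by exact: rray_open.
apply: (@open_comp _ _ (fun A : 'M[R]_(m, n) => A i j)) op => A _.
exact: coord_continuous.
Qed.

(** * The recursion as a gradient step with noise *)

Section OjaField.
Variables (R : realType) (N M : nat).
Implicit Types (Z : 'M[R]_N) (A : 'M[R]_(N, M)).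

(** The direction of the recursion when the sample matrix x x^T is replaced with Z; it is linear in
    Z, so that replacing Z with its mean exhibits the noise. *)
Definition oja_field Z A : 'M[R]_(N, M) :=
  (Z *m (2 *: 1%:M - A *m A^T) - A *m A^T *m Z) *m A.

(** With Z the matrix of second moments, the direction is that of steepest descent. *)
Lemma oja_field_gradient (C : 'M[R]_N) A :
  oja_field C A = - 2^-1 *: objective_grad C A.
Proof.
rewrite /oja_field /objective_grad /residual scalerA mulNr mulrN opprK.
rewrite mulVf ?pnatr_eq0// scale1r; congr (_ *m A).
rewrite !mulmxBr !mulmxBl -scalemxAr !mulmx1 mul1mx scaler_nat mulr2n.
by rewrite addrA (addrAC C C).
Qed.

Lemma oja_fieldD Z Z' A : oja_field (Z + Z') A = oja_field Z A + oja_field Z' A.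
Proof.
rewrite /oja_field -mulmxDl; congr (_ *m A).
by rewrite mulmxDl (mulmxDr _ Z Z') opprD addrACA.
Qed.

Lemma oja_fieldZ c Z A : oja_field (c *: Z) A = c *: oja_field Z A.
Proof.
by rewrite /oja_field -scalemxAl -scalemxAr -scalerBr -scalemxAl.
Qed.

Lemma oja_field0 A : oja_field 0 A = 0.
Proof. by rewrite -(scale0r 0) oja_fieldZ scale0r. Qed.

Lemma oja_field_sum Z A : oja_field Z A =
  \sum_kl Z kl.1 kl.2 *: oja_field (delta_mx kl.1 kl.2) A.
Proof.
rewrite {1}(matrix_sum_delta Z) pair_big /=.
elim/big_ind2 : _ => [|Z1 A1 Z2 A2 <- <-|kl _]; first exact: oja_field0.
  exact: oja_fieldD.
exact: oja_fieldZ.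
Qed.

Lemma oja_field_lipschitz Z : locally_lipschitz_mx (oja_field Z).
Proof.
have cZ := @locally_lipschitz_mx_cst R N M _ _ Z.
have idl := @locally_lipschitz_mx_id R N M.
have sq : locally_lipschitz_mx (fun A : 'M[R]_(N, M) => A *m A^T).
  by apply: locally_lipschitz_mxM => //; exact: locally_lipschitz_mx_tr.
apply: locally_lipschitz_mxM => //; apply: locally_lipschitz_mxB.
  apply: locally_lipschitz_mxM => //; apply: locally_lipschitz_mxB => //.
  exact: locally_lipschitz_mx_cst.
exact: locally_lipschitz_mxM.
Qed.

Lemma measurable_oja_field d (T : measurableType d) (Z : T -> 'M[R]_N)
    (A : T -> 'M[R]_(N, M)) :
  measurable_mx Z -> measurable_mx A ->
  measurable_mx (fun w => oja_field (Z w) (A w)).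
Proof.
move=> mZ mA.
have sq : measurable_mx (fun w => A w *m (A w)^T).
  by apply: measurable_mxM => //; exact: measurable_mx_tr.
apply: measurable_mxM => //; apply: measurable_mxB; last exact: measurable_mxM.
by apply: measurable_mxM => //; apply: measurable_mxB.
Qed.

End OjaField.

Section SecondMoments.
Context d (Omega : measurableType d) (R : realType) (P : probability Omega R).
Variables (N : nat) (x : Omega -> 'cV[R]_N).
Hypothesis x_meas : measurable_mx x.
Hypothesis x_4 : (\int[P]_w (enorm (x w) ^+ 4)%:E < +oo)%E.

Definition covmx : 'M[R]_N :=
  \matrix_(k, l) fine (\int[P]_w (x w k 0 * x w l 0)%:E).

Lemma covmx_sym : covmx^T = covmx.
Proof.
apply/matrixP => k l; rewrite !mxE; congr fine.
by apply: eq_integral => w _; rewrite mulrC.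
Qed.

Lemma entry_product_measurable k l : measurable_fun setT (fun w => x w k 0 * x w l 0).
Proof. exact: measurable_funM. Qed.

Lemma sqr_entry_product_integrable k l :
  P.-integrable setT (fun w => ((x w k 0 * x w l 0) ^+ 2)%:E).
Proof.
have m4 : measurable_fun setT (fun w => enorm (x w) ^+ 4).
  under eq_fun do rewrite (exprM _ 2 2) sqr_enorm.
  by apply: measurable_funX; exact: measurable_dot.
have i4 : P.-integrable setT (fun w => (enorm (x w) ^+ 4)%:E).
  apply/integrableP; split; first exact/measurable_EFinP.
  apply: le_lt_trans x_4; apply: ge0_le_integral => //.
  - by apply: measurableT_comp => //; exact/measurable_EFinP.
  - exact/measurable_EFinP.
  - by move=> w _; rewrite abse_EFin lee_fin ger0_norm// exprn_ge0 ?enorm_ge0.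
apply: le_integrable i4 => //.
  by apply/measurable_EFinP; apply: measurable_funX; exact: entry_product_measurable.
move=> w _; rewrite !abse_EFin lee_fin !ger0_norm ?sqr_ge0 ?exprn_ge0 ?enorm_ge0//.
rewrite (exprM _ 2 2) -[leLHS]real_normK ?num_real// ler_sqr ?nnegrE ?sqr_ge0//.
by rewrite normrM expr2 ler_pM// entry_le_enorm.
Qed.

Lemma entry_product_integrable k l :
  P.-integrable setT (fun w => (x w k 0 * x w l 0)%:E).
Proof.
apply: sqr_integrable_integrable; first exact: entry_product_measurable.
exact: sqr_entry_product_integrable.
Qed.

Lemma covform_sum (C T : 'M[R]_N) : covform C T T =
  \sum_(t : 'I_N * ('I_N * 'I_N)) T t.1 t.2.1 * T t.1 t.2.2 * C t.2.1 t.2.2.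
Proof.
rewrite /covform /mxtrace -(pair_bigA _ (fun i u => T i u.1 * T i u.2 * C u.1 u.2)).
apply: eq_bigr => i _; rewrite -(pair_bigA _ (fun k l => T i k * T i l * C k l)) /=.
rewrite mxE exchange_big /=; apply: eq_bigr => l _; rewrite !mxE mulr_suml.
by apply: eq_bigr => k _; ring.
Qed.

Lemma sqr_enorm_covform (T : 'M[R]_N) (y : 'cV[R]_N) :
  enorm (T *m y) ^+ 2 = covform (y *m y^T) T T.
Proof.
by rewrite sqr_enorm dot_trace mxtrace_mulC trmx_mul /covform !mulmxA.
Qed.

(** |T x|^2 is a quadratic form in the entries of x, and its mean involves second moments only. *)
Lemma expected_sqr_enorm (T : 'M[R]_N) :
  (\int[P]_w (enorm (T *m x w) ^+ 2)%:E = (covform covmx T T)%:E)%E.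
Proof.
pose g (t : 'I_N * ('I_N * 'I_N)) w := x w t.2.1 0 * x w t.2.2 0.
pose c (t : 'I_N * ('I_N * 'I_N)) := T t.1 t.2.1 * T t.1 t.2.2.
have gE w : enorm (T *m x w) ^+ 2 = \sum_t c t * g t w.
  rewrite sqr_enorm_covform covform_sum; apply: eq_bigr => t _.
  by rewrite /c /g !mxE big_ord1 !mxE.
under eq_integral do rewrite gE.
have ig t : P.-integrable setT (fun w => (g t w)%:E) by exact: entry_product_integrable.
have [_ ->] := @integral_sum_real _ _ _ P _ (index_enum _) (fun t w => c t * g t w)
  (fun t => (integralZ_real (c t) (ig t)).1).
rewrite covform_sum; congr EFin; apply: eq_bigr => t _.
by rewrite (integralZ_real (c t) (ig t)).2 mxE.
Qed.

Lemma centered_product_moments k l :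
  [/\ P.-integrable setT (fun w => ((x w k 0 * x w l 0 - covmx k l) ^+ 2)%:E),
      P.-integrable setT (fun w => (x w k 0 * x w l 0 - covmx k l)%:E) &
      (\int[P]_w (x w k 0 * x w l 0 - covmx k l)%:E = 0)%E].
Proof.
have i1 := entry_product_integrable k l.
have i2 := sqr_entry_product_integrable k l.
have mh : measurable_fun setT (fun w => x w k 0 * x w l 0 - covmx k l).
  by apply: measurable_funB => //; exact: entry_product_measurable.
have isq : P.-integrable setT (fun w => ((x w k 0 * x w l 0 - covmx k l) ^+ 2)%:E).
  have ib : P.-integrable setT (fun w => (2%:E * ((x w k 0 * x w l 0) ^+ 2)%:E +
      (2 * covmx k l ^+ 2)%:E)%E).
    apply: integrableD => //; first exact: integrableZl.
    exact: finite_measure_integrable_cst.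
  apply: le_integrable ib => //.
    by apply/measurable_EFinP; exact: measurable_funX.
  move=> w _; rewrite -EFinM -EFinD !abse_EFin lee_fin.
  set a := x w k 0 * x w l 0; set b := covmx k l.
  have a2 := sqr_ge0 a; have b2 := sqr_ge0 b; have ab := sqr_ge0 (a + b).
  by rewrite !ger0_norm ?sqr_ge0//; lra.
split=> //; first exact: sqr_integrable_integrable.
have ic : P.-integrable setT (fun w : Omega => (covmx k l)%:E).
  exact: finite_measure_integrable_cst.
under eq_integral do rewrite EFinB.
rewrite integralB//.
rewrite integral_cst// [X in (_ * X)%E](@probability_setT _ _ _ P) mule1 mxE fineK ?subee//.
all: exact: integrable_fin_num.
Qed.

End SecondMoments.

(** * Summability of the noise of the recursion *)

Section NoiseConvergence.
Context d (Omega : measurableType d) (R : realType) (P : probability Omega R).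
Variables (N M : nat) (X : nat -> Omega -> borel_mx R N 1).
Variables (alpha c : nat -> R) (Theta0 : 'M[R]_(N, M)).
Variable Theta : nat -> Omega -> 'M[R]_(N, M).
Hypothesis X_iid : iid P X.
Hypothesis X_4 : (\int[P]_w (enorm (X 0%N w : 'cV[R]_N) ^+ 4)%:E < +oo)%E.
Hypothesis Theta_start : forall w, Theta 0%N w = Theta0.
Hypothesis Theta_step : forall n w, Theta n.+1 w = Theta n w +
  alpha n *: oja_field ((X n w : 'cV[R]_N) *m (X n w : 'cV[R]_N)^T) (Theta n w).
Hypothesis c_sq : cvgn (series (fun n => c n ^+ 2)).

Let C := covmx P (X 0%N).

Let X_meas n : measurable_fun setT (X n).
Proof. by have [] := X_iid. Qed.

Let X_entries n : measurable_mx (X n : Omega -> 'cV[R]_N).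
Proof. by move=> i j; exact: measurableT_comp (borel_entry_measurable i j) (X_meas n). Qed.

Lemma iterate_past n : @measurable_mx _ (g_sigma_algebraType (past X n)) R N M (Theta n).
Proof.
elim: n => [|n IH].
  by rewrite (_ : Theta 0%N = fun=> Theta0);
    [exact: measurable_mx_cst|exact/funext].
rewrite (_ : Theta n.+1 = fun w => Theta n w +
  alpha n *: oja_field ((X n w : 'cV[R]_N) *m (X n w : 'cV[R]_N)^T) (Theta n w));
  last by apply/funext => w; exact: Theta_step.
have mT : @measurable_mx _ (g_sigma_algebraType (past X n.+1)) R N M (Theta n).
  by move=> i j; apply: (past_fun_mono (leqnSn n)); exact: IH.
have mX : @measurable_mx _ (g_sigma_algebraType (past X n.+1)) R N 1 (X n).
  by move=> i j; apply: measurableT_comp (borel_entry_measurable i j) _; exact: X_past.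
apply: measurable_mxD => //; apply: measurable_mxZ.
apply: measurable_oja_field => //; apply: measurable_mxM => //.
exact: measurable_mx_tr.
Qed.

Let centered k l (y : borel_mx R N 1) : R :=
  (y : 'cV[R]_N) k 0 * (y : 'cV[R]_N) l 0 - C k l.

Let centered_meas k l : measurable_fun setT (centered k l).
Proof.
apply: measurable_funB => //; apply: measurable_funM; exact: borel_entry_measurable.
Qed.

(** Capping makes the factor that depends on the past bounded, as [weighted_noise_cvg] requires; on a
    bounded path no term is changed once q is large enough. *)
Let capped_field (q : R) k l i j n w : R :=
  if dot (Theta n w) (Theta n w) <= q
  then oja_field (delta_mx k l) (Theta n w) i j else 0.

Lemma capped_noise_cvg (q : R) k l i j :
  {ae P, forall w, cvgn (series (fun n =>
     c n * (centered k l (X n w) * capped_field q k l i j n w)))}.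
Proof.
have [_ X_indep X_id] := X_iid.
have [i2 i1 m0] := centered_product_moments (X_entries 0) X_4 k l.
have [B B0 HB] := locally_lipschitz_mx_bounded (@oja_field_lipschitz R N M (delta_mx k l)) (Num.sqrt q).
have law2 n := same_law X_meas X_id n (measurable_funX 2 (@centered_meas k l)) i2.
have law1 n := same_law X_meas X_id n (@centered_meas k l) i1.
apply: (@weighted_noise_cvg _ _ _ _ _ P X X_meas X_indep (centered k l)
  (fine (\int[P]_w (centered k l (X 0%N w) ^+ 2)%:E)) B c (capped_field q k l i j)) => //.
- by move=> n; have [] := law2 n.
- by move=> n; have [_ ->] := law1 n.
- move=> n; have [_ ->] := law2 n.
  by rewrite fineK//; exact: integrable_fin_num i2.
- move=> n; apply: measurable_fun_ifT => //.
    by apply: measurable_fun_ler => //; apply: measurable_dot; exact: iterate_past.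
  apply: measurable_oja_field; [exact: measurable_mx_cst|exact: iterate_past].
- move=> n w; rewrite /capped_field; case: ifP => [le|_]; last by rewrite normr0.
  apply: le_trans (entry_le_enorm _ i j) _; apply: HB.
  by rewrite enormE ler_wsqrtr.
- by rewrite fine_ge0// integral_ge0// => w _; rewrite lee_fin sqr_ge0.
Qed.

(** The noise is a finite sum of products of a centred second-order monomial of X n and a function of
    Theta n. The exceptional null sets of the countably many caps are put together before the path,
    and with it the cap, is chosen. *)
Lemma oja_noise_cvg :
  {ae P, forall w, (exists Q, forall n, enorm (Theta n w) <= Q) ->
    forall i j, cvgn (series (fun n => c n *
      oja_field ((X n w : 'cV[R]_N) *m (X n w : 'cV[R]_N)^T - C) (Theta n w) i j))}.
Proof.
have H : {ae P, forall w, forall q : nat, forall kl : 'I_N * 'I_N,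
    forall ij : 'I_N * 'I_M, cvgn (series (fun n => c n *
     (centered kl.1 kl.2 (X n w) * capped_field q%:R kl.1 kl.2 ij.1 ij.2 n w)))}.
  apply: ae_foralln => q; apply: filter_forall => kl; apply: filter_forall => ij.
  exact: capped_noise_cvg.
apply: filterS H => w H [Q HQ] i j.
pose q := Num.bound (Q ^+ 2).
have cap n : dot (Theta n w) (Theta n w) <= q%:R.
  rewrite -sqr_enorm; apply: le_trans (ltW (archi_boundP (sqr_ge0 Q))).
  have Q0 : 0 <= Q by exact: le_trans (enorm_ge0 _) (HQ 0%N).
  by rewrite ler_sqr ?nnegrE ?enorm_ge0.
pose term kl n := c n *
  (centered kl.1 kl.2 (X n w) * capped_field q%:R kl.1 kl.2 i j n w).
rewrite (_ : (fun n => _) = fun n => \sum_kl term kl n).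
  by apply: cvg_series_sum => kl; exact: H q kl (i, j).
apply/funext => n.
rewrite oja_field_sum summxE mulr_sumr; apply: eq_bigr => kl _; congr (_ * _).
by rewrite /capped_field cap /centered /= !mxE big_ord1 !mxE.
Qed.

End NoiseConvergence.

(** * Landau relations and extended exponents *)

Section RatesInTime.
Variable R : realType.

(** A gap between the exponents turns a bounded ratio into one that tends to 0. *)
Lemma rate_O_gap (g u : nat -> R) (s t : R) :
  g n @[n --> \oo] --> +oo -> t < s ->
  rate_O u (fun n => g n `^ (- s)) -> rate_o u (fun n => g n `^ (- t)).
Proof.
move=> gy ts [K K0 [n0 H]] e e0.
have st : 0 < s - t by rewrite subr_gt0.
pose a := (K / e) `^ (s - t)^-1.
move/cvgryPge: gy => /(_ (a + 1))[n1 _ H1].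
exists (n0 + n1)%N => n nn.
have gn : a + 1 <= g n by apply: H1 => /=; nat_lia.
have a0 : 0 <= a by exact: powR_ge0.
have g0 : 0 < g n by lra.
apply: le_trans (H n ltac:(nat_lia)) _.
have -> : - t = (s - t) + - s by ring.
rewrite powRD; last by rewrite [g n == 0]gt_eqF// implybT.
rewrite mulrA ler_wpM2r ?powR_ge0// mulrC -ler_pdivrMr//.
have -> : K / e = a `^ (s - t).
  by rewrite /a -powRrM mulVf ?gt_eqF// powRr1// divr_ge0// ltW.
by apply: ge0_ler_powR; rewrite ?nnegrE ?(ltW st)//; lra.
Qed.

Lemma rate_o_littleo (u v : nat -> R) : rate_o u v -> u =o_\oo v.
Proof.
move=> H; apply/eqoP => e e0; have [n0 Hn] := H e e0.
exists n0 => // n /= nn; apply: le_trans (Hn n nn) _.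
by rewrite ler_wpM2l ?ler_norm// ltW.
Qed.

Lemma rate_O_bigO (u v : nat -> R) : rate_O u v -> u =O_\oo v.
Proof.
move=> [K K0 [n0 Hn]]; apply/eqO_exP; exists K => //.
exists n0 => // n /= nn; apply: le_trans (Hn n nn) _.
by rewrite ler_wpM2l ?ler_norm// ltW.
Qed.

Lemma rate_o_norm (u v : nat -> R) : rate_o u v -> rate_o (fun n => `|u n|) v.
Proof. by move=> H e /H[n0 Hn]; exists n0 => n; rewrite normr_id; exact: Hn. Qed.

Lemma rate_O_norm (u v : nat -> R) : rate_O u v -> rate_O (fun n => `|u n|) v.
Proof.
by move=> [K K0 [n0 Hn]]; exists K => //; exists n0 => n; rewrite normr_id; exact: Hn.
Qed.

Lemma ereal_sup_range_bounded (u : nat -> R) :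
  (ereal_sup (range (fun n => (u n)%:E)) < +oo)%E -> exists Q, forall n, u n <= Q.
Proof.
move=> Sy; set S := ereal_sup _ in Sy.
have uS n : ((u n)%:E <= S)%E by apply: ereal_sup_ubound; exists n.
have Sfin : S \is a fin_num.
  by apply: fin_real; rewrite Sy andbT (lt_le_trans _ (uS 0%N))// ltNyr.
by exists (fine S) => n; rewrite -lee_fin fineK.
Qed.

(** For mu = 2 both sides hold, as the exponent is infinite. *)
Lemma r_exp_gt (r mu : R) : 1 < mu <= 2 -> (r%:E < r_exp mu)%E = (r * (2 - mu) < 1).
Proof.
move=> /andP[_ mu2]; rewrite /r_exp; have [lt|ge] := ltP mu 2.
  by rewrite lte_fin -ltr_pdivlMr ?subr_gt0// div1r.
have -> : mu = 2 by apply/eqP; rewrite eq_le mu2.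
by rewrite subrr mulr0 ltr01 ltry.
Qed.

Lemma min_exp_lt (r mu : R) : (r%:E < r_exp mu)%E -> min_exp r mu = r.
Proof. by move=> lt; rewrite /min_exp min_l// ltW. Qed.

Lemma min_exp_ge (r mu : R) : (r_exp mu <= r%:E)%E -> min_exp r mu = (2 - mu)^-1.
Proof.
move=> le; rewrite /min_exp min_r//; move: le; rewrite /r_exp.
by case: ifP => // _; rewrite leye_eq.
Qed.

End RatesInTime.

(** * Convergence of the recursion *)

Theorem theorem5p2 (R : realType) (N M : nat) (hMN : (M <= N)%N)
    (hM : (1 < M)%N)
    (d : measure_display) (Omega : measurableType d) (P : probability Omega R)
    (X : nat -> Omega -> 'cV[R]_N)
    (hX : iid P (X : nat -> Omega -> borel_mx R N 1))
    (hX4 : ('E_P[fun w => (enorm (X 0%N w) ^+ 4)%R] < +oo)%E)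
    (f : 'M[R]_(N, M) -> R)
    (hf : forall Theta, f Theta =
       fine ('E_P[fun w =>
         (enorm (X 0%N w - Theta *m Theta^T *m X 0%N w) ^+ 2)%R])%E)
    (Theta0 : 'M[R]_(N, M)) (alpha : nat -> R)
    (Theta : nat -> Omega -> 'M[R]_(N, M))
    (hTheta0 : forall w, Theta 0%N w = Theta0)
    (hTheta : forall n w, Theta n.+1 w = Theta n w + alpha n *:
       ((X n w *m (X n w)^T *m (2 *: 1%:M - Theta n w *m (Theta n w)^T)
         - Theta n w *m (Theta n w)^T *m X n w *m (X n w)^T) *m Theta n w))
    (halpha0 : forall n, 0 < alpha n)
    (halpha_lim : alpha n @[n --> \oo] --> 0)
    (halpha_inv : (limn_esup
       (fun n => (`|(alpha n.+1)^-1 - (alpha n)^-1|%R)%:E) < +oo)%E)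
    (halpha_sum : (\sum_(0 <= n <oo) (alpha n)%:E = +oo)%E)
    (r : R) (hr : 1 < r)
    (halpha_r : (\sum_(0 <= n <oo)
       (alpha n ^+ 2 * gamma alpha n `^ (2 * r))%R%:E < +oo)%E)
    (delta mu K : 'M[R]_(N, M) -> R)
    (hdelta : forall A, 0 < delta A <= 1)
    (hmu : forall A, 1 < mu A <= 2)
    (hK : forall A, 1 <= K A)
    (hLoj : forall A A' : 'M[R]_(N, M), enorm (A' - A) <= delta A ->
       `|f A' - f A| <= K A * enorm (grad f A') `^ mu A) :
  let bounded w :=
    (ereal_sup (range (fun n => (enorm (Theta n w))%:E)) < +oo)%E in
  let That w : 'M[R]_(N, M) := limn (fun n => Theta n w) in
  let rhat w := r_exp (mu (That w)) in
  let phat w := p_exp r (mu (That w)) in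
  let qhat w := q_exp r (mu (That w)) in
  let p := Num.min 1 r in
  [/\ {ae P, forall w, bounded w ->
        cvgn (fun n => Theta n w) /\ grad f (That w) = 0},
      {ae P, forall w, bounded w -> (r%:E < rhat w)%E ->
        [/\ (fun n => enorm (grad f (Theta n w)) ^+ 2) =o_\oo
              (fun n => gamma alpha n `^ (- phat w)),
            (fun n => `|f (Theta n w) - f (That w)|) =o_\oo
              (fun n => gamma alpha n `^ (- phat w)) &
            (fun n => enorm (Theta n w - That w)) =o_\oo
              (fun n => gamma alpha n `^ (- qhat w))]},
      {ae P, forall w, bounded w -> (rhat w <= r%:E)%E ->
        [/\ (fun n => enorm (grad f (Theta n w)) ^+ 2) =O_\oo
              (fun n => gamma alpha n `^ (- phat w)),
            (fun n => `|f (Theta n w) - f (That w)|) =O_\oo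
              (fun n => gamma alpha n `^ (- phat w)) &
            (fun n => enorm (Theta n w - That w)) =O_\oo
              (fun n => gamma alpha n `^ (- qhat w))]} &
      {ae P, forall w, bounded w ->
        (fun n => enorm (grad f (Theta n w)) ^+ 2) =o_\oo
          (fun n => gamma alpha n `^ (- p)) /\
        (fun n => `|f (Theta n w) - f (That w)|) =o_\oo
          (fun n => gamma alpha n `^ (- p))}].
Proof.
move=> bounded That rhat phat qhat p.
have X4 : (\int[P]_w (enorm (X 0%N w) ^+ 4)%:E < +oo)%E by move: hX4; rewrite unlock.
pose C := covmx P (X 0%N).
have C_sym : C^T = C by exact: covmx_sym.
have X0_entries : measurable_mx (X 0%N).
  have [X_meas _ _] := hX.
  by move=> i j; exact: measurableT_comp (borel_entry_measurable i j) (X_meas 0%N).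
have fE : f = objective C.
  apply/funext => A; rewrite hf unlock /=.
  under eq_integral => w _.
    rewrite (_ : _ - _ = residual A *m X 0%N w); last by rewrite mulmxBl mul1mx.
    over.
  by rewrite (expected_sqr_enorm X0_entries X4).
have gradE : grad f = objective_grad C.
  by apply/funext => A; rewrite fE grad_objective.
have gamma_cvg := divergent_partial_sums halpha0 halpha_sum.
pose c n := alpha n * gamma alpha n `^ r.
have c_sq : cvgn (series (fun n => c n ^+ 2)).
  apply: finite_sum_cvg => [n|]; first exact: sqr_ge0.
  congr (_ < _)%E: halpha_r; apply: eq_eseriesr => n _; congr EFin.
  by rewrite /c exprMn (mulrC 2) powRrM powR_mulrn ?powR_ge0.
have step n w : Theta n.+1 w = Theta n w +
    alpha n *: oja_field (X n w *m (X n w)^T) (Theta n w).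
  by rewrite hTheta /oja_field !mulmxA.
(* All the claims come from one almost sure statement, in which both exponents of
   the value exceed 1. *)
have core : {ae P, forall w, bounded w ->
  [/\ Theta n w @[n --> \oo] --> That w, grad f (That w) = 0,
      (r%:E < rhat w)%E ->
        [/\ rate_o (fun n => enorm (grad f (Theta n w)) ^+ 2)
              (fun n => gamma alpha n `^ (- phat w)),
            rate_o (fun n => `|f (Theta n w) - f (That w)|)
              (fun n => gamma alpha n `^ (- phat w)),
            rate_o (fun n => enorm (Theta n w - That w))
              (fun n => gamma alpha n `^ (- qhat w)) & 1 < phat w] &
      (rhat w <= r%:E)%E ->
        [/\ rate_O (fun n => enorm (grad f (Theta n w)) ^+ 2)
              (fun n => gamma alpha n `^ (- phat w)),
            rate_O (fun n => `|f (Theta n w) - f (That w)|)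
              (fun n => gamma alpha n `^ (- phat w)),
            rate_O (fun n => enorm (Theta n w - That w))
              (fun n => gamma alpha n `^ (- qhat w)) & 1 < phat w]]}.
  apply: filterS (oja_noise_cvg hX X4 hTheta0 step c_sq) => w noise_w bw.
  have [Q HQ] := ereal_sup_range_bounded bw.
  pose xi n := oja_field (X n w *m (X n w)^T - C) (Theta n w).
  have recursion n : Theta n.+1 w =
      Theta n w + alpha n *: (- 2^-1 *: objective_grad C (Theta n w) + xi n).
    by rewrite step -oja_field_gradient -oja_fieldD [C + _]addrC subrK.
  have lojasiewicz A A' : enorm (A' - A) <= delta A ->
     `|objective C A' - objective C A| <= K A * enorm (objective_grad C A') `^ mu A.
    by rewrite -gradE -fE; exact: hLoj.
  have delta_gt0 A : 0 < delta A by have /andP[] := hdelta A.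
  have [A [Acvg A0 Ao AO]] := pathwise_convergence C_sym hr halpha0 halpha_lim
    gamma_cvg recursion HQ (noise_w (ex_intro _ Q HQ)) delta_gt0 hmu hK lojasiewicz.
  have TE : That w = A by apply: cvg_lim => //; exact: norm_hausdorff.
  have /andP[mu1 mu2] := hmu A.
  rewrite /phat /qhat /rhat TE gradE fE.
  split=> //.
    move=> lt; have lt' := lt; rewrite r_exp_gt// in lt'.
    have [h1 h2 h3] := Ao lt'; rewrite /p_exp /q_exp min_exp_lt//.
    split=> //; first exact: rate_o_norm.
    by rewrite mulr_egt1.
  move=> le; have ge : 1 <= r * (2 - mu A) by rewrite leNgt -r_exp_gt// -leNgt.
  have [h1 h2 h3] := AO ge; rewrite /p_exp /q_exp min_exp_ge//.
  split=> //; first exact: rate_O_norm.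
  by rewrite ltr_pdivlMr; nra.
have p1 : p = 1 by rewrite /p min_l// ltW.
split.
- by apply: filterS core => w H /H[Acvg A0 _ _]; split=> //; exact: cvgP Acvg.
- apply: filterS core => w H /H[_ _ + _] lt => /(_ lt)[h1 h2 h3 _].
  by split; exact: rate_o_littleo.
- apply: filterS core => w H /H[_ _ _ +] le => /(_ le)[h1 h2 h3 _].
  by split; exact: rate_O_bigO.
- apply: filterS core => w H /H[_ _ Ho HO]; rewrite p1.
  have [lt|le] := ltP r%:E (rhat w).
    have [/rate_oO h1 /rate_oO h2 _ ph] := Ho lt.
    by split; apply: rate_o_littleo; exact: rate_O_gap gamma_cvg ph _.
  have [h1 h2 _ ph] := HO le.
  by split; apply: rate_o_littleo; exact: rate_O_gap gamma_cvg ph _.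
Qed.
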